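(* Consider the stochastic volatility model $U_i=\sqrt{V_i}\,\eta_i$, $i=1,\dots,n$, where $(\eta_i)$ is an i.i.d. sequence, $(V_i)$ is a stationary sequence of positive random variables, and the sequences $(V_i)$ and $(\eta_i)$ are independent. Set $Z_i=\ln(U_i^2)$, $X_i=\ln(V_i)$, $\varepsilon_i=\ln(\eta_i^2)$, so that $Z_i=X_i+\varepsilon_i$, and suppose $X_1$ has a density $g$. Assume that $\eta_1^2$ has the Gamma density $e^{-x}x^{p-1}\Gamma(p)^{-1}\mathbf{1}_{x>0}$ with $p>0$, so that $f_\varepsilon^*(x)=\Gamma(p+ix)/\Gamma(p)$. Assume that $(X_k)=(\ln V_k)$ is $\beta$-mixing with coefficients satisfying $\sum_k\beta_k<+\infty$. For $\lambda>0$ let $h(\lambda)=\mathbb{E}(V_1e^{-\lambda V_1})$, $\psi_\lambda(x)=e^{x-\lambda e^x}$, $\psi_\lambda^*(x)=\lambda^{-1-ix}\Gamma(1+ix)$, and, for a positive integer $m$, $$\hat h_m(\lambda)=\frac{1}{2\pi n}\sum_{k=1}^n\int_{|t|\le\pi m}e^{itZ_k}\frac{\psi_\lambda^*(-t)}{f_\varepsilon^*(t)}\,dt .$$ Then, for $\lambda>0$, $$\mathbb{E}[(\hat h_m(\lambda)-h(\lambda))^2]\le Kme^{-\pi^2m}+\frac{K'\left(m^{(3-2p)\vee0}\mathbf{1}_{p\ne3/2}+\ln(m)\mathbf{1}_{p=3/2}\right)}{n}+\frac{K''\sum_k\beta_k}{n},$$ where $K$, $K'$ and $K''$ are positive constants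 (not depending on $m$ and $n$).
   Context: For a function $u\in\mathbb{L}^1(\mathbb{R})$, $u^*(x)=\int e^{ixt}u(t)\,dt$; $f_\varepsilon$ denotes the density of $\varepsilon_1$; $\Gamma$ is the Gamma function; $a\vee b=\max(a,b)$; $\mathbf{1}$ denotes an indicator. $\beta_k=\beta(\sigma(X_i,i\le0),\sigma(X_i,i\ge k))$, $k\ge0$, are the usual $\beta$-mixing (absolute regularity) coefficients of $(X_i)$. *)

(* Defs.v *)
From HB Require Import structures.
From mathcomp Require Import all_boot all_order all_algebra.
From mathcomp Require Import complex.
From mathcomp Require Import all_classical all_reals all_analysis.

Set Implicit Arguments.
Unset Strict Implicit.
Unset Printing Implicit Defensive.
Import Order.TTheory GRing.Theory Num.Theory.
Import numFieldNormedType.Exports.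

Local Open Scope classical_set_scope.
Local Open Scope ring_scope.
Local Open Scope complex_scope.

Section complex_valued.
Context {R : realType}.

Definition expi (x : R) : R[i] := cos x +i* sin x.

Definition Cintegral (D : set R) (f : R -> R[i]) : R[i] :=
  (\int[lebesgue_measure]_(t in D) complex.Re (f t))
    +i* (\int[lebesgue_measure]_(t in D) complex.Im (f t)).

(* No 1/(2 pi) factor, and a plus sign in the exponent. *)
Definition fourier (u : R -> R) (x : R) : R[i] :=
  Cintegral setT (fun t => expi (x * t) * (u t)%:C).

End complex_valued.

Section gamma.
Context {R : realType}.

Definition Gamma (p : R) : R :=
  \int[lebesgue_measure]_(x in `]0, +oo[) (x `^ (p - 1) * expR (- x)).

Definition gamma_density (p x : R) : R :=
  if 0 < x then expR (- x) * x `^ (p - 1) / Gamma p else 0.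

End gamma.

Section processes.
Context {d : measure_display} {T : measurableType d} {R : realType}.
Variable P : probability T R.

Definition has_density (X : T -> R) (f : R -> R) : Prop :=
  [/\ measurable_fun setT f, forall x, 0 <= f x
    & forall A : set R, measurable A ->
        P (X @^-1` A) = (\int[lebesgue_measure]_(x in A) (f x)%:E)%E].

Definition sigma_family (X : int -> T -> R) (J : set int) : set (set T) :=
  <<s \bigcup_(j in J) preimage_set_system setT (X j) measurable >>.

Definition independent_families (X Y : int -> T -> R) : Prop :=
  forall A B, sigma_family X setT A -> sigma_family Y setT B ->
    P (A `&` B) = (P A * P B)%E.

Definition mutually_independent (X : int -> T -> R) : Prop :=
  forall (s : seq int) (A : int -> set R), uniq s ->
    (forall i, measurable (A i)) ->
    P (\bigcap_(i in [set` s]) (X i @^-1` A i)) =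
    (\prod_(i <- s) P (X i @^-1` A i))%E.

Definition identically_distributed (X : int -> T -> R) : Prop :=
  forall (i j : int) (A : set R), measurable A ->
    P (X i @^-1` A) = P (X j @^-1` A).

Definition iid (X : int -> T -> R) : Prop :=
  mutually_independent X /\ identically_distributed X.

(* Strict stationarity: the finite-dimensional laws are invariant under time
   shifts. *)
Definition stationary (X : int -> T -> R) : Prop :=
  forall (n : nat) (t : 'I_n -> int) (k : int) (B : set (n.-tuple R)),
    measurable B ->
    P [set w | B [tuple X (t j + k) w | j < n]] =
    P [set w | B [tuple X (t j) w | j < n]].

Definition finite_partition (F : set (set T)) (I : nat) (A : 'I_I -> set T) :=
  [/\ forall i, F (A i), trivIset setT A & \bigcup_i A i = setT].

(* Volkonskii-Rozanov absolute regularity coefficient of two sigma-algebras,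
   with the usual normalisation by 1/2. Blocks of a partition may be empty,
   which does not affect the supremum. *)
Definition beta_coef (F G : set (set T)) : \bar R :=
  ereal_sup [set s : \bar R |
    exists (I J : nat) (A : 'I_I -> set T) (B : 'I_J -> set T),
      [/\ finite_partition F A, finite_partition G B
        & s = ((2^-1)%:E * \sum_(i < I) \sum_(j < J)
                `|P (A i `&` B j) - P (A i) * P (B j)|)%E]].

Definition beta_mixing_coef (X : int -> T -> R) (k : nat) : \bar R :=
  beta_coef (sigma_family X [set i | i <= 0])
            (sigma_family X [set i | k%:Z <= i]).

End processes.

Section stochastic_volatility.
Context {T : Type} {R : realType}.
Variables V eta : int -> T -> R.

Definition sv_U (i : int) (w : T) : R := Num.sqrt (V i w) * eta i w.
Definition sv_Z (i : int) (w : T) : R := ln (sv_U i w ^+ 2).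
Definition sv_X (i : int) (w : T) : R := ln (V i w).
Definition sv_eps (i : int) (w : T) : R := ln (eta i w ^+ 2).

End stochastic_volatility.

Section estimation.
Context {R : realType}.

Definition psi (lambda x : R) : R := expR (x - lambda * expR x).

(* Z is the sequence of observations and f_eps the density of the noise. The
   value is a complex number with zero imaginary part, because the integrand at
   -t is conjugate to the integrand at t. *)
Definition h_hat {T : Type} (Z : int -> T -> R) (f_eps : R -> R)
    (m n : nat) (lambda : R) (w : T) : R[i] :=
  ((2 * pi * n%:R)^-1)%:C *
  \sum_(1 <= k < n.+1)
    Cintegral [set t | `|t| <= pi * m%:R]
      (fun t => expi (t * Z k%:Z w) *
                (fourier (psi lambda) (- t) / fourier f_eps t)).

Definition h_target {d : measure_display} {T : measurableType d}
    (P : probability T R) (V : int -> T -> R) (lambda : R) : R :=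
  fine ('E_P[fun w => (V 1 w * expR (- (lambda * V 1 w)))%R])%E.

Definition variance_rate (p : R) (m : nat) : R :=
  m%:R `^ Num.max (3 - 2 * p) 0 * (p != 3 / 2)%:R
  + ln m%:R * (p == 3 / 2)%:R.

End estimation.

(* Main.v *)
(* Write w a l x = exp (a x - l e^x), so that psi_lambda = w 1 lambda and the
   noise has density w p 1 / Gamma(p). Integration by parts gives the Fourier
   transforms of these weights the recurrence of |Gamma(a + i t)|^2, namely
   multiplication by (a^2 + t^2) / l^2 when a increases by 1. Iterating it, comparing
   the resulting products with integrals, replaces Stirling's formula: it yields
   |psi_lambda^*(t)|^2 = O((1 + t^2)^(1/2) e^(- pi |t|)) and
   |psi_lambda^*(t) / f_eps^*(t)|^2 = O((1 + t^2)^(1 - p)).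

   The estimator is an average of H(Z_k) for a bounded function H. Let
   B(x) = E H(x + eps), which is the inverse Fourier integral of psi_lambda^*
   over |t| <= pi m. Then the estimator minus h(lambda) is the sum of
   - the average of H(X_k + eps_k) - B(X_k): these terms are orthogonal because
     the noises are independent, and since f_eps^*(u) = O(1 / (1 + u^2)), Schur's
     test bounds their variance by the integral over |t| <= pi m of
     |psi_lambda^* / f_eps^*|^2;
   - the average of B(X_k) - E B(X_1), whose variance is controlled by the mixing
     coefficients because B is bounded independently of m;
   - the bias E B(X_1) - h(lambda), bounded uniformly by the tail of
     psi_lambda^* over |t| > pi m. *)

Require Import Defs.
From HB Require Import structures.
From mathcomp Require Import all_boot all_order all_algebra.
From mathcomp Require Import complex.
From mathcomp Require Import all_classical all_reals all_analysis.
From mathcomp Require Import measurable_realfun ring lra.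

Set Implicit Arguments.
Unset Strict Implicit.
Unset Printing Implicit Defensive.
Import Order.TTheory GRing.Theory Num.Theory.
Import numFieldNormedType.Exports.

Local Open Scope classical_set_scope.
Local Open Scope ring_scope.
Local Open Scope complex_scope.

(** The bias term has to come out with the exact power of m and the exact rate pi^2, so the tail of
    psi_lambda^* beyond A = pi m must be of order sqrt(A) e^(-pi A / 2). This is why the products
    are compared with integrals by convexity, which loses only constant factors. Gamma at a complex
    argument never appears: only squared moduli and real and imaginary parts are handled. Schur's
    test stands in for Plancherel's theorem. Given X_k = x, the second moment of H(x + eps) is a
    double integral over frequencies t, s that involves the characteristic function of the noise at
    s - t and s + t only, and its decay makes that quadratic form bounded. Mixing coefficients speak
    of events, so bounded functions are written as integrals of the indicators of their level sets
    before covariances are estimated. At p = 3/2 the rate ln m vanishes for m = 1 although the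
    variance does not; the missing 1/n is then charged to the term m e^(-pi^2 m). The sup norm of H
    grows with m. It is used for integrability only and enters none of the constants. *)

Notation "m .-rint f" := (m.-integrable setT (EFin \o f)) (at level 9, f at level 9).

(** * Real-valued integrals over the whole space *)

Section rint.
Context d (T : measurableType d) (R : realType) (m : {measure set T -> \bar R}).
Implicit Types f g h : T -> R.

Lemma rint_measurable f : m.-rint f -> measurable_fun setT f.
Proof. by move=> /measurable_int/measurable_EFinP. Qed.

Lemma rint_dom f g : measurable_fun setT f -> (forall x, `|f x| <= g x) ->
  m.-rint g -> m.-rint f.
Proof.
move=> mf fg; apply: le_integrable => //; first exact/measurable_EFinP.
by move=> x _ /=; rewrite lee_fin (le_trans (fg x))// ler_norm.
Qed.

Lemma rintD f g : m.-rint f -> m.-rint g -> m.-rint (fun x => f x + g x).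
Proof. by move=> hf hg; exact: (integrableD _ hf hg). Qed.

Lemma rintB f g : m.-rint f -> m.-rint g -> m.-rint (fun x => f x - g x).
Proof. by move=> hf hg; exact: (integrableB _ hf hg). Qed.

Lemma rintZ f k : m.-rint f -> m.-rint (fun x => k * f x).
Proof. by move=> hf; exact: (integrableZl _ k hf). Qed.

Lemma rint_abs f : m.-rint f -> m.-rint (fun x => `|f x|).
Proof. by move=> hf; exact: (integrable_norm hf). Qed.

Lemma rintM h f M : measurable_fun setT h -> (forall x, `|h x| <= M) ->
  m.-rint f -> m.-rint (fun x => h x * f x).
Proof.
move=> mh hM hf; apply: (@rint_dom _ (fun x => M * `|f x|)).
- by apply: measurable_funM => //; exact: rint_measurable.
- by move=> x; rewrite normrM ler_wpM2r.
- exact/rintZ/rint_abs.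
Qed.

Lemma rint_sum (I : Type) (s : seq I) (F : I -> T -> R) :
  (forall i, m.-rint (F i)) -> m.-rint (fun x => \sum_(i <- s) F i x).
Proof.
move=> hF.
rewrite (_ : EFin \o _ = fun x => (\sum_(i <- s) (F i x)%:E)%E); last first.
  by apply/funext => x /=; rewrite sumEFin.
by apply: integrable_sum => // i _; exact: hF.
Qed.

Lemma RintegralTD f g : m.-rint f -> m.-rint g ->
  \int[m]_x (f x + g x) = \int[m]_x f x + \int[m]_x g x.
Proof. by move=> *; rewrite RintegralD. Qed.

Lemma RintegralTB f g : m.-rint f -> m.-rint g ->
  \int[m]_x (f x - g x) = \int[m]_x f x - \int[m]_x g x.
Proof. by move=> *; rewrite RintegralB. Qed.

Lemma RintegralTZ f k : m.-rint f ->
  \int[m]_x (k * f x) = k * \int[m]_x f x.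
Proof. by move=> *; rewrite RintegralZl. Qed.

Lemma RintegralTN f : m.-rint f ->
  \int[m]_x (- f x) = - \int[m]_x f x.
Proof.
move=> hf; rewrite -mulN1r -RintegralTZ//.
by apply: eq_Rintegral => x _; rewrite mulN1r.
Qed.

Lemma Rintegral_sumT (I : Type) (s : seq I) (F : I -> T -> R) :
  (forall i, m.-rint (F i)) ->
  \int[m]_x (\sum_(i <- s) F i x) = \sum_(i <- s) \int[m]_x F i x.
Proof.
move=> hF; elim: s => [|i s IH].
  under eq_Rintegral do rewrite big_nil.
  by rewrite big_nil /Rintegral integral0.
under eq_Rintegral do rewrite big_cons.
by rewrite big_cons RintegralTD ?IH//; exact: rint_sum.
Qed.

Lemma le_RintegralT f g : m.-rint f -> m.-rint g -> (forall x, f x <= g x) ->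
  \int[m]_x f x <= \int[m]_x g x.
Proof. by move=> hf hg fg; apply: le_Rintegral. Qed.

Lemma le_norm_RintegralT f g : m.-rint f -> m.-rint g ->
  (forall x, `|f x| <= g x) -> `|\int[m]_x f x| <= \int[m]_x g x.
Proof.
move=> hf hg fg; apply: (le_trans (le_normr_Rintegral _ hf)) => //.
by apply: le_RintegralT => //; exact: rint_abs.
Qed.

Lemma RintegralT_ge0 f : (forall x, 0 <= f x) -> 0 <= \int[m]_x f x.
Proof. by move=> f0; exact: Rintegral_ge0. Qed.

Lemma EFin_RintegralT f : m.-rint f ->
  (\int[m]_x f x)%:E = (\int[m]_x (f x)%:E)%E.
Proof. by move=> hf; rewrite fineK//; exact: (integrable_fin_num _ hf). Qed.

Lemma ae_eq_RintegralT f g : measurable_fun setT f -> measurable_fun setT g ->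
  {ae m, forall x, f x = g x} -> \int[m]_x f x = \int[m]_x g x.
Proof.
move=> mf mg fg; rewrite /Rintegral; congr fine.
apply: ae_eq_integral => //; [exact/measurable_EFinP..|].
by apply: filterS fg => x /= -> _.
Qed.

Lemma Rintegral_indic (D : set T) f :
  \int[m]_(x in D) f x = \int[m]_x (\1_D x * f x).
Proof.
rewrite Rintegral_mkcond; apply: eq_Rintegral => x _.
by rewrite patchE indicE; case: ifPn => ?; rewrite ?mul1r ?mul0r.
Qed.

Lemma rint_indic (D : set T) f : measurable D ->
  m.-rint f -> m.-rint (fun x => \1_D x * f x).
Proof.
move=> mD; apply: (@rintM _ _ 1) => //.
by move=> x; rewrite indicE; case: (_ \in _); rewrite ?normr1 ?normr0.
Qed.

Lemma dominated_cvg_Rintegral (F : nat -> T -> R) f g :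
  (forall n, measurable_fun setT (F n)) -> m.-rint g ->
  (forall n x, `|F n x| <= g x) ->
  (forall x, F n x @[n --> \oo] --> f x) ->
  m.-rint f /\ \int[m]_x F n x @[n --> \oo] --> \int[m]_x f x.
Proof.
move=> mF hg Fg Ff.
have mf : measurable_fun setT f.
  by apply: (@measurable_fun_cvg _ _ _ _ F) => // x _; exact: Ff.
have Ff' : {ae m, forall x, setT x -> (F n x)%:E @[n --> \oo] --> (f x)%:E}.
  by apply/aeW => x _; apply: cvg_EFin; [exact: nearW|exact: Ff].
have Fg' : {ae m, forall x, forall n, setT x -> (`|(F n x)%:E| <= (g x)%:E)%E}.
  by apply/aeW => x n _; rewrite lee_fin.
have [] := @dominated_convergence _ _ _ m setT measurableT
  (fun n x => (F n x)%:E) (EFin \o f) (EFin \o g) _ _ Ff' hg Fg'.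
- by move=> n; exact/measurable_EFinP.
- exact/measurable_EFinP.
move=> hf _ cF; split => //.
exact: fine_cvg (eq_ind _ (fun z => _ --> z) cF _ (esym (EFin_RintegralT hf))).
Qed.

End rint.

Section finite_rint.
Context d (T : measurableType d) (R : realType) (P : probability T R).

Lemma rint_cst (k : R) : P.-rint (fun=> k).
Proof.
exact: finite_measure_integrable_cst.
Qed.

Lemma rint_bounded (f : T -> R) M : measurable_fun setT f ->
  (forall x, `|f x| <= M) -> P.-rint f.
Proof. by move=> mf fM; apply: (rint_dom mf fM); exact: rint_cst. Qed.

Lemma Rintegral_cstT (k : R) : \int[P]_x k = k.
Proof. rewrite Rintegral_cst//; transitivity (k * fine (P setT)) => //.
by rewrite probability_setT mulr1. Qed.

Lemma norm_Rintegral_bounded (f : T -> R) M : measurable_fun setT f ->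
  (forall x, `|f x| <= M) -> `|\int[P]_x f x| <= M.
Proof.
move=> mf fM; rewrite -[leRHS]Rintegral_cstT.
by apply: le_norm_RintegralT => //; [exact: rint_bounded fM|exact: rint_cst].
Qed.

End finite_rint.

(** * Exchange of integrals under a product majorant *)

Section fubini.
Context d1 d2 (T1 : measurableType d1) (T2 : measurableType d2) (R : realType).
Variables (m1 : {sigma_finite_measure set T1 -> \bar R})
          (m2 : {sigma_finite_measure set T2 -> \bar R}).

(** A majorant of product form makes [f] integrable for the product measure by Tonelli, so both
    iterated integrals exist everywhere and agree. *)
Lemma Fubini_dominated (f : T1 -> T2 -> R) (u : T1 -> R) (v : T2 -> R) :
  measurable_fun setT (fun z : T1 * T2 => f z.1 z.2) ->
  m1.-rint u -> m2.-rint v ->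
  (forall x y, `|f x y| <= u x * v y) ->
  [/\ m1.-rint (fun x => \int[m2]_y f x y),
      m2.-rint (fun y => \int[m1]_x f x y)
    & \int[m1]_x \int[m2]_y f x y = \int[m2]_y \int[m1]_x f x y].
Proof.
move=> mf hu hv fuv.
have mfx x : measurable_fun setT (f x).
  exact: (measurable_fun_pair2 (f := fun z : T1 * T2 => f z.1 z.2)).
have mfy y : measurable_fun setT (f ^~ y).
  exact: (measurable_fun_pair1 (f := fun z : T1 * T2 => f z.1 z.2)).
have hfx x : m2.-rint (f x).
  by apply: (rint_dom (mfx x) (fuv x)); exact: rintZ.
have hfy y : m1.-rint (f ^~ y).
  apply: (@rint_dom _ _ _ _ _ (fun x => v y * u x)) => //.
    by move=> x; rewrite mulrC.
  exact: rintZ.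
have hf : (m1 \x m2)%E.-integrable setT
    (fun z : T1 * T2 => (f z.1 z.2)%:E).
  apply/integrable12ltyP; first exact/measurable_EFinP.
  apply: (@le_lt_trans _ _ (\int[m1]_x ((\int[m2]_y `|v y|) * `|u x|)%:E)%E).
    apply: ge0_le_integral => //.
    - by move=> x _; exact: integral_ge0.
    - apply: (@measurable_fun_fubini_tonelli_F _ _ _ _ _ m2
        (fun z : T1 * T2 => `|(f z.1 z.2)%:E|%E)) => //.
      by apply: measurableT_comp => //; exact/measurable_EFinP.
    - apply/measurable_EFinP.
      exact: rint_measurable (rintZ _ (rint_abs hu)).
    move=> x _.
    rewrite EFinM EFin_RintegralT; last exact: rint_abs.
    rewrite muleC -ge0_integralZl//; last first.
      apply/measurable_EFinP; apply: measurableT_comp => //.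
      exact: rint_measurable hv.
    apply: ge0_le_integral => //.
    - by apply/measurable_EFinP; exact: rint_measurable (rint_abs (hfx x)).
    - apply/measurable_EFinP.
      exact: rint_measurable (rintZ `|u x| (rint_abs hv)).
    move=> y _; rewrite /= lee_fin (le_trans (fuv x y))// (le_trans (ler_norm _))//.
    by rewrite normrM.
  have /integrable_lty : m1.-rint (fun x => (\int[m2]_y `|v y|) * `|u x|).
    exact/rintZ/rint_abs.
  exact.
have FE : fubini_F m2 (fun z : T1 * T2 => (f z.1 z.2)%:E) =
    EFin \o (fun x => \int[m2]_y f x y).
  by apply/funext => x /=; rewrite /fubini_F EFin_RintegralT.
have GE : fubini_G m1 (fun z : T1 * T2 => (f z.1 z.2)%:E) =
    EFin \o (fun y => \int[m1]_x f x y).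
  by apply/funext => y /=; rewrite /fubini_G EFin_RintegralT.
have h1 : m1.-rint (fun x => \int[m2]_y f x y).
  by rewrite -FE; exact: integrable_fubini_F.
have h2 : m2.-rint (fun y => \int[m1]_x f x y).
  apply: (@rint_dom _ _ _ _ _ (fun y => (\int[m1]_x u x) * v y)).
  - by apply/measurable_EFinP; rewrite -GE; exact: (measurable_fubini_G hf).
  - move=> y; rewrite mulrC -RintegralTZ//; apply: le_norm_RintegralT => //.
      exact: rintZ.
    by move=> x; rewrite mulrC.
  - exact: rintZ.
split => //; apply: EFin_inj.
rewrite !EFin_RintegralT//.
have := Fubini hf => /=.
under eq_integral do rewrite -EFin_RintegralT//.
by under [in RHS]eq_integral do rewrite -EFin_RintegralT//.
Qed.

End fubini.

(** * Calculus on the real line *)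

Section derivative_rules.
Context {R : realType}.
Implicit Types (f g : R -> R) (x df dg : R).

(* Unlike [is_derive], not a type class, so that proofs by [der] are not
   preempted by instance resolution. *)
Definition der1 f x df := is_derive x (1:R) f df.

Lemma der1_eq f x df df' : der1 f x df -> df = df' -> der1 f x df'.
Proof. by move=> h <-. Qed.

Lemma der1_cst (k x : R) : der1 (fun _ : R => k) x 0.
Proof. exact: is_derive_cst. Qed.

Lemma der1_id x : der1 (fun y : R => y) x 1.
Proof. exact: is_derive_id. Qed.

Lemma der1D f g x df dg : der1 f x df -> der1 g x dg ->
  der1 (fun y => f y + g y) x (df + dg).
Proof. by move=> hf hg; exact: is_deriveD. Qed.

Lemma der1N f x df : der1 f x df ->
  der1 (fun y => - f y) x (- df).
Proof. by move=> hf; exact: is_deriveN. Qed.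

Lemma der1B f g x df dg : der1 f x df -> der1 g x dg ->
  der1 (fun y => f y - g y) x (df - dg).
Proof. by move=> hf hg; exact: is_deriveB. Qed.

Lemma der1M f g x df dg : der1 f x df -> der1 g x dg ->
  der1 (fun y => f y * g y) x (f x * dg + g x * df).
Proof. by move=> hf hg; exact: is_deriveM. Qed.

Lemma der1_comp f g x df dg : der1 f (g x) df ->
  der1 g x dg -> der1 (fun y => f (g y)) x (df * dg).
Proof. by move=> hf hg; exact: is_derive1_comp. Qed.

Lemma der1_expR g x dg : der1 g x dg ->
  der1 (fun y => expR (g y)) x (expR (g x) * dg).
Proof. by move=> hg; apply: der1_comp hg; exact: is_derive_expR. Qed.

Lemma der1_cos g x dg : der1 g x dg ->
  der1 (fun y => cos (g y)) x (- sin (g x) * dg).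
Proof. by move=> hg; apply: der1_comp hg; exact: is_derive_cos. Qed.

Lemma der1_sin g x dg : der1 g x dg ->
  der1 (fun y => sin (g y)) x (cos (g x) * dg).
Proof. by move=> hg; apply: der1_comp hg; exact: is_derive_sin. Qed.

Lemma der1_atan g x dg : der1 g x dg ->
  der1 (fun y => atan (g y)) x ((1 + g x ^+ 2)^-1 * dg).
Proof. by move=> hg; apply: der1_comp hg; exact: is_derive1_atan. Qed.

Lemma der1_ln g x dg : 0 < g x -> der1 g x dg ->
  der1 (fun y => ln (g y)) x ((g x)^-1 * dg).
Proof. by move=> g0 hg; apply: der1_comp hg; exact: is_derive1_ln. Qed.

Lemma der1_inv g x dg : g x != 0 -> der1 g x dg ->
  der1 (fun y => (g y)^-1) x (- (g x) ^- 2 * dg).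
Proof. by move=> g0 hg; exact: is_deriveV. Qed.

Lemma der1_sqr g x dg : der1 g x dg ->
  der1 (fun y => g y ^+ 2) x (2 * g x * dg).
Proof.
move=> hg; under eq_fun do rewrite expr2.
by rewrite (_ : 2 * g x * dg = g x * dg + g x * dg); [exact: der1M|ring].
Qed.

Lemma der1_continuous f x df : der1 f x df -> {for x, continuous f}.
Proof.
by move=> [d _]; apply: differentiable_continuous; exact/derivable1_diffP.
Qed.

End derivative_rules.

Ltac der := eapply der1_eq; [ repeat first
  [ apply: der1_id | apply: der1_cst | apply: der1_expR | apply: der1_cos
  | apply: der1_sin | apply: der1_atan | apply: der1_sqr | apply: der1N | apply: der1B | apply: der1D
  | apply: der1M ] | rewrite /= /id ].
Ltac der_cont := move=> ?; eapply der1_continuous; repeat first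
  [ apply: der1_id | apply: der1_cst | apply: der1_expR | apply: der1_cos
  | apply: der1_sin | apply: der1_atan | apply: der1_sqr | apply: der1N | apply: der1B | apply: der1D
  | apply: der1M ].

(** * Improper integrals on the line *)

Section real_line.
Context {R : realType}.
Notation mu := (@lebesgue_measure R).
Implicit Types f F : R -> R.

Lemma RFTC f F (a b : R) : (forall x, der1 F x (f x)) ->
  continuous f -> a <= b -> \int[mu]_(x in `[a, b]) f x = F b - F a.
Proof.
move=> dF cf; rewrite le_eqVlt => /predU1P[->|ab].
  by rewrite set_itv1 Rintegral_set1 subrr.
have cF x : {for x, continuous F}.
  by apply: differentiable_continuous; apply/derivable1_diffP; have [] := dF x.
rewrite /Rintegral (@continuous_FTC2 _ _ F)//.
- exact: continuous_subspaceT.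
- split; [by move=> x _; have [] := dF x| |].
  + exact/cvg_at_right_filter/cF.
  + exact/cvg_at_left_filter/cF.
- by move=> x _; rewrite derive1E; have [_ ->] := dF x.
Qed.

Lemma cvg_Rintegral_sets f (D : nat -> set R) (E : set R) : mu.-rint f ->
  (forall n, measurable (D n)) ->
  (forall x, \forall n \near \oo, (\1_(D n) x : R) = \1_E x) ->
  \int[mu]_(x in D n) f x @[n --> \oo] --> \int[mu]_(x in E) f x.
Proof.
move=> hf mD DE; rewrite Rintegral_indic.
under eq_fun do rewrite Rintegral_indic.
have [] // := @dominated_cvg_Rintegral _ _ _ mu (fun n x => \1_(D n) x * f x)
  (fun x => \1_E x * f x) (fun x => `|f x|).
- by move=> n; exact: rint_measurable (rint_indic (m := mu) (mD n) hf).
- exact: rint_abs.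
- move=> n x; rewrite normrM indicE.
  by case: (_ \in _); rewrite ?normr1 ?mul1r// normr0 mul0r.
- move=> x; apply: cvgMr_tmp; apply: cvg_near_cst.
  exact: DE.
Qed.

Lemma near_ge_norm (x : R) : \forall n \near \oo, `|x| <= n%:R.
Proof. by near do apply: ltW; apply: nbhs_infty_gtr. Unshelve. all: by end_near. Qed.

Lemma cvg_Rintegral_sym f : mu.-rint f ->
  \int[mu]_(x in `[(- n%:R), n%:R]) f x @[n --> \oo] --> \int[mu]_x f x.
Proof.
move=> hf; apply: cvg_Rintegral_sets => // x.
apply: filterS (near_ge_norm x) => n xn.
by rewrite !indicE !mem_set//= in_itv/= -ler_norml.
Qed.

Lemma cvg_Rintegral_y f (a : R) : mu.-rint f ->
  \int[mu]_(x in `[a, a + n%:R]) f x @[n --> \oo] -->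
  \int[mu]_(x in `[a, +oo[) f x.
Proof.
move=> hf; apply: cvg_Rintegral_sets => // x.
apply: filterS (near_ge_norm (x - a)) => n; rewrite ler_norml lerBlDl => /andP[_ xn].
rewrite !indicE; congr (_%:R); congr nat_of_bool.
by apply/idP/idP => /set_mem/=; rewrite in_itv/= => H; apply/mem_set;
  rewrite /= in_itv/= ?andbT; move: H; rewrite ?andbT ?xn ?andbT.
Qed.

(** Since [f] is already known to be integrable, limits of [F] along the integers are enough. *)
Lemma RFTC_line f F (l1 l2 : R) : (forall x, der1 F x (f x)) ->
  continuous f -> mu.-rint f ->
  F n%:R @[n --> \oo] --> l2 -> F (- n%:R) @[n --> \oo] --> l1 ->
  \int[mu]_x f x = l2 - l1.
Proof.
move=> dF cf hf F2 F1; have := cvg_Rintegral_sym hf.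
under eq_fun do rewrite (RFTC dF cf (le_trans _ (ler0n _ _))) ?oppr_le0//.
by move=> /cvg_lim <-//; apply: cvg_lim => //; exact: cvgB.
Qed.

(** [f] is the smooth expression that the fundamental theorem needs everywhere, and it may grow to
    the left of [a]; [f2] is an integrable function on the line that coincides with it on the
    half-line. *)
Lemma RFTC_y f f2 F (a l : R) : (forall x, der1 F x (f x)) ->
  continuous f -> mu.-rint f2 -> (forall x, a <= x -> f2 x = f x) ->
  F (a + n%:R) @[n --> \oo] --> l ->
  \int[mu]_(x in `[a, +oo[) f2 x = l - F a.
Proof.
move=> dF cf hf ff2 F2; have := cvg_Rintegral_y (a := a) hf.
have E n : \int[mu]_(x in `[a, a + n%:R]) f2 x = F (a + n%:R) - F a.
  rewrite -(RFTC dF cf) ?lerDl//; apply: eq_Rintegral => x.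
  by rewrite inE/= in_itv/= => /andP[ax _]; exact: ff2.
under eq_fun do rewrite E.
by move=> /cvg_lim <-//; apply: cvg_lim => //; apply: cvgB => //; exact: cvg_cst.
Qed.

Lemma rint_oneDsqrV : mu.-rint (fun x : R => (1 + x ^+ 2)^-1).
Proof.
have p0 (x : R) : 0 <= (1 + x ^+ 2)^-1 by rewrite invr_ge0 addr_ge0// sqr_ge0.
have c : continuous (fun x : R => (1 + x ^+ 2)^-1) by exact: continuous_oneDsqrV.
apply/integrableP; split.
  by apply/measurable_EFinP; exact: continuous_measurable_fun.
under eq_integral do rewrite /= ger0_norm//.
rewrite ge0_symfun_integralT//; last by move=> x /=; rewrite sqrrN.
rewrite -set_itvcy.
by have := @integral0y_oneDsqr R; rewrite /oneDsqr => ->; rewrite -EFinM ltry.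
Qed.

Lemma rint_decay f (K : R) : measurable_fun setT f ->
  (forall x, `|f x| <= K * (1 + x ^+ 2)^-1) -> mu.-rint f.
Proof. by move=> mf fK; apply: (rint_dom (m := mu) mf fK); exact/rintZ/rint_oneDsqrV. Qed.

Lemma rint_opp f : mu.-rint f -> mu.-rint (fun x => f (- x)).
Proof.
move=> hf.
have mN : measurable_fun setT (-%R : measurableTypeR R -> measurableTypeR R).
  exact: oppr_measurable.
have mfN : measurable_fun setT (EFin \o (fun x => f (- x))).
  by apply/measurable_EFinP; apply: measurableT_comp => //; exact: rint_measurable hf.
apply/integrableP; split => //.
have /integrableP[mf] := hf.
apply: le_lt_trans.
rewrite -(@eq_measure_integral _ _ _ _ _ (pushforward mu
  (-%R : measurableTypeR R -> measurableTypeR R))); last first.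
  by move=> A mA _; exact: lebesgue_measureN.
rewrite ge0_integral_pushforward//; last exact: measurableT_comp.
by rewrite preimage_setT; under eq_integral do rewrite /= opprK.
Qed.

Lemma Rintegral_opp f : mu.-rint f -> \int[mu]_x f (- x) = \int[mu]_x f x.
Proof.
move=> hf.
have mN : measurable_fun setT (-%R : measurableTypeR R -> measurableTypeR R).
  exact: oppr_measurable.
rewrite /Rintegral; congr fine; symmetry.
rewrite -(@eq_measure_integral _ _ _ _ _ (pushforward mu
  (-%R : measurableTypeR R -> measurableTypeR R))); last first.
  by move=> A mA _; exact: lebesgue_measureN.
rewrite integral_pushforward//; last exact: rint_opp.
by have /measurable_EFinP := rint_measurable hf.
Qed.

Lemma Rintegral_fold f : mu.-rint f ->
  \int[mu]_x f x = \int[mu]_(x in `[0, +oo[) (f x + f (- x)).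
Proof.
move=> hf; have hN := rint_opp hf.
rewrite RintegralD//; [|exact: integrableS hf|exact: integrableS hN].
rewrite (Rintegral_indic mu _ (fun x : R => f (- x))).
have -> : \int[mu]_x (\1_`[0, +oo[ x * f (- x)) =
    \int[mu]_x (\1_(`]-oo, 0] : set R) x * f x).
  rewrite -[RHS]Rintegral_opp; last by apply: rint_indic.
  apply: eq_Rintegral => x _; rewrite !indicE; congr (_%:R * _).
  by congr nat_of_bool; apply/idP/idP => /set_mem/=; rewrite in_itv/= => H;
    apply/mem_set; rewrite /= in_itv/=; move: H; rewrite ?andbT oppr_le0.
(* The two closed half-lines share the point 0; it is removed from one of them so that they
   partition the line. *)
rewrite -Rintegral_indic -Rintegral_itv_bndo_bndc; last first.
  exact: integrableS hf.
have E : (`[0, +oo[ : set R) `|` `]-oo, 0[ = setT.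
  by rewrite setUC -set_itvNyy -(itv_bndbnd_setU (x := BLeft (0 : R))).
rewrite -Rintegral_setU ?E//.
by apply/disj_setPS => x /= [] /[!in_itv]/= /andP[+ _]; rewrite leNgt => /negP.
Qed.

End real_line.

(** * Fourier transforms of log-gamma weights *)

Section log_gamma.
Context {R : realType}.
Notation mu := (@lebesgue_measure R).
Implicit Types a l t x : R.

(* [psi l] is [lgw 1 l], and the density of the logarithm of a Gamma variable of
   shape [p] is [lgw p 1 / Gamma p]. *)
Definition lgw a l x : R := expR (a * x - l * expR x).

(** [lgC a l t + i lgS a l t] is the Fourier transform of the weight at [t], that is l^(-a-it)
    Gamma(a + it), and [lgG a l] is its value l^(-a) Gamma(a) at 0. *)
Definition lgC a l t : R := \int[mu]_x (cos (t * x) * lgw a l x).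
Definition lgS a l t : R := \int[mu]_x (sin (t * x) * lgw a l x).
Definition lgG a l : R := \int[mu]_x lgw a l x.

Lemma expRN_le (u : R) : 0 <= u -> expR (- u) <= (1 + u ^+ 2 / 2)^-1.
Proof.
move=> u0; rewrite expRN lef_pV2 ?posrE ?expR_gt0//; last first.
  by rewrite ltr_wpDr// divr_ge0// sqr_ge0.
by have := expR_ge1Dxn 1 u0.
Qed.

Lemma lgw_exp_decay a l : 0 < a -> 0 < l ->
  exists2 K, 0 <= K & forall x, lgw a l x <= K * expR (- (a * `|x|)).
Proof.
(* With n >= 2a, the n-th term of the exponential series gives e^(-l e^x) <= (n! / l^n) e^(-2 a x)
   for x > 0, which leaves e^(-a x) after multiplication by e^(a x). *)
move=> a0 l0; pose n := (Num.bound (2 * a)).+1.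
have n2a : 2 * a <= n%:R.
  have := archi_boundP (ltW (mulr_gt0 (ltr0Sn R 1) a0)).
  by move=> /ltW/le_trans; apply; rewrite ler_nat.
have nl0 : 0 < (n`!%:R / l ^+ n : R).
  by rewrite divr_gt0// ?exprn_gt0// ltr0n fact_gt0.
exists (1 + n`!%:R / l ^+ n) => [|x]; first by rewrite addr_ge0// ltW.
have [x0|x0] := leP x 0.
  rewrite ler0_norm// mulrN opprK /lgw expRD [leLHS]mulrC.
  rewrite ler_wpM2r ?expR_ge0// (@le_trans _ _ 1) ?lerDl ?(ltW nl0)//.
  by rewrite expR_le1 oppr_le0 mulr_ge0 ?expR_ge0// ltW.
rewrite gtr0_norm// /lgw expRD.
have e1 : expR (- (l * expR x)) <= n`!%:R / l ^+ n * expR (- (2 * a * x)).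
  rewrite expRN -[leRHS]invrK lef_pV2 ?posrE ?expR_gt0//; last first.
    by rewrite invr_gt0 mulr_gt0// expR_gt0.
  rewrite invfM invfM invrK expRN invrK.
  have lx0 : 0 <= l * expR x by rewrite mulr_ge0 ?expR_ge0// ltW.
  have := expR_ge1Dxn (Num.bound (2 * a)) lx0; rewrite -/n.
  apply: le_trans; rewrite ler_wpDl// exprMn -mulrA mulrC.
  rewrite ler_wpM2r ?invr_ge0// ler_wpM2l ?exprn_ge0 ?(ltW l0)//.
  by rewrite -(expRM_natl n x) ler_expR ler_wpM2r// ltW.
apply: (@le_trans _ _ (n`!%:R / l ^+ n * expR (- (a * x)))).
  rewrite (le_trans (ler_wpM2l (expR_ge0 _) e1))// mulrCA ler_wpM2l ?(ltW nl0)//.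
  by rewrite -expRD ler_expR; lra.
by rewrite ler_wpM2r ?expR_ge0// lerDr.
Qed.

Lemma exp_abs_decay a x : 0 < a ->
  expR (- (a * `|x|)) <= (1 + 2 / a ^+ 2) * (1 + x ^+ 2)^-1.
Proof.
move=> a0; have a20 : 0 < a ^+ 2 by rewrite exprn_gt0.
have := @expRN_le (a * `|x|) (mulr_ge0 (ltW a0) (normr_ge0 x)).
move=> /le_trans; apply; rewrite exprMn real_normK ?num_real//.
have x20 := sqr_ge0 x.
rewrite ler_pdivlMr; last by lra.
rewrite mulrC ler_pdivrMr; last by nra.
have -> : (1 + 2 / a ^+ 2) * (1 + a ^+ 2 * x ^+ 2 / 2) =
  1 + x ^+ 2 + (2 / a ^+ 2 + a ^+ 2 * x ^+ 2 / 2).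
  by field; rewrite gt_eqF.
by rewrite lerDl; apply: addr_ge0; apply: divr_ge0 => //; nra.
Qed.

Lemma lgw_decay a l : 0 < a -> 0 < l ->
  exists2 K, 0 <= K & forall x, lgw a l x <= K * (1 + x ^+ 2)^-1.
Proof.
move=> a0 l0; have [K K0 HK] := lgw_exp_decay a0 l0.
exists (K * (1 + 2 / a ^+ 2)) => [|x].
  by rewrite mulr_ge0// addr_ge0// divr_ge0// sqr_ge0.
rewrite (le_trans (HK x))// -mulrA ler_wpM2l//.
exact: exp_abs_decay.
Qed.

Lemma lgw_gt0 a l x : 0 < lgw a l x. Proof. exact: expR_gt0. Qed.

Lemma lgw_continuous a l : continuous (lgw a l).
Proof. by rewrite /lgw; der_cont. Qed.

Lemma measurable_lgw a l : measurable_fun setT (lgw a l).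
Proof. by apply: continuous_measurable_fun; exact: lgw_continuous. Qed.

Lemma rint_lgwM a l (h : R -> R) M : 0 < a -> 0 < l -> measurable_fun setT h ->
  (forall x, `|h x| <= M) -> mu.-rint (fun x => h x * lgw a l x).
Proof.
move=> a0 l0 mh hM; have [K K0 HK] := lgw_decay a0 l0.
apply: (rintM (m := mu) mh hM); apply: (@rint_decay _ _ K).
  exact: measurable_lgw.
by move=> x; rewrite (ger0_norm (ltW (lgw_gt0 _ _ _))); exact: HK.
Qed.

Lemma measurable_cosM t : measurable_fun setT (fun x : R => cos (t * x)).
Proof. by apply: continuous_measurable_fun; der_cont. Qed.

Lemma measurable_sinM t : measurable_fun setT (fun x : R => sin (t * x)).
Proof. by apply: continuous_measurable_fun; der_cont. Qed.

Lemma rint_cos_lgw a l t : 0 < a -> 0 < l ->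
  mu.-rint (fun x => cos (t * x) * lgw a l x).
Proof.
move=> a0 l0; apply: (rint_lgwM a0 l0 (measurable_cosM t)) => x.
exact: cos_max.
Qed.

Lemma rint_sin_lgw a l t : 0 < a -> 0 < l ->
  mu.-rint (fun x => sin (t * x) * lgw a l x).
Proof.
move=> a0 l0; apply: (rint_lgwM a0 l0 (measurable_sinM t)) => x.
exact: sin_max.
Qed.

Lemma rint_lgw a l : 0 < a -> 0 < l -> mu.-rint (lgw a l).
Proof.
move=> a0 l0; have [K K0 HK] := lgw_decay a0 l0.
apply: (@rint_decay _ _ K); first exact: measurable_lgw.
by move=> x; rewrite (ger0_norm (ltW (lgw_gt0 _ _ _))); exact: HK.
Qed.

Lemma lgw_shift a l x : expR x * lgw a l x = lgw (a + 1) l x.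
Proof. by rewrite /lgw -expRD; congr expR; ring. Qed.

Lemma cvg_decay (F : R -> R) (K : R) : (forall x, `|F x| <= K * (1 + x ^+ 2)^-1) ->
  F n%:R @[n --> \oo] --> 0 /\ F (- n%:R) @[n --> \oo] --> 0.
Proof.
move=> FK.
have K0 : 0 <= K.
  by have := FK 0; rewrite expr0n/= addr0 invr1 mulr1; exact: le_trans.
have sq (u : nat -> R) : (forall n, `|u n| <= K * (1 + n%:R ^+ 2)^-1) ->
    u n @[n --> \oo] --> (0 : R).
  move=> uK; apply/norm_cvg0P.
  apply: (squeeze_cvgr (f := fun=> 0) (h := fun n => K * n.+1%:R^-1)).
  - near=> n; rewrite normr_ge0/= (le_trans (uK n))// ler_wpM2l// lef_pV2 ?posrE//.
      rewrite -natr1 addrC lerD2l expr2 ler_peMr// ler1n.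
      by near: n; exact: nbhs_infty_ge.
  - exact: cvg_cst.
  - by rewrite -[X in _ --> X](mulr0 K); apply: cvgMl_tmp; exact: cvg_harmonic.
by split; apply: sq => n; rewrite (le_trans (FK _))// sqrrN.
Unshelve. all: by end_near. Qed.

Lemma lgw_bounded_cvg a l (h : R -> R) : 0 < a -> 0 < l -> (forall x, `|h x| <= 1) ->
  (h n%:R * lgw a l n%:R) @[n --> \oo] --> 0 /\
  (h (- n%:R) * lgw a l (- n%:R)) @[n --> \oo] --> 0.
Proof.
move=> a0 l0 h1; have [K K0 HK] := lgw_decay a0 l0.
apply: (@cvg_decay (fun x => h x * lgw a l x) K) => x.
rewrite normrM (ger0_norm (ltW (lgw_gt0 _ _ _))) -[leRHS]mul1r.
by rewrite ler_pM// ltW// lgw_gt0.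
Qed.

(** The derivative of [cos (t * x) * lgw a l x] integrates to 0, and the factor e^x that it produces
    shifts [a] to [a + 1]. Together with [lgS_rec] this is the functional equation l F(a + 1) = (a +
    i t) F(a) for F = lgC + i lgS. *)
Lemma lgC_rec a l t : 0 < a -> 0 < l ->
  l * lgC (a + 1) l t = a * lgC a l t - t * lgS a l t.
Proof.
move=> a0 l0; have a10 : 0 < a + 1 by lra.
pose F x := cos (t * x) * lgw a l x.
pose f x := (a * (cos (t * x) * lgw a l x) - t * (sin (t * x) * lgw a l x))
   - l * (cos (t * x) * lgw (a + 1) l x).
have dF x : der1 F x (f x).
  by rewrite /F /f -lgw_shift /lgw; der; rewrite /=; ring.
have cf : continuous f by rewrite /f /lgw; der_cont.
have hf1 := rint_cos_lgw t a0 l0.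
have hf2 := rint_sin_lgw t a0 l0.
have hf3 := rint_cos_lgw t a10 l0.
have hf12 := rintB (rintZ a hf1) (rintZ t hf2).
have hf := rintB hf12 (rintZ l hf3).
have [F1 F2] := @lgw_bounded_cvg a l (fun x => cos (t * x)) a0 l0 (fun x => cos_max _).
have := RFTC_line dF cf hf F1 F2.
rewrite subr0 RintegralTB//; last exact: rintZ.
rewrite RintegralTB; [|exact: rintZ..].
rewrite !RintegralTZ//.
by move=> /eqP; rewrite subr_eq0 => /eqP.
Qed.

Lemma lgS_rec a l t : 0 < a -> 0 < l ->
  l * lgS (a + 1) l t = a * lgS a l t + t * lgC a l t.
Proof.
move=> a0 l0; have a10 : 0 < a + 1 by lra.
pose F x := sin (t * x) * lgw a l x.
pose f x := (a * (sin (t * x) * lgw a l x) + t * (cos (t * x) * lgw a l x))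
   - l * (sin (t * x) * lgw (a + 1) l x).
have dF x : der1 F x (f x).
  by rewrite /F /f -lgw_shift /lgw; der; rewrite /=; ring.
have cf : continuous f by rewrite /f /lgw; der_cont.
have hf1 := rint_sin_lgw t a0 l0.
have hf2 := rint_cos_lgw t a0 l0.
have hf3 := rint_sin_lgw t a10 l0.
have hf12 := rintD (rintZ a hf1) (rintZ t hf2).
have hf := rintB hf12 (rintZ l hf3).
have [F1 F2] := @lgw_bounded_cvg a l (fun x => sin (t * x)) a0 l0 (fun x => sin_max _).
have := RFTC_line dF cf hf F1 F2.
rewrite subr0 RintegralTB//; last exact: rintZ.
rewrite RintegralTD; [|exact: rintZ..].
rewrite !RintegralTZ//.
by move=> /eqP; rewrite subr_eq0 => /eqP.
Qed.

Lemma lgCE a l t : lgC a l t = \int[mu]_x (cos (t * x) * lgw a l x).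
Proof. by []. Qed.

Lemma lgSE a l t : lgS a l t = \int[mu]_x (sin (t * x) * lgw a l x).
Proof. by []. Qed.

Lemma lgGE a l : lgG a l = \int[mu]_x lgw a l x.
Proof. by []. Qed.

Lemma lgC0 a l : lgC a l 0 = lgG a l.
Proof. by apply: eq_Rintegral => x _; rewrite mul0r cos0 mul1r. Qed.

Lemma lgS0 a l : lgS a l 0 = 0.
Proof.
rewrite /lgS (_ : (fun _ => _) = cst 0) ?Rintegral_cst ?mul0r//.
by apply/funext => x; rewrite mul0r sin0 mul0r.
Qed.

Lemma lgG_rec a l : 0 < a -> 0 < l -> l * lgG (a + 1) l = a * lgG a l.
Proof. by move=> a0 l0; rewrite -!lgC0 lgC_rec// lgS0; ring. Qed.

Lemma lgG_ge0 a l : 0 <= lgG a l.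
Proof. by apply: RintegralT_ge0 => x; rewrite ltW// lgw_gt0. Qed.

Lemma lgC_le a l t : 0 < a -> 0 < l -> `|lgC a l t| <= lgG a l.
Proof.
move=> a0 l0; apply: le_norm_RintegralT; [exact: rint_cos_lgw|exact: rint_lgw|].
move=> x; rewrite normrM (ger0_norm (ltW (lgw_gt0 _ _ _))) ler_piMl ?cos_max//.
by rewrite ltW// lgw_gt0.
Qed.

Lemma lgS_le a l t : 0 < a -> 0 < l -> `|lgS a l t| <= lgG a l.
Proof.
move=> a0 l0; apply: le_norm_RintegralT; [exact: rint_sin_lgw|exact: rint_lgw|].
move=> x; rewrite normrM (ger0_norm (ltW (lgw_gt0 _ _ _))) ler_piMl ?sin_max//.
by rewrite ltW// lgw_gt0.
Qed.

Lemma lgCN a l t : lgC a l (- t) = lgC a l t.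
Proof. by apply: eq_Rintegral => x _; rewrite mulNr cosN. Qed.

Lemma lgSN a l t : 0 < a -> 0 < l -> lgS a l (- t) = - lgS a l t.
Proof.
move=> a0 l0; rewrite /lgS -RintegralTN; last exact: rint_sin_lgw.
by apply: eq_Rintegral => x _; rewrite mulNr sinN mulNr.
Qed.

Lemma lgG_gt0 a l : 0 < a -> 0 < l -> 0 < lgG a l.
Proof.
move=> a0 l0.
pose c := expR (- (a + l * expR 1)).
have c0 : 0 < c by exact: expR_gt0.
apply: (@lt_le_trans _ _ (\int[mu]_(x in `[0, 1]) (c : R))).
  by rewrite Rintegral_cst//= lebesgue_measure_itv/= lte_fin ltr01 sube0/= mulr1.
rewrite (Rintegral_indic mu _ (fun=> c)).
have hc : mu.-rint (fun x => \1_`[0, 1] x * c).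
  rewrite (_ : (fun _ => _) = (fun x => c * \1_`[0, 1] x)); last by apply/funext => x; rewrite mulrC.
  by apply: rintZ; exact: integrable_indic_itv.
apply: le_RintegralT => //; first exact: rint_lgw.
move=> x; rewrite indicE; case: (boolP (x \in _)) => [|_]; last by rewrite mul0r ltW// lgw_gt0.
rewrite inE/= in_itv/= => /andP[x0 x1]; rewrite mul1r /c /lgw ler_expR.
have : l * expR x <= l * expR 1 by rewrite ler_wpM2l ?(ltW l0)// ler_expR.
have : 0 <= a * x by rewrite mulr_ge0// ltW.
by lra.
Qed.

End log_gamma.

(* Keeps unification from unfolding the integrals. *)
Global Opaque lgC lgS lgG.

(** * Convexity of the logarithmic factors of the Gamma product *)

Section log_ratio.
Context {R : realType}.
Implicit Types t x y z : R.

Lemma MVT_der (f df : R -> R) (a b : R) : a < b ->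
  (forall x, a <= x <= b -> der1 f x (df x)) ->
  exists2 c, a < c < b & f b - f a = df c * (b - a).
Proof.
move=> ab dF; have [||c] := @MVT R f df a b ab.
- by move=> x /[!in_itv]/= /andP[ax xb]; apply: dF; rewrite !ltW.
- apply: continuous_in_subspaceT => x /set_mem/= /[!in_itv]/= H.
  exact: der1_continuous (dF x H).
- by rewrite in_itv/=; exists c.
Qed.

(* [lphi t (a + k)] is minus the logarithm of the [k]-th factor of the infinite
   product [|Gamma (a + i t) / Gamma a| ^ 2]. *)
Definition lphi t x : R := ln (1 + t ^+ 2 / x ^+ 2).

Definition lphi' t x : R := - (2 * t ^+ 2 / (x * (x ^+ 2 + t ^+ 2))).

Lemma lphi_arg t x : 0 < 1 + t ^+ 2 / x ^+ 2.
Proof. by rewrite ltr_wpDr// divr_ge0// sqr_ge0. Qed.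

Lemma der1_lphi t x : 0 < x -> der1 (lphi t) x (lphi' t x).
Proof.
move=> x0; have x2 : x ^+ 2 != 0 by rewrite expf_neq0// gt_eqF.
have D := der1D (der1_cst 1 x) (der1M (der1_cst (t ^+ 2) x)
  (der1_inv (g := fun y => y ^+ 2) x2 (der1_sqr (der1_id x)))).
have E := @der1_ln _ (fun y => 1 + t ^+ 2 / y ^+ 2) x _ (lphi_arg t x) D.
apply: (der1_eq E).
rewrite /lphi' /=; field.
have x20 : 0 < x ^+ 2 by rewrite exprn_gt0.
have t20 := sqr_ge0 t.
by rewrite !gt_eqF// ltr_wpDr.
Qed.

Lemma lphi'_le t x y : 0 < x -> x <= y -> lphi' t x <= lphi' t y.
Proof.
move=> x0 xy; have y0 : 0 < y by lra.
have t20 := sqr_ge0 t.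
have x20 : 0 < x ^+ 2 by rewrite exprn_gt0.
have y20 : 0 < y ^+ 2 by rewrite exprn_gt0.
have xy2 : x ^+ 2 <= y ^+ 2 by rewrite ler_sqr ?nnegrE ?(ltW x0) ?(ltW y0).
rewrite /lphi' lerN2 ler_wpM2l ?(mulr_ge0 (ler0n _ 2) t20)// lef_pV2 ?posrE; last 2 first.
- by apply: mulr_gt0 => //; lra.
- by apply: mulr_gt0 => //; lra.
by apply: ler_pM; lra.
Qed.

(** The slopes of the chords of a convex function increase. The inequality is multiplied out so that
    the degenerate cases y = x and y = z are covered. *)
Lemma lphi_convex t x y z : 0 < x -> x <= y -> y <= z ->
  (z - y) * (lphi t y - lphi t x) <= (y - x) * (lphi t z - lphi t y).
Proof.
move=> x0; rewrite le_eqVlt => /predU1P[->|xy]; first by rewrite !subrr mulr0 mul0r.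
rewrite le_eqVlt => /predU1P[->|yz]; first by rewrite !subrr mulr0 mul0r.
have [|c /andP[c1 c2] ->] := MVT_der (df := lphi' t) xy (f := lphi t).
  by move=> u /andP[u1 _]; apply: der1_lphi; lra.
have [|e /andP[e1 e2] ->] := MVT_der (df := lphi' t) yz (f := lphi t).
  by move=> u /andP[u1 _]; apply: der1_lphi; lra.
have : lphi' t c <= lphi' t e by apply: lphi'_le; lra.
have : 0 <= (z - y) * (y - x) by rewrite mulr_ge0// subr_ge0 ltW.
by nra.
Qed.

Lemma lphi_ge0 t x : 0 <= lphi t x.
Proof. by rewrite ln_ge0// lerDl divr_ge0// sqr_ge0. Qed.

Lemma lphi_le t x : lphi t x <= t ^+ 2 / x ^+ 2.
Proof.
by apply: le_ln1Dx; rewrite (@lt_le_trans _ _ 0)// ?ltrN10// divr_ge0// sqr_ge0.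
Qed.

(** For t > 0, the antiderivative of [lphi t] on the positive axis that tends to 0 at 0. *)
Definition lPhi t x : R := x * lphi t x + 2 * t * atan (x / t).

Lemma der1_lPhi t x : 0 < t -> 0 < x -> der1 (lPhi t) x (lphi t x).
Proof.
move=> t0 x0.
have D := der1D (der1M (der1_id x) (der1_lphi t x0)) (der1M (der1_cst (2 * t) x)
  (der1_atan (der1M (der1_id x) (der1_cst t^-1 x)))).
apply: (der1_eq D).
rewrite /lphi' /=.
have x20 : 0 < x ^+ 2 by rewrite exprn_gt0.
have t20 : 0 < t ^+ 2 by rewrite exprn_gt0.
have H : lphi t x + (- (2 * t ^+ 2 / (x * (x ^+ 2 + t ^+ 2)))) * x +
   2 * t * ((1 + (x / t) ^+ 2)^-1 * t^-1) = lphi t x.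
  field; rewrite !gt_eqF//; lra.
by rewrite -[RHS]H; ring.
Qed.

(* Convexity makes the trapezoidal rule overestimate the integral. *)
Lemma lPhi_trapezoid t x : 0 < t -> 0 < x ->
  lPhi t (x + 1) - lPhi t x <= (lphi t x + lphi t (x + 1)) / 2.
Proof.
move=> t0 x0.
(* [g s] is the trapezoidal rule minus the antiderivative on [x, x + s]. Its derivative is (lphi(x)
   - lphi(x + s) + s lphi'(x + s)) / 2, which is nonnegative because lphi' increases. *)
pose g s := s * ((lphi t x + lphi t (x + s)) / 2) - lPhi t (x + s).
pose g' s := (lphi t x + lphi t (x + s)) / 2 + s * (lphi' t (x + s) / 2) - lphi t (x + s).
have [|s|c /andP[c0 c1]] := @MVT_der g g' 0 1.
- exact: ltr01.
- move=> /andP[s0 _]; have xs0 : 0 < x + s by lra.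
  have dx : der1 (fun s => x + s) s 1.
    by apply: (der1_eq (der1D (der1_cst x s) (der1_id s))); ring.
  have dphi := der1_comp (der1_lphi t xs0) dx.
  have dPhi := der1_comp (der1_lPhi t0 xs0) dx.
  have D := der1B (der1M (der1_id s) (der1M (der1D (der1_cst (lphi t x) s) dphi)
    (der1_cst 2^-1 s))) dPhi.
  apply: (der1_eq D).
  by rewrite /g' /=; ring.
have [||xi /andP[xi0 xi1] E] := @MVT_der (lphi t) (lphi' t) x (x + c).
- by lra.
- by move=> u /andP[u1 _]; apply: der1_lphi; lra.
have Hxi : lphi' t xi <= lphi' t (x + c) by apply: lphi'_le; lra.
have gc : 0 <= g' c by rewrite /g'; nra.
by rewrite /g subr0 mulr1 addr0 mul0r mul1r; lra.
Qed.

Lemma atan_le (u : R) : 0 <= u -> atan u <= u.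
Proof.
rewrite le_eqVlt => /predU1P[<-|u0]; first by rewrite atan0.
have [|c _] := @MVT_der (@atan R) (fun x => (1 + x ^+ 2)^-1) 0 u u0.
  by move=> x _; exact: is_derive1_atan.
rewrite atan0 !subr0 => ->; rewrite ler_piMl ?(ltW u0)//.
by rewrite invf_le1 ?lerDl ?sqr_ge0// ltr_wpDr// sqr_ge0.
Qed.

Definition lphi_sum t (a : R) (n : nat) : R := \sum_(k < n) lphi t (a + k%:R).

(** Since p + k lies between 1 + k and 2 + k, convexity gives lphi(p + k) - lphi(1 + k) <= (p - 1)
    (lphi(2 + k) - lphi(1 + k)), and the right-hand sides telescope. *)
Lemma lphi_sum_convex t (p : R) n : 1 <= p <= 2 ->
  lphi_sum t p n - lphi_sum t 1 n <=
  (p - 1) * (lphi t (1 + n%:R) - lphi t 1).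
Proof.
move=> /andP[p1 p2]; elim: n => [|n IH].
  by rewrite /lphi_sum !big_ord0 addr0 !subrr mulr0.
rewrite /lphi_sum !big_ord_recr/= -/(lphi_sum t p n) -/(lphi_sum t 1 n).
have n0 : 0 <= n%:R :> R by [].
have := @lphi_convex t (1 + n%:R) (p + n%:R) (1 + n.+1%:R).
rewrite -(natr1 n) => /(_ _ _ _); nra.
Qed.

(** The trapezoids over [1, 1 + n] add up to the sum plus half the difference of the end values. The
    term 2 bounds [2 * t * atan (1 / t)], the arctangent part of [lPhi t 1]; the half value of
    [lphi t 1] that remains is the source of the factor (1 + t^2)^(1/2). *)
Lemma lphi_sum_ge t n : 0 < t ->
  2 * t * atan ((1 + n%:R) / t) - 2 - lphi t 1 / 2 <= lphi_sum t 1 n.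
Proof.
move=> t0.
have H : lPhi t (1 + n%:R) - lPhi t 1 <=
    lphi_sum t 1 n + (lphi t (1 + n%:R) - lphi t 1) / 2.
  elim: n => [|n IH]; first by rewrite /lphi_sum big_ord0 addr0 !subrr mul0r addr0.
  rewrite /lphi_sum big_ord_recr/= -/(lphi_sum t 1 n).
  have := @lPhi_trapezoid t (1 + n%:R) t0.
  rewrite -(natr1 n) addrA => /(_ (ltr_wpDr (ler0n _ _) ltr01)); lra.
move: H; rewrite /lPhi mul1r.
have : 2 * t * atan (1 / t) <= 2.
  have it0 : 0 <= 1 / t by rewrite divr_ge0// ltW.
  rewrite (le_trans (ler_wpM2l _ (atan_le it0)))//; first by rewrite mulr_ge0// ltW.
  by rewrite mul1r mulfK// gt_eqF.
have := lphi_ge0 t (1 + n%:R); have n0 : 0 <= n%:R :> R by [].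
by nra.
Qed.

End log_ratio.

(** * The squared modulus of Gamma on vertical lines *)

Section modulus.
Context {R : realType}.
Notation mu := (@lebesgue_measure R).
Implicit Types a l t x p : R.

Lemma sqr_normr (x : R) : `|x| ^+ 2 = x ^+ 2.
Proof. exact/real_normK/num_real. Qed.

Lemma cos_ge_sqr (y : R) : 1 - y ^+ 2 / 2 <= cos y.
Proof.
have sin_le (u : R) : sin u ^+ 2 <= u ^+ 2.
  have H (v : R) : 0 < v -> sin v ^+ 2 <= v ^+ 2.
    move=> v0; have [|c _] := @MVT_der _ (@sin R) cos 0 v v0.
      by move=> x _; exact: is_derive_sin.
    rewrite sin0 !subr0 => ->; rewrite exprMn ler_piMl ?sqr_ge0//.
  have [u0|u0|->] := ltgtP u 0; last by rewrite sin0.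
    by rewrite -sqrrN -sinN -(sqrrN u); apply: H; rewrite oppr_gt0.
  exact: H.
have -> : y = (y / 2) *+ 2 by rewrite -mulr_natr divfK.
rewrite cos_mulr2n cos2sin2.
by have := sin_le (y / 2); lra.
Qed.

(** For u = 2 v the right-hand side is 4 (e^v - e^(-v))^2, and v <= e^v - e^(-v) when v >= 0. *)
Lemma sqr_le_exp (u : R) : u ^+ 2 <= 4 * (expR u + expR (- u) - 2).
Proof.
have H (v : R) : 0 <= v -> (v *+ 2) ^+ 2 <= 4 * (expR (v *+ 2) + expR (- (v *+ 2)) - 2).
  move=> v0; have e1 := expR_ge1Dx v.
  have e2 : expR (- v) <= 1 by rewrite expR_le1 oppr_le0.
  have e3 := expRxMexpNx_1 v; have e4 := expR_gt0 (- v).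
  have -> : - (v *+ 2) = - v + - v by ring.
  rewrite mulr2n !expRD.
  have h : v <= expR v - expR (- v) by lra.
  have : v ^+ 2 <= (expR v - expR (- v)) ^+ 2 by rewrite ler_sqr ?nnegrE//; lra.
  by move: e3; set A := expR v; set B := expR _ => e3; nra.
have E (v : R) : (v / 2) *+ 2 = v by rewrite -mulr_natr divfK.
have [u0|u0] := leP 0 u; first by have := H (u / 2); rewrite E; apply; lra.
by have := H (- u / 2); rewrite E opprK sqrrN addrC [expR (- u) + _]addrC addrC; apply; lra.
Qed.

(** The squared modulus of the Fourier transform. Dividing it by its value at 0 gives [lgR a l t] =
    |Gamma(a + it) / Gamma(a)|^2, in which the scale [l] cancels. *)
Definition lgN a l t : R := lgC a l t ^+ 2 + lgS a l t ^+ 2.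
Definition lgR a l t : R := lgN a l t / lgG a l ^+ 2.

Lemma lgN_ge0 a l t : 0 <= lgN a l t.
Proof. by rewrite addr_ge0// sqr_ge0. Qed.

Lemma lgN_rec a l t : 0 < a -> 0 < l ->
  l ^+ 2 * lgN (a + 1) l t = (a ^+ 2 + t ^+ 2) * lgN a l t.
Proof.
move=> a0 l0.
have E (A B : R) : l ^+ 2 * (A ^+ 2 + B ^+ 2) = (l * A) ^+ 2 + (l * B) ^+ 2 by ring.
rewrite /lgN E (lgC_rec t a0 l0) (lgS_rec t a0 l0).
by move: (lgC a l t) (lgS a l t) => C S; ring.
Qed.

Lemma lgR_ge0 a l t : 0 <= lgR a l t.
Proof. by rewrite divr_ge0 ?lgN_ge0// sqr_ge0. Qed.

Lemma lgR_rec a l t : 0 < a -> 0 < l ->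
  lgR (a + 1) l t = (1 + t ^+ 2 / a ^+ 2) * lgR a l t.
Proof.
move=> a0 l0; have a10 : 0 < a + 1 by lra.
have H1 := lgN_rec t a0 l0; have H2 := lgG_rec a0 l0.
have G0 := lgG_gt0 a0 l0; have G10 := lgG_gt0 a10 l0.
have -> : lgR (a + 1) l t = (l ^+ 2 * lgN (a + 1) l t) / (l * lgG (a + 1) l) ^+ 2.
  rewrite /lgR; move: (lgN _ _ _) (lgG _ _) G10 => N G G10.
  by field; rewrite !gt_eqF.
rewrite H1 H2 /lgR; move: (lgN _ _ _) (lgG _ _) G0 => N G {}G0.
by field; rewrite !gt_eqF.
Qed.

Lemma lgR_le2 a l t : 0 < a -> 0 < l -> lgR a l t <= 2.
Proof.
move=> a0 l0; have G0 := lgG_gt0 a0 l0.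
rewrite ler_pdivrMr ?exprn_gt0//.
have sq (u : R) : `|u| <= lgG a l -> u ^+ 2 <= lgG a l ^+ 2.
  by move=> h; rewrite -(sqr_normr u) ler_sqr ?nnegrE// lgG_ge0.
have := sq _ (lgC_le t a0 l0); have := sq _ (lgS_le t a0 l0).
by rewrite /lgN; lra.
Qed.

Lemma lgN_le a l t : 0 < a -> 0 < l -> lgN a l t <= 2 * lgG a l ^+ 2.
Proof.
move=> a0 l0; have := lgR_le2 t a0 l0.
by rewrite ler_pdivrMr// exprn_gt0// lgG_gt0.
Qed.

Lemma lgNE a l t : lgN a l t = lgC a l t ^+ 2 + lgS a l t ^+ 2.
Proof. by []. Qed.

Lemma lgRE a l t : lgR a l t = lgN a l t / lgG a l ^+ 2.
Proof. by []. Qed.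

Lemma expR_lphi t x : expR (lphi t x) = 1 + t ^+ 2 / x ^+ 2.
Proof. by rewrite lnK// posrE lphi_arg. Qed.

Lemma lgR_iter a l t n : 0 < a -> 0 < l ->
  lgR (a + n%:R) l t = expR (lphi_sum t a n) * lgR a l t.
Proof.
move=> a0 l0; elim: n => [|n IH].
  by rewrite addr0 /lphi_sum big_ord0 expR0 mul1r.
rewrite -(natr1 n) addrA lgR_rec ?IH//; last by rewrite ltr_wpDr.
by rewrite /lphi_sum big_ord_recr/= expRD expR_lphi mulrA; congr (_ * _); rewrite mulrC.
Qed.

(* With [c = ln (a / l)], the mean of [X] under the log-gamma weight is close
   to [c], and [(X - c) ^ 2 <= 4 (e^(X - c) + e^(c - X) - 2)] has an explicit
   mean of order [1 / a]. *)
Lemma lgR_ge a l t : 1 < a -> 0 < l -> 8 * t ^+ 2 <= a - 1 -> 1 / 4 <= lgR a l t.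
Proof.
move=> a1 l0 ta; have a0 : 0 < a by lra.
have a10 : 0 < a - 1 by lra.
have al0 : 0 < a / l by rewrite divr_gt0.
pose c := ln (a / l).
have ec : expR c = a / l by rewrite lnK.
have eNc : expR (- c) = l / a by rewrite expRN ec invf_div.
have G0 := lgG_gt0 a0 l0.
have hw := rint_lgw a0 l0; have hwp := rint_lgw (a := a + 1) (ltr_wpDr ler01 a0) l0.
have hwm := rint_lgw a10 l0.
have hC := rint_cos_lgw t a0 l0; have hS := rint_sin_lgw t a0 l0.
have Ec : \int[mu]_x (cos (t * (x - c)) * lgw a l x) =
    cos (t * c) * lgC a l t + sin (t * c) * lgS a l t.
  rewrite lgCE lgSE -!RintegralTZ// -RintegralTD; [|exact: rintZ..].
  by apply: eq_Rintegral => x _; rewrite mulrBr cosB; ring.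
have Hge : lgG a l / 2 <= cos (t * c) * lgC a l t + sin (t * c) * lgS a l t.
  rewrite -Ec.
  (* [h] minorizes the integrand by cos y >= 1 - y^2 / 2 and [sqr_le_exp] at x - c. By the
     recurrence of [lgG] its integral is (1 - 2 t^2 / (a - 1)) [lgG a l], whence the hypothesis on 8
     t^2. *)
  pose h x := (1 + 4 * t ^+ 2) * lgw a l x -
    (2 * t ^+ 2 * expR (- c) * lgw (a + 1) l x + 2 * t ^+ 2 * expR c * lgw (a - 1) l x).
  have hh : mu.-rint h by apply: rintB; [exact: rintZ|apply: rintD; exact: rintZ].
  apply: (@le_trans _ _ (\int[mu]_x h x)); last first.
    apply: le_RintegralT => //.
      under eq_fun do rewrite mulrBr cosB.
      rewrite (_ : (fun _ => _) = fun x => cos (t * c) * (cos (t * x) * lgw a l x) +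
        sin (t * c) * (sin (t * x) * lgw a l x)).
        by apply: rintD; exact: rintZ.
      by apply/funext => x; ring.
    move=> x; rewrite /h -lgw_shift.
    have -> : lgw (a - 1) l x = expR (- x) * lgw a l x.
      by rewrite /lgw -expRD; congr expR; ring.
    rewrite !mulrA -!mulrDl -mulrBl ler_wpM2r//; first exact/ltW/lgw_gt0.
    apply: le_trans (cos_ge_sqr _).
    have := sqr_le_exp (x - c); rewrite opprB (expRD x) (expRD c) exprMn => H.
    have := ler_wpM2l (sqr_ge0 t) H; nra.
  rewrite /h RintegralTB; [|exact: rintZ|by apply: rintD; exact: rintZ].
  rewrite RintegralTD; [|exact: rintZ..].
  rewrite !RintegralTZ// -!lgGE.
  rewrite ec eNc.
  have e1 : l / a * lgG (a + 1) l = lgG a l.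
    by rewrite mulrAC lgG_rec// mulrAC mulfV ?mul1r// gt_eqF.
  have e2 : a / l * lgG (a - 1) l = a / (a - 1) * lgG a l.
    have := lgG_rec a10 l0; rewrite subrK => H.
    have -> : lgG (a - 1) l = l * lgG a l / (a - 1) by rewrite H mulrAC mulfV ?mul1r// gt_eqF.
    by field; rewrite !gt_eqF.
  rewrite -!mulrA [l * _]mulrA e1 [a * _]mulrA e2.
  have -> : a / (a - 1) = 1 + (a - 1)^-1 by field; rewrite gt_eqF.
  have : 2 * t ^+ 2 * (a - 1)^-1 <= 1 / 4.
    by rewrite ler_pdivrMr//; move: ta; clear; lra.
  move=> H; have := ler_wpM2r (ltW G0) H; move: G0; clear.
  by move: (lgG a l) => G; nra.
rewrite ler_pdivlMr ?exprn_gt0//.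
have cs : cos (t * c) ^+ 2 + sin (t * c) ^+ 2 = 1 by exact: cos2Dsin2.
have Hsq : (lgG a l / 2) ^+ 2 <= (cos (t * c) * lgC a l t + sin (t * c) * lgS a l t) ^+ 2.
  by rewrite ler_sqr ?nnegrE//; lra.
have CS : (cos (t * c) * lgC a l t + sin (t * c) * lgS a l t) ^+ 2 <= lgN a l t.
  rewrite -[leRHS]mul1r -cs /lgN.
  have := sqr_ge0 (cos (t * c) * lgS a l t - sin (t * c) * lgC a l t).
  by nra.
by move: Hsq CS; lra.
Qed.

Lemma large_shift (A : R) : exists n : nat, A <= n%:R.
Proof.
exists (Num.bound A); have := archi_boundP (normr_ge0 A).
have [A0|A0] := leP 0 A; first by rewrite ger0_norm// => /ltW.
by move=> _; rewrite (le_trans (ltW A0)).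
Qed.

(** The recurrence carries the lower bound 1/4, valid at a + n for n large, down to [a]. In
    particular the characteristic function of the noise has no zero, so the deconvolution quotient
    is a genuine one. *)
Lemma lgR_gt0 a l t : 0 < a -> 0 < l -> 0 < lgR a l t.
Proof.
move=> a0 l0; have [n Hn] := large_shift (8 * t ^+ 2 + 2).
have := @lgR_ge (a + n%:R) l t; rewrite lgR_iter// => H.
have t20 := sqr_ge0 t.
have {}H : 0 < expR (lphi_sum t a n) * lgR a l t.
  by apply: lt_le_trans (H _ l0 _); lra.
by rewrite -(pmulr_rgt0 _ (expR_gt0 (lphi_sum t a n))).
Qed.

(* [lgR 1] is [lgR n] times the exponential of minus a sum of [lphi]'s, which is
   at least the integral given by [lPhi]; the rate [pi t] is the limit of the
   summand [2 t atan (x / t)] of [lPhi]. *)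
Lemma lgR_exp_decay l t : 0 < l -> 0 < t ->
  lgR 1 l t <= 2 * expR 4 * expR (ln (1 + t ^+ 2) / 2) * expR (- (pi * t)).
Proof.
move=> l0 t0.
(* An error 1 / t on the arctangent costs 2 in the exponent, and [lphi_sum_ge] costs another 2; this
   is the origin of [expR 4]. *)
have [n Hn] : exists n : nat, pi / 2 - 1 / t <= atan ((1 + n%:R) / t).
  have it0 : 0 < 1 / t by rewrite divr_gt0.
  have /cvgrPdist_le /(_ _ it0) [M [_ HM]] := @cvgy_atan R.
  have [n Hn] := large_shift (t * (1 + `|M|)); exists n.
  have /HM : M < (1 + n%:R) / t.
    rewrite ltr_pdivlMr// (@le_lt_trans _ _ (t * (1 + `|M|)))//.
      by rewrite mulrC ler_wpM2l ?(ltW t0)// (le_trans (ler_norm _))// lerDr.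
    by rewrite (le_lt_trans Hn)// ltrDr.
  by rewrite ler_norml; lra.
have := lgR_le2 t (ltr_wpDr (ler0n R n) ltr01) l0.
rewrite lgR_iter// => H.
have S := lphi_sum_ge n t0.
have HS : pi * t - 4 - ln (1 + t ^+ 2) / 2 <= lphi_sum t 1 n.
  apply: le_trans S.
  have -> : lphi t 1 = ln (1 + t ^+ 2) by rewrite /lphi expr1n divr1.
  have : 2 * t * (pi / 2 - 1 / t) <= 2 * t * atan ((1 + n%:R) / t).
    by rewrite ler_wpM2l// mulr_ge0// ltW.
  have -> : 2 * t * (pi / 2 - 1 / t) = pi * t - 2 by field; rewrite gt_eqF.
  by lra.
rewrite -!mulrA -!expRD.
have -> : 4 + (ln (1 + t ^+ 2) / 2 - pi * t) = - (pi * t - 4 - ln (1 + t ^+ 2) / 2) by ring.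
rewrite expRN ler_pdivlMr ?expR_gt0// mulrC.
by apply: le_trans H; rewrite ler_wpM2r ?lgR_ge0// ler_expR.
Qed.

(** Both sides are pushed up by n, where [lgR] lies between 1/4 and 2; this gives the factor 8. What
    remains is the exponential of the difference of the two sums of [lphi], controlled by convexity,
    with a last term [lphi t (1 + n%:R)] at most 1 for n large. *)
Lemma lgR_ratio12 l p t : 0 < l -> 1 <= p <= 2 ->
  lgR 1 l t <= 8 * expR 1 * expR ((1 - p) * ln (1 + t ^+ 2)) * lgR p 1 t.
Proof.
move=> l0 /[dup] p12 /andP[p1 p2]; have p0 : 0 < p by lra.
have [n Hn] := large_shift (8 * t ^+ 2 + 2).
have t20 := sqr_ge0 t.
have H1 := lgR_le2 t (ltr_wpDr (ler0n R n) ltr01) l0.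
have H2 := @lgR_ge (p + n%:R) 1 t.
rewrite lgR_iter// in H1; rewrite lgR_iter// in H2.
have {}H2 : 1 / 4 <= expR (lphi_sum t p n) * lgR p 1 t by apply: H2 => //; lra.
have H3 := lphi_sum_convex t n p12.
have H4 : lphi t (1 + n%:R) <= 1.
  rewrite (le_trans (lphi_le _ _))// ler_pdivrMr; last by rewrite exprn_gt0//; lra.
  have : 1 + n%:R <= (1 + n%:R : R) ^+ 2 by rewrite expr2 ler_peMr; lra.
  by lra.
have H5 : lphi_sum t p n - lphi_sum t 1 n <= 1 + (1 - p) * ln (1 + t ^+ 2).
  have -> : ln (1 + t ^+ 2) = lphi t 1 by rewrite /lphi expr1n divr1.
  by nra.
apply: (@le_trans _ _ (2 * expR (- lphi_sum t 1 n))).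
  by rewrite expRN ler_pdivlMr ?expR_gt0// mulrC.
apply: (@le_trans _ _ (8 * expR (lphi_sum t p n - lphi_sum t 1 n) * lgR p 1 t)).
  rewrite expRD; have := ler_wpM2r (expR_ge0 (- lphi_sum t 1 n)) H2.
  set A := expR (lphi_sum t p n); set B := expR _; set C := lgR _ _ _.
  have -> : 8 * (A * B) * C = 8 * (A * C * B) by ring.
  by clear; move: (A * C * B) => D; lra.
rewrite ler_wpM2r ?lgR_ge0// -[X in _ <= X]mulrA -expRD ler_wpM2l// ler_expR//.
Qed.

(** Every p > 0 is reached from [1, 2] by unit shifts. A shift multiplies [lgR q 1 t] by 1 + t^2 /
    q^2, which is comparable to 1 + t^2 and so matches the change of exponent. *)
Lemma lgR_ratio l p : 0 < l -> 0 < p -> exists2 K, 0 < K & forall t,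
  lgR 1 l t <= K * expR ((1 - p) * ln (1 + t ^+ 2)) * lgR p 1 t.
Proof.
move=> l0.
have H12 q : 1 <= q <= 2 -> exists2 K, 0 < K & forall t,
    lgR 1 l t <= K * expR ((1 - q) * ln (1 + t ^+ 2)) * lgR q 1 t.
  move=> q12; exists (8 * expR 1) => [|t]; first by rewrite mulr_gt0// expR_gt0.
  exact: lgR_ratio12.
have expln t : expR (ln (1 + t ^+ 2)) = 1 + t ^+ 2.
  by rewrite lnK// posrE ltr_wpDr// sqr_ge0.
have Hup q : 1 <= q -> (exists2 K, 0 < K & forall t,
    lgR 1 l t <= K * expR ((1 - q) * ln (1 + t ^+ 2)) * lgR q 1 t) ->
    exists2 K, 0 < K & forall t,
    lgR 1 l t <= K * expR ((1 - (q + 1)) * ln (1 + t ^+ 2)) * lgR (q + 1) 1 t.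
  move=> q1 [K K0 HK]; have q0 : 0 < q by lra.
  have q20 : 0 < q ^+ 2 by rewrite exprn_gt0.
  exists (K * q ^+ 2) => [|t]; first by rewrite mulr_gt0.
  apply: (le_trans (HK t)); rewrite (lgR_rec t q0 ltr01) [leRHS]mulrA ler_wpM2r ?lgR_ge0//.
  have -> : (1 - q) * ln (1 + t ^+ 2) = (1 - (q + 1)) * ln (1 + t ^+ 2) + ln (1 + t ^+ 2) by ring.
  rewrite expRD expln.
  set E := expR _; have E0 : 0 <= E by exact: expR_ge0.
  have -> : K * q ^+ 2 * E * (1 + t ^+ 2 / q ^+ 2) = K * (E * (q ^+ 2 + t ^+ 2)).
    by field; rewrite gt_eqF.
  rewrite ler_wpM2l ?(ltW K0)// ler_wpM2l// lerD2r.
  by rewrite expr_ge1// ltW.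
have Hdn q : 0 < q -> (exists2 K, 0 < K & forall t,
    lgR 1 l t <= K * expR ((1 - (q + 1)) * ln (1 + t ^+ 2)) * lgR (q + 1) 1 t) ->
    exists2 K, 0 < K & forall t,
    lgR 1 l t <= K * expR ((1 - q) * ln (1 + t ^+ 2)) * lgR q 1 t.
  move=> q0 [K K0 HK].
  have q20 : 0 < q ^+ 2 by rewrite exprn_gt0.
  have iq0 : 0 < (q ^+ 2)^-1 by rewrite invr_gt0.
  exists (K * (1 + (q ^+ 2)^-1)) => [|t]; first by rewrite mulr_gt0// addr_gt0.
  apply: (le_trans (HK t)); rewrite (lgR_rec t q0 ltr01) [leLHS]mulrA ler_wpM2r ?lgR_ge0//.
  have -> : (1 - q) * ln (1 + t ^+ 2) = (1 - (q + 1)) * ln (1 + t ^+ 2) + ln (1 + t ^+ 2) by ring.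
  rewrite expRD expln.
  set E := expR _; have E0 : 0 <= E by exact: expR_ge0.
  have -> : K * (1 + (q ^+ 2)^-1) * (E * (1 + t ^+ 2)) =
    K * (E * ((1 + (q ^+ 2)^-1) * (1 + t ^+ 2))) by ring.
  rewrite -[leLHS]mulrA ler_wpM2l ?(ltW K0)// ler_wpM2l//.
  by have := sqr_ge0 t; nra.
have Hn n : forall q, 0 < q -> q <= n%:R + 2 -> exists2 K, 0 < K & forall t,
    lgR 1 l t <= K * expR ((1 - q) * ln (1 + t ^+ 2)) * lgR q 1 t.
  elim: n => [|n IH] q q0 qn.
    have [q1|q1] := leP 1 q; first by apply: H12; lra.
    by apply: Hdn => //; apply: H12; lra.
  have [q2|q2] := leP q 2; first by apply: IH; rewrite // (le_trans q2)// lerDr.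
  have -> : q = (q - 1) + 1 by ring.
  by apply: Hup; [lra|apply: IH; rewrite -(natr1 n) in qn; lra].
by move=> p0; have [n Hpn] := large_shift p; apply: (Hn n) => //; lra.
Qed.

End modulus.

Global Opaque lgN lgR.

(** * Fourier inversion and the truncation bias *)

Section decay.
Context {R : realType}.
Notation mu := (@lebesgue_measure R).
Implicit Types a l t x p : R.

Lemma sqr_decay_le (a b t : R) : 0 < b -> b <= 1 -> b <= a ->
  b ^+ 2 * (1 + t ^+ 2) <= a ^+ 2 + t ^+ 2.
Proof.
move=> b0 b1 ba; have t20 := sqr_ge0 t.
have ba2 : b ^+ 2 <= a ^+ 2 by rewrite ler_sqr ?nnegrE; lra.
have b12 : b ^+ 2 <= 1 by rewrite -(expr1n _ 2) ler_sqr ?nnegrE; lra.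
have := ler_wpM2r t20 b12; rewrite mul1r mulrDr mulr1.
by move: ba2; clear; lra.
Qed.

(** Two steps of the recurrence express l^4 [lgN (a + 1 + 1) l t], a bounded quantity, as (a^2 +
    t^2) ((a + 1)^2 + t^2) [lgN a l t]. With b = min(1, a), both factors are at least b^2 (1 +
    t^2). *)
Lemma lgCS_decay a l : 0 < a -> 0 < l -> exists2 K, 0 <= K & forall t,
  `|lgC a l t| <= K * (1 + t ^+ 2)^-1 /\ `|lgS a l t| <= K * (1 + t ^+ 2)^-1.
Proof.
move=> a0 l0; pose b := Num.min 1 a.
have b0 : 0 < b by rewrite lt_min ltr01.
have b1 : b <= 1 by rewrite ge_min lexx.
have ba : b <= a by rewrite ge_min lexx orbT.
have a10 : 0 < a + 1 by lra.
have ba1 : b <= a + 1 by lra.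
clearbody b.
have a20 : 0 < a + 1 + 1 by lra.
have G0 := lgG_ge0 (a + 1 + 1) l.
have N2 t := lgN_le t a20 l0.
set G := lgG _ _ in G0 N2; clearbody G.
exists (2 * l ^+ 2 * G / b ^+ 2) => [|t].
  by rewrite divr_ge0 ?sqr_ge0// !mulr_ge0// ltW.
have t20 := sqr_ge0 t.
have t1 : 0 < 1 + t ^+ 2 by move: t20; clear; lra.
have NK : lgN a l t <= (2 * l ^+ 2 * G / b ^+ 2 * (1 + t ^+ 2)^-1) ^+ 2.
  have Hb := sqr_decay_le t b0 b1 ba.
  have Hb1 := sqr_decay_le t b0 b1 ba1.
  have bt0 : 0 < b ^+ 2 * (1 + t ^+ 2) by rewrite mulr_gt0// exprn_gt0.
  have -> : (2 * l ^+ 2 * G / b ^+ 2 * (1 + t ^+ 2)^-1) ^+ 2 =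
      (l ^+ 2 * (l ^+ 2 * (4 * G ^+ 2))) / (b ^+ 2 * (1 + t ^+ 2)) ^+ 2.
    by field; rewrite !gt_eqF.
  rewrite ler_pdivlMr ?exprn_gt0//.
  apply: (@le_trans _ _ (l ^+ 2 * (l ^+ 2 * lgN (a + 1 + 1) l t))); last first.
    by rewrite !ler_wpM2l ?sqr_ge0//; have := sqr_ge0 G; move: (N2 t); clear; lra.
  rewrite (lgN_rec t a10 l0) [leRHS]mulrCA (lgN_rec t a0 l0) [leRHS]mulrA [leLHS]mulrC ler_wpM2r ?lgN_ge0// expr2.
  by apply: ler_pM Hb1 Hb; exact: ltW.
have K0 : 0 <= 2 * l ^+ 2 * G / b ^+ 2 * (1 + t ^+ 2)^-1.
  by rewrite mulr_ge0 ?invr_ge0 ?(ltW t1)// divr_ge0 ?sqr_ge0// !mulr_ge0// ltW.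
move: NK K0; set K := (_ / _) => NK K0.
have sC := sqr_ge0 (lgC a l t); have sS := sqr_ge0 (lgS a l t).
rewrite lgNE in NK.
by split; rewrite -ler_sqr ?nnegrE// sqr_normr; move: NK sC sS; clear; lra.
Qed.

Lemma Rintegral_poisson (d x : R) : 0 < d ->
  mu.-rint (fun y => d * (d ^+ 2 + (y - x) ^+ 2)^-1) /\
  \int[mu]_y (d * (d ^+ 2 + (y - x) ^+ 2)^-1) = pi.
Proof.
move=> d0; have d20 : 0 < d ^+ 2 by rewrite exprn_gt0.
have p0 y : 0 < d ^+ 2 + (y - x) ^+ 2 by rewrite ltr_wpDr// sqr_ge0.
have dF y : der1 (fun y => atan ((y - x) / d)) y (d * (d ^+ 2 + (y - x) ^+ 2)^-1).
  have D := der1_atan (der1M (der1B (der1_id y) (der1_cst x y)) (der1_cst d^-1 y)).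
  by apply: (der1_eq D); field; rewrite !gt_eqF//; have := p0 y; nra.
have cf : continuous (fun y => d * (d ^+ 2 + (y - x) ^+ 2)^-1).
  move=> y; apply: cvgMl_tmp; apply: cvgV; first by rewrite gt_eqF.
  have : continuous (fun y => d ^+ 2 + (y - x) ^+ 2) by der_cont.
  exact.
have hf : mu.-rint (fun y => d * (d ^+ 2 + (y - x) ^+ 2)^-1).
  apply: (@rint_decay _ _ (d * (1 + 2 * (1 + x ^+ 2) / d ^+ 2 + 2))).
    exact: continuous_measurable_fun.
  move=> y; rewrite ger0_norm; last by rewrite mulr_ge0 ?invr_ge0 ?(ltW d0) ?(ltW (p0 y)).
  rewrite -mulrA ler_wpM2l ?(ltW d0)// ler_pdivlMr ?ltr_wpDr ?sqr_ge0//.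
  rewrite mulrC ler_pdivrMr//.
  have x20 := sqr_ge0 x; have yx := sqr_ge0 (y - x).
  have -> : (1 + 2 * (1 + x ^+ 2) / d ^+ 2 + 2) * (d ^+ 2 + (y - x) ^+ 2) =
    d ^+ 2 * 3 + 3 * (y - x) ^+ 2 + 2 * (1 + x ^+ 2) + 2 * (1 + x ^+ 2) / d ^+ 2 * (y - x) ^+ 2.
    by field; rewrite gt_eqF.
  have : 0 <= 2 * (1 + x ^+ 2) / d ^+ 2 * (y - x) ^+ 2.
    by rewrite mulr_ge0// divr_ge0 ?(ltW d20)//; lra.
  by have := sqr_ge0 (y - 2 * x); nra.
split => //.
have atl (g : nat -> R) : g n @[n --> \oo] --> +oo -> atan (g n) @[n --> \oo] --> (pi / 2 : R).
  by move=> /cvg_comp; apply; exact: cvgy_atan.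
have gy (s e : R) : 0 < s -> (n%:R * s + e) @[n --> \oo] --> +oo.
  move=> s0; apply/cvgryPge => A; near=> n.
  rewrite -lerBlDr -ler_pdivrMr//.
  by near: n; exact: nbhs_infty_ger.
have di0 : 0 < d^-1 by rewrite invr_gt0.
rewrite (RFTC_line (l2 := pi / 2) (l1 := - (pi / 2)) dF cf hf).
- by lra.
- have /atl := gy d^-1 (- x / d) di0.
  by under eq_fun do rewrite -mulrDl.
- have /atl := gy d^-1 (x / d) di0 => /cvgN.
  rewrite (_ : - _ = fun n => atan ((- n%:R - x) / d)) //.
  by apply/funext => n /=; rewrite !fctE -mulrDl -atanN -mulNr opprD.
Unshelve. all: by end_near. Qed.

(** The damping e^(-d |t|) has the Poisson kernel as its transform, so that a damped inversion
    integral becomes a convolution with that kernel. *)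
Lemma Rintegral_abel (d v : R) : 0 < d ->
  \int[mu]_t (expR (- (d * `|t|)) * cos (t * v)) = 2 * d * (d ^+ 2 + v ^+ 2)^-1.
Proof.
move=> d0.
have q0 : 0 < d ^+ 2 + v ^+ 2 by rewrite ltr_wpDr ?sqr_ge0// exprn_gt0.
have hf : mu.-rint (fun t => expR (- (d * `|t|)) * cos (t * v)).
  apply: (@rint_decay _ _ (1 + 2 / d ^+ 2)).
    apply: measurable_funM; last by apply: continuous_measurable_fun; der_cont.
    apply: measurableT_comp => //; apply: measurableT_comp => //.
    exact: measurable_funM.
  move=> t; rewrite normrM (ger0_norm (expR_ge0 _)) (le_trans _ (exp_abs_decay t d0))//.
  by rewrite ler_piMr ?expR_ge0// cos_max.
rewrite Rintegral_fold//.
pose F t := 2 * (expR (- (d * t)) * ((v * sin (t * v) - d * cos (t * v)) / (d ^+ 2 + v ^+ 2))).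
rewrite (@RFTC_y _ (fun t => 2 * (expR (- (d * t)) * cos (t * v)))
  (fun t => expR (- (d * `|t|)) * cos (t * v) + expR (- (d * `|- t|)) * cos (- t * v)) F 0 0).
- by rewrite /F mulr0 oppr0 expR0 mul0r sin0 cos0; field; rewrite gt_eqF.
- move=> t; rewrite /F; der.
  by field; rewrite gt_eqF.
- by der_cont.
- exact: rintD hf (rint_opp hf).
- by move=> t t0; rewrite normrN ger0_norm// mulNr cosN; ring.
- pose M := 2 * ((`|v| + d) / (d ^+ 2 + v ^+ 2)).
  have M0 : 0 <= M by rewrite mulr_ge0// divr_ge0 ?(ltW q0)// addr_ge0// ltW.
  have HF t : `|F t| <= M * expR (- (d * t)).
    rewrite /F /M normrM ger0_norm// -[leRHS]mulrA ler_wpM2l// normrM (ger0_norm (expR_ge0 _)).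
    rewrite [leRHS]mulrC ler_wpM2l ?expR_ge0// normrM.
    rewrite [X in _ * X <= _]ger0_norm ?invr_ge0 ?(ltW q0)// ler_wpM2r ?invr_ge0 ?(ltW q0)//.
    rewrite (le_trans (ler_normB _ _))// !normrM (ger0_norm (ltW d0)).
    by rewrite lerD// ler_piMr ?sin_max ?cos_max// ltW.
  clearbody M; have [|H _] := @cvg_decay R (fun t => F `|t|) (M * (1 + 2 / d ^+ 2)).
    by move=> t; rewrite (le_trans (HF _))// -mulrA ler_wpM2l// exp_abs_decay.
  by under eq_fun do rewrite add0r -[n in F n](ger0_norm (ler0n R _)).
Qed.

End decay.

Section inversion.
Context {R : realType}.
Notation mu := (@lebesgue_measure R).
Notation mR := (measurableTypeR R).
Implicit Types a l t x y : R.

Lemma measurable_cos_comp d (T : measurableType d) (f : T -> R) :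
  measurable_fun setT f -> measurable_fun setT (fun w => cos (f w)).
Proof.
by apply: (measurableT_comp (f := cos)); apply: continuous_measurable_fun; exact: continuous_cos.
Qed.

Lemma measurable_sin_comp d (T : measurableType d) (f : T -> R) :
  measurable_fun setT f -> measurable_fun setT (fun w => sin (f w)).
Proof.
by apply: (measurableT_comp (f := sin)); apply: continuous_measurable_fun; exact: continuous_sin.
Qed.

Lemma measurable_oneDsqrV : measurable_fun setT (fun t : R => (1 + t ^+ 2)^-1).
Proof. by apply: continuous_measurable_fun; exact: continuous_oneDsqrV. Qed.

(** Measurability of a partial integral is part of Fubini's theorem, but [f] has no integrable
    majorant in [t]; the weight 1 / (1 + t^2) supplies one and is divided out afterwards. *)
Lemma measurable_fun_param (f : R -> R -> R) (v : R -> R) :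
  measurable_fun setT (fun z : mR * mR => f z.1 z.2) -> mu.-rint v ->
  (forall t x, `|f t x| <= v x) ->
  measurable_fun setT (fun t => \int[mu]_x f t x).
Proof.
move=> mf hv fv.
have [|||h _ _] := @Fubini_dominated _ _ mR mR R mu mu
  (fun t x => (1 + t ^+ 2)^-1 * f t x) (fun t => (1 + t ^+ 2)^-1) v _ _ hv.
- apply: measurable_funM => //.
  apply: (measurableT_comp (f := fun t : R => (1 + t ^+ 2)^-1)); first exact: measurable_oneDsqrV.
  exact: measurable_fst.
- exact: rint_oneDsqrV.
- move=> t x; rewrite normrM ger0_norm ?invr_ge0 ?addr_ge0 ?sqr_ge0//.
  by rewrite ler_wpM2l// invr_ge0 addr_ge0// sqr_ge0.
have hf t : mu.-rint (f t).
  apply: (rint_dom (m := mu) _ (fv t) hv).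
  exact: (measurable_fun_pair2 (f := fun z : mR * mR => f z.1 z.2)).
rewrite (_ : (fun t => _) = fun t => (1 + t ^+ 2) *
    \int[mu]_x ((1 + t ^+ 2)^-1 * f t x)).
  apply: measurable_funM; last exact: rint_measurable h.
  by apply: continuous_measurable_fun; der_cont.
apply/funext => t; rewrite RintegralTZ// mulrA mulfV ?mul1r//.
by rewrite gt_eqF// ltr_wpDr ?sqr_ge0.
Qed.

Lemma measurable_lgC a l : 0 < a -> 0 < l -> measurable_fun setT (lgC a l).
Proof.
move=> a0 l0; rewrite (_ : lgC a l = fun t => \int[mu]_x (cos (t * x) * lgw a l x)); last first.
  by apply/funext => t; rewrite lgCE.
apply: (@measurable_fun_param _ (lgw a l)); last 2 first.
- exact: rint_lgw.
- move=> t x; rewrite normrM (ger0_norm (ltW (lgw_gt0 _ _ _))).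
  by rewrite ler_piMl ?cos_max// ltW// lgw_gt0.
apply: measurable_funM.
  by apply: measurable_cos_comp; exact: measurable_funM measurable_fst measurable_snd.
apply: (measurableT_comp (f := lgw a l)); first exact: measurable_lgw.
exact: measurable_snd.
Qed.

Lemma measurable_lgS a l : 0 < a -> 0 < l -> measurable_fun setT (lgS a l).
Proof.
move=> a0 l0; rewrite (_ : lgS a l = fun t => \int[mu]_x (sin (t * x) * lgw a l x)); last first.
  by apply/funext => t; rewrite lgSE.
apply: (@measurable_fun_param _ (lgw a l)); last 2 first.
- exact: rint_lgw.
- move=> t x; rewrite normrM (ger0_norm (ltW (lgw_gt0 _ _ _))).
  by rewrite ler_piMl ?sin_max// ltW// lgw_gt0.
apply: measurable_funM.
  by apply: measurable_sin_comp; exact: measurable_funM measurable_fst measurable_snd.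
apply: (measurableT_comp (f := lgw a l)); first exact: measurable_lgw.
exact: measurable_snd.
Qed.

Lemma rint_lgC a l : 0 < a -> 0 < l -> mu.-rint (lgC a l).
Proof.
move=> a0 l0; have [K K0 HK] := lgCS_decay a0 l0.
by apply: rint_decay; [exact: measurable_lgC|move=> t; exact: (HK t).1].
Qed.

Lemma rint_lgS a l : 0 < a -> 0 < l -> mu.-rint (lgS a l).
Proof.
move=> a0 l0; have [K K0 HK] := lgCS_decay a0 l0.
by apply: rint_decay; [exact: measurable_lgS|move=> t; exact: (HK t).2].
Qed.

(* The real part of [e^(i t x)] times the conjugate of the Fourier transform of
   [lgw a l] at [t]. *)
Definition lgI a l t x : R := cos (t * x) * lgC a l t + sin (t * x) * lgS a l t.

Lemma rint_lgI a l x : 0 < a -> 0 < l -> mu.-rint (lgI a l ^~ x).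
Proof.
move=> a0 l0; apply: rintD.
  apply: (rintM (m := mu) (M := 1)); last exact: rint_lgC.
    by apply: continuous_measurable_fun; der_cont.
  by move=> t; exact: cos_max.
apply: (rintM (m := mu) (M := 1)); last exact: rint_lgS.
  by apply: continuous_measurable_fun; der_cont.
by move=> t; exact: sin_max.
Qed.

Lemma lgI_le a l t x : `|lgI a l t x| <= `|lgC a l t| + `|lgS a l t|.
Proof.
rewrite (le_trans (ler_normD _ _))// !normrM lerD// ler_piMl//.
- exact: cos_max.
- exact: sin_max.
Qed.

Lemma lgIE a l t x : 0 < a -> 0 < l ->
  lgI a l t x = \int[mu]_y (cos (t * (x - y)) * lgw a l y).
Proof.
move=> a0 l0; rewrite /lgI lgCE lgSE -!RintegralTZ; last 2 first.
- exact: rint_sin_lgw.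
- exact: rint_cos_lgw.
rewrite -RintegralTD.
- by apply: eq_Rintegral => y _; rewrite mulrBr cosB; ring.
- by apply: rintZ; exact: rint_cos_lgw.
- by apply: rintZ; exact: rint_sin_lgw.
Qed.

Lemma abel_lgI a l d x : 0 < a -> 0 < l -> 0 < d ->
  \int[mu]_t (expR (- (d * `|t|)) * lgI a l t x) =
  \int[mu]_y (lgw a l y * (2 * d * (d ^+ 2 + (x - y) ^+ 2)^-1)).
Proof.
move=> a0 l0 d0.
have me : measurable_fun setT (fun t : R => expR (- (d * `|t|))).
  apply: measurableT_comp => //; apply: measurableT_comp => //.
  exact: measurable_funM.
have -> : \int[mu]_t (expR (- (d * `|t|)) * lgI a l t x) =
    \int[mu]_t \int[mu]_y (expR (- (d * `|t|)) * (cos (t * (x - y)) * lgw a l y)).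
  apply: eq_Rintegral => t _; rewrite lgIE// RintegralTZ//.
  apply: rint_lgwM => //; last by move=> y; exact: cos_max.
  by apply: continuous_measurable_fun; der_cont.
have [|||_ _ ->] := @Fubini_dominated _ _ mR mR R mu mu
  (fun t y => expR (- (d * `|t|)) * (cos (t * (x - y)) * lgw a l y))
  (fun t => expR (- (d * `|t|))) (lgw a l) _ _ (rint_lgw a0 l0).
- apply: measurable_funM.
    by apply: (measurableT_comp me); exact: measurable_fst.
  apply: measurable_funM.
    apply: measurable_cos_comp; apply: measurable_funM; first exact: measurable_fst.
    by apply: measurable_funB => //; exact: measurable_snd.
  apply: (measurableT_comp (f := lgw a l)); first exact: measurable_lgw.
  exact: measurable_snd.
- apply: (@rint_decay _ _ (1 + 2 / d ^+ 2)) => // t.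
  by rewrite (ger0_norm (expR_ge0 _)); exact: exp_abs_decay.
- move=> t y; rewrite normrM (ger0_norm (expR_ge0 _)) ler_wpM2l ?expR_ge0//.
  rewrite normrM (ger0_norm (ltW (lgw_gt0 _ _ _))).
  by rewrite ler_piMl ?cos_max// ltW// lgw_gt0.
apply: eq_Rintegral => y _.
rewrite -(Rintegral_abel _ d0) -RintegralTZ; first by apply: eq_Rintegral => t _; ring.
apply: (@rint_decay _ _ (1 + 2 / d ^+ 2)).
  by apply: measurable_funM => //; apply: continuous_measurable_fun; der_cont.
move=> t; rewrite normrM (ger0_norm (expR_ge0 _)) (le_trans _ (exp_abs_decay t d0))//.
by rewrite ler_piMr ?expR_ge0// cos_max.
Qed.

(* Abel summation: the Poisson kernel is an approximate identity. *)
Lemma lgI_inversion a l x : 0 < a -> 0 < l ->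
  \int[mu]_t lgI a l t x = 2 * pi * lgw a l x.
Proof.
move=> a0 l0.
pose d (n : nat) : R := n.+1%:R^-1.
have d0 n : 0 < d n by rewrite invr_gt0.
have cd : d n @[n --> \oo] --> 0 by exact: cvg_harmonic.
have [M M0 HM] : exists2 M : R, 0 <= M & forall y, lgw a l y <= M.
  have [K K0 HK] := lgw_decay a0 l0; exists K => // y.
  rewrite (le_trans (HK y))// ler_piMr// invf_le1 ?lerDl ?sqr_ge0//.
  by rewrite ltr_wpDr// sqr_ge0.
have L : \int[mu]_t (expR (- (d n * `|t|)) * lgI a l t x) @[n --> \oo] -->
    \int[mu]_t lgI a l t x.
  have [] // := @dominated_cvg_Rintegral _ _ _ mu
    (fun n t => expR (- (d n * `|t|)) * lgI a l t x) (lgI a l ^~ x)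
    (fun t => `|lgI a l t x|).
  - move=> n; apply: measurable_funM; last exact: rint_measurable (rint_lgI x a0 l0).
    apply: measurableT_comp => //; apply: measurableT_comp => //.
    exact: measurable_funM.
  - exact: rint_abs (rint_lgI x a0 l0).
  - move=> n t; rewrite normrM (ger0_norm (expR_ge0 _)) ler_piMl//.
    by rewrite expR_le1 oppr_le0 mulr_ge0// ltW.
  - move=> t; rewrite -[X in _ --> X]mul1r; apply: cvgMr_tmp.
    rewrite -expR0; apply: (continuous_cvg _ (@continuous_expR R _)).
    rewrite -oppr0; apply: cvgN; rewrite -[X in _ --> X](mul0r `|t|).
    exact: cvgMr_tmp.
apply/eqP; rewrite -subr_eq0 -normr_le0; apply/ler_addgt0Pr => e e0; rewrite add0r.
pose eta := e / (2 * pi * 2).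
have eta0 : 0 < eta by rewrite !divr_gt0// !mulr_gt0// pi_gt0.
have [r r0 Hr] : exists2 r : R, 0 < r & forall y, `|y - x| < r -> `|lgw a l y - lgw a l x| <= eta.
  have /cvgrPdist_le /(_ _ eta0) /nbhs_ballP [r /= r0 Hr] := @lgw_continuous R a l x.
  exists r => // y yx; rewrite distrC; apply: Hr; rewrite /ball /=.
  by rewrite distrC.
pose Kr := M * (1 + (r ^+ 2)^-1).
have Kr0 : 0 <= Kr by rewrite mulr_ge0// addr_ge0// invr_ge0 sqr_ge0.
(* One bound for near and far points: continuity gives [eta] near x, and beyond distance r the last
   factor is at least r^2 / (1 + r^2). Against the Poisson kernel, the last term contributes only a
   multiple of [d n]. *)
have key y : `|lgw a l y - lgw a l x| <= eta + Kr * ((y - x) ^+ 2 / (1 + (y - x) ^+ 2)).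
  have q0 : 0 <= (y - x) ^+ 2 := sqr_ge0 _.
  have q1 : 0 < 1 + (y - x) ^+ 2 by rewrite ltr_wpDr.
  have [yr|yr] := ltP `|y - x| r.
    by rewrite (le_trans (Hr y yr))// lerDl mulr_ge0// divr_ge0// ltW.
  apply: (@le_trans _ _ M).
    rewrite ler_norml; have := HM x; have := HM y.
    by have := lgw_gt0 a l x; have := lgw_gt0 a l y; lra.
  rewrite -[leLHS]add0r lerD ?(ltW eta0)// -[leLHS]mulr1 /Kr -mulrA ler_wpM2l//.
  have r2 : r ^+ 2 <= (y - x) ^+ 2.
    by rewrite -(sqr_normr (y - x)) ler_sqr ?nnegrE// ltW.
  have r20 : 0 < r ^+ 2 by rewrite exprn_gt0.
  rewrite mulrA ler_pdivlMr// mul1r mulrDl mul1r addrC lerD2l mulrC.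
  by rewrite ler_pdivlMr// mul1r.
clearbody Kr.
have bound n : `|\int[mu]_t (expR (- (d n * `|t|)) * lgI a l t x) - 2 * pi * lgw a l x|
    <= 2 * pi * eta + 2 * Kr * pi * d n.
  have [hP IP] := Rintegral_poisson x (d0 n).
  have [h1 I1] := @Rintegral_poisson R 1 x ltr01.
  have Psym y : d n ^+ 2 + (x - y) ^+ 2 = d n ^+ 2 + (y - x) ^+ 2 by ring.
  have hw : mu.-rint (fun y => lgw a l y * (d n * (d n ^+ 2 + (y - x) ^+ 2)^-1)).
    apply: (rintM (m := mu) (M := M)) => //; first exact: measurable_lgw.
    by move=> y; rewrite (ger0_norm (ltW (lgw_gt0 _ _ _))).
  have -> : \int[mu]_t (expR (- (d n * `|t|)) * lgI a l t x) - 2 * pi * lgw a l x =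
      2 * \int[mu]_y ((lgw a l y - lgw a l x) * (d n * (d n ^+ 2 + (y - x) ^+ 2)^-1)).
    rewrite abel_lgI//.
    rewrite (_ : \int[mu]_y ((lgw a l y - lgw a l x) * _) =
       \int[mu]_y (lgw a l y * (d n * (d n ^+ 2 + (y - x) ^+ 2)^-1)) - lgw a l x * pi).
      rewrite mulrBr -RintegralTZ//; congr (_ - _); last by ring.
      by apply: eq_Rintegral => y _; rewrite Psym; ring.
    rewrite -[in RHS]IP -RintegralTZ// -RintegralTB//; last exact: rintZ.
    by apply: eq_Rintegral => y _; rewrite mulrBl.
  rewrite normrM ger0_norm//.
  have -> : 2 * pi * eta + 2 * Kr * pi * d n = 2 * \int[mu]_y (
      eta * (d n * (d n ^+ 2 + (y - x) ^+ 2)^-1) +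
      Kr * d n * (1 * (1 ^+ 2 + (y - x) ^+ 2)^-1)).
    rewrite RintegralTD; [|exact: rintZ..].
    by rewrite (RintegralTZ eta hP) (RintegralTZ (Kr * d n) h1) I1 IP; ring.
  rewrite ler_wpM2l//; apply: le_norm_RintegralT.
  - rewrite (_ : (fun _ => _) = fun y => lgw a l y * (d n * (d n ^+ 2 + (y - x) ^+ 2)^-1) -
      lgw a l x * (d n * (d n ^+ 2 + (y - x) ^+ 2)^-1)).
      by apply: rintB => //; exact: rintZ.
    by apply/funext => y; rewrite mulrBl.
  - by apply: rintD; exact: rintZ.
  move=> y.
  have q0 : 0 <= (y - x) ^+ 2 := sqr_ge0 _.
  have q1 : 0 < 1 + (y - x) ^+ 2 by rewrite ltr_wpDr.
  have dq1 : 0 < d n ^+ 2 + (y - x) ^+ 2 by rewrite ltr_wpDr// exprn_gt0.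
  have P0 : 0 <= d n * (d n ^+ 2 + (y - x) ^+ 2)^-1.
    by rewrite mulr_ge0 ?invr_ge0 ?(ltW (d0 n)) ?(ltW dq1).
  rewrite normrM (ger0_norm P0) (le_trans (ler_wpM2r P0 (key y)))// mulrDl lerD2l.
  rewrite [leLHS](_ : _ = Kr * d n * (1 + (y - x) ^+ 2)^-1 *
    ((y - x) ^+ 2 / (d n ^+ 2 + (y - x) ^+ 2))); last by ring.
  rewrite expr1n mul1r ler_piMr//.
    by rewrite !mulr_ge0 ?invr_ge0 ?(ltW (d0 n)) ?(ltW q1).
  by rewrite ler_pdivrMr// mul1r lerDr sqr_ge0.
have lhs : `|\int[mu]_t (expR (- (d n * `|t|)) * lgI a l t x) - 2 * pi * lgw a l x| @[n --> \oo]
    --> `|\int[mu]_t lgI a l t x - 2 * pi * lgw a l x|.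
  by apply: cvg_norm; apply: cvgB => //; exact: cvg_cst.
have rhs : (2 * pi * eta + 2 * Kr * pi * d n) @[n --> \oo] --> 2 * pi * eta.
  rewrite -[X in _ --> X]addr0; apply: cvgD; first exact: cvg_cst.
  by rewrite -[X in _ --> X](mulr0 (2 * Kr * pi)); exact: cvgMl_tmp.
apply: (@le_trans _ _ (2 * pi * eta)).
  by apply: (ler_cvg_to lhs rhs); apply: nearW.
rewrite /eta.
have -> : 2 * pi * (e / (2 * pi * 2)) = e / 2.
  by have := @pi_gt0 R; move: (pi : R) => q q0; field; rewrite gt_eqF.
by lra.
Qed.

End inversion.

(** * Tail of the inversion integral *)

Section truncation.
Context {R : realType}.
Notation mu := (@lebesgue_measure R).
Implicit Types a l t x y p A c : R.

Definition wnd A : set R := [set t | `|t| <= A].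

Lemma wndE A : wnd A = `[- A, A]%classic.
Proof. by apply/seteqP; split=> t; rewrite /wnd /= in_itv/= ler_norml. Qed.

Lemma measurable_wnd A : measurable (wnd A).
Proof. by rewrite wndE. Qed.

Lemma indic_wndN A t : \1_(wnd A) (- t) = \1_(wnd A) t :> R.
Proof.
rewrite !indicE; congr (_%:R); congr nat_of_bool.
by apply/idP/idP => /set_mem; rewrite /wnd/= ?normrN => H; apply/mem_set; rewrite /wnd/= ?normrN.
Qed.

Lemma integral_linexp_tail c A : 0 < c -> 1 <= A ->
  mu.-integrable `[A, +oo[ (EFin \o (fun t => (t + A) * expR (- (c * t)))) /\
  \int[mu]_(t in `[A, +oo[) ((t + A) * expR (- (c * t))) =
    (2 * A / c + 1 / c ^+ 2) * expR (- (c * A)).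
Proof.
move=> c0 A1; have A0 : 0 < A by lra.
(* Half of the exponent is spent on absorbing the linear factor, through t e^(-b t) <= 1 / b. *)
pose b := c / 2; have b0 : 0 < b by rewrite divr_gt0.
have eb t : expR (- (c * t)) = expR (- (b * t)) * expR (- (b * t)).
  by rewrite -expRD; congr expR; rewrite /b; field.
have tb t : t * expR (- (b * t)) <= b^-1.
  rewrite expRN ler_pdivrMr ?expR_gt0// ler_pdivlMl//.
  by have := expR_ge1Dx (b * t); lra.
have bc : b <= c by rewrite /b; lra.
clearbody b.
pose f t := (t + A) * expR (- (c * t)).
pose f2 t := \1_(`[A, +oo[ : set R) t * f t.
have f2E t : A <= t -> f2 t = f t.
  by move=> At; rewrite /f2 indicE mem_set ?mul1r//= in_itv/= At.
have f20 t : t < A -> f2 t = 0.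
  by move=> At; rewrite /f2 indicE memNset ?mul0r//= in_itv/= leNgt At.
have f_le t : A <= t -> 0 <= f t <= 2 * b^-1 * expR (- (b * t)).
  move=> At; have t0 : 0 < t by lra.
  rewrite /f mulr_ge0 ?expR_ge0//=; last lra.
  rewrite eb mulrA ler_wpM2r ?expR_ge0//.
  apply: (@le_trans _ _ (2 * (t * expR (- (b * t))))); last by rewrite ler_wpM2l.
  by rewrite mulrA ler_wpM2r ?expR_ge0//; lra.
have cf : continuous f by rewrite /f; der_cont.
have bi0 : 0 <= 2 * b^-1 by rewrite mulr_ge0// invr_ge0 ltW.
have hf2 : mu.-rint f2.
  apply: (@rint_decay _ _ (2 * b^-1 * (1 + 2 / b ^+ 2))).
    by apply: measurable_funM => //; exact: continuous_measurable_fun.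
  move=> t; have [At|At] := leP A t; last first.
    rewrite f20// normr0; apply: mulr_ge0.
      by rewrite mulr_ge0// addr_ge0// divr_ge0// sqr_ge0.
    by rewrite invr_ge0 addr_ge0// sqr_ge0.
  rewrite f2E//; have /andP[ft0 ft1] := f_le t At.
  rewrite ger0_norm// (le_trans ft1)// -[leRHS]mulrA ler_wpM2l//.
  have t0 : 0 <= t by rewrite (le_trans _ At)// ltW.
  by have := exp_abs_decay t b0; rewrite (ger0_norm t0).
pose F t := - (((t + A) / c + 1 / c ^+ 2) * expR (- (c * t))).
have F0 : F (A + n%:R) @[n --> \oo] --> 0.
  pose K := 2 * b^-1 / c + 1 / c ^+ 2.
  have K0 : 0 <= K by rewrite addr_ge0// divr_ge0// ?ltW// exprn_gt0.
  have [|H _] := @cvg_decay R (fun t => F (A + `|t|)) (K * (1 + 2 / b ^+ 2)).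
    move=> t; rewrite /F normrN ger0_norm; last first.
      rewrite mulr_ge0 ?expR_ge0// addr_ge0// divr_ge0// ?sqr_ge0 ?(ltW c0)//.
      by have := normr_ge0 t; lra.
    set s := A + `|t|; have As : A <= s by rewrite /s lerDl.
    apply: (@le_trans _ _ (K * expR (- (b * `|t|)))); last first.
      by rewrite -[leRHS]mulrA ler_wpM2l//; exact: exp_abs_decay.
    apply: (@le_trans _ _ (K * expR (- (b * s)))); last first.
      by rewrite ler_wpM2l// ler_expR lerN2 ler_wpM2l ?(ltW b0)// /s lerDr ltW.
    rewrite mulrDl /K [leRHS]mulrDl lerD//.
      have /andP[_ fs] := f_le s As.
      by rewrite mulrAC [leRHS]mulrAC ler_wpM2r// invr_ge0 ltW.
    rewrite ler_wpM2l ?divr_ge0 ?sqr_ge0// ler_expR lerN2 ler_wpM2r//.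
    by rewrite (le_trans (ltW A0)).
  by under eq_fun do rewrite -[n in A + n](ger0_norm (ler0n R _)).
split.
  have h : mu.-integrable `[A, +oo[ (EFin \o f2) by exact: integrableS hf2.
  apply: eq_integrable h => // t; rewrite inE/= in_itv/= andbT => At.
  by rewrite /= f2E.
have dF t : der1 F t (f t).
  by rewrite /F /f; der; field; rewrite gt_eqF.
rewrite (_ : \int[mu]_(t in _) _ = \int[mu]_(t in `[A, +oo[) f2 t); last first.
  by apply: eq_Rintegral => t; rewrite inE/= in_itv/= andbT => At; rewrite f2E.
rewrite (@RFTC_y _ f f2 F A 0)// /F sub0r opprK; congr (_ * _).
by field; rewrite gt_eqF.
Qed.

End truncation.

Section truncation_bounds.
Context {R : realType}.
Notation mu := (@lebesgue_measure R).
Implicit Types a l t x y p A c : R.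

Lemma expR_half_ln_sqr t : expR (ln (1 + t ^+ 2) / 2) ^+ 2 = 1 + t ^+ 2.
Proof.
rewrite -expRM_natl mulrC divfK// lnK// posrE ltr_wpDr ?sqr_ge0//.
Qed.

(** The transform is of order sqrt(t) e^(-pi t / 2). The bound sqrt(t) <= (t + A) / (2 sqrt(A)), an
    equality at t = A, replaces the root by a linear factor that integrates in closed form and keeps
    the order of the tail from A on. *)
Lemma lgCS_exp_decay l : 0 < l -> exists2 K, 0 <= K & forall A t, 1 <= A -> A <= t ->
  `|lgC 1 l t| + `|lgS 1 l t| <= K / Num.sqrt A * ((t + A) * expR (- (pi / 2 * t))).
Proof.
move=> l0; have G0 := lgG_gt0 ltr01 l0.
pose K2 := 4 * expR 4 * lgG 1 l ^+ 2.
have K20 : 0 <= K2 by rewrite mulr_ge0 ?sqr_ge0// mulr_ge0 ?expR_ge0.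
exists (Num.sqrt K2) => [|A t A1 At]; first exact: sqrtr_ge0.
have t0 : 0 < t by lra.
have A0 : 0 < A by lra.
have tA0 : 0 < t + A by lra.
have sA0 : 0 < Num.sqrt A by rewrite sqrtr_gt0.
set e := expR (- (pi / 2 * t)); have e0 : 0 < e by exact: expR_gt0.
have e2 : expR (- (pi * t)) = e ^+ 2.
  by rewrite /e -expRM_natl; congr expR; move: (pi : R) => q; field.
have NK : lgN 1 l t <= K2 * t * e ^+ 2.
  have HR := lgR_exp_decay l0 t0; rewrite lgRE ler_pdivrMr ?exprn_gt0// e2 in HR.
  apply: (le_trans HR).
  have h : expR (ln (1 + t ^+ 2) / 2) <= 2 * t.
    rewrite -ler_sqr ?nnegrE ?expR_ge0//; last lra.
    by rewrite expR_half_ln_sqr; nra.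
  rewrite /K2; set E := expR 4; set G := lgG 1 l ^+ 2; set H := expR (ln _ / 2) in h *.
  have -> : 4 * E * G * t * e ^+ 2 = 2 * E * (2 * t) * e ^+ 2 * G by ring.
  rewrite ler_wpM2r ?sqr_ge0// ler_wpM2r ?sqr_ge0// ler_wpM2l//.
  by rewrite mulr_ge0// expR_ge0.
clearbody K2.
pose B := Num.sqrt K2 / Num.sqrt A / 2 * (t + A) * e.
have B0 : 0 <= B.
  by rewrite !mulr_ge0 ?invr_ge0 ?sqrtr_ge0 ?(ltW tA0) ?(ltW e0).
have B2 : K2 * t * e ^+ 2 <= B ^+ 2.
  rewrite /B !exprMn sqr_sqrtr// exprVn sqr_sqrtr ?(ltW A0)//.
  rewrite ler_wpM2r ?sqr_ge0// -!mulrA ler_wpM2l//.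
  rewrite ler_pdivlMl//.
  by have := sqr_ge0 (t - A); clear; lra.
have sC := sqr_ge0 (lgC 1 l t); have sS := sqr_ge0 (lgS 1 l t).
rewrite lgNE in NK.
have bd (u : R) : u ^+ 2 <= B ^+ 2 -> `|u| <= B.
  by rewrite -(sqr_normr u) ler_sqr ?nnegrE.
have -> : Num.sqrt K2 / Num.sqrt A * ((t + A) * e) = B + B.
  by rewrite /B; field; rewrite gt_eqF.
rewrite lerD// bd//; move: NK sC sS B2; clear; lra.
Qed.

(** By inversion, the difference is the part of the integral over |t| > A with A = pi m. It is of
    order sqrt(A) e^(-pi A / 2), whose square is of order m e^(-pi^2 m), uniformly in [x]. *)
Lemma lgI_truncation l : 0 < l -> exists2 K, 0 < K & forall (m : nat) x, (0 < m)%N ->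
  (lgw 1 l x - (2 * pi)^-1 * \int[mu]_t (\1_(wnd (pi * m%:R)) t * lgI 1 l t x)) ^+ 2
  <= K * m%:R * expR (- (pi ^+ 2 * m%:R)).
Proof.
move=> l0; have [K K0 HK] := lgCS_exp_decay l0.
have pi1 : (1:R) <= pi by rewrite (le_trans _ (pi_ge2 R))// ler1n.
have pi0 := @pi_gt0 R.
exists ((2 * pi)^-1 ^+ 2 * (6 * K) ^+ 2 * pi + 1) => [|m x m0].
  by rewrite ltr_wpDl// (mulr_ge0 _ (ltW pi0))// mulr_ge0 ?sqr_ge0.
have m1 : 1 <= m%:R :> R by rewrite ler1n.
pose A : R := pi * m%:R.
have A1 : 1 <= A by rewrite -[leLHS]mulr1 ler_pM.
have A0 : 0 < A by rewrite (lt_le_trans _ A1).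
rewrite -/A; have sA0 : 0 < Num.sqrt A by rewrite sqrtr_gt0.
pose f t := (1 - \1_(wnd A) t) * (`|lgC 1 l t| + `|lgS 1 l t|).
have hC := rint_lgC ltr01 l0; have hS := rint_lgS ltr01 l0.
have hI := rint_lgI x ltr01 l0.
have hW := rint_indic (m := mu) (measurable_wnd A) hI.
have h01 t : `|(1 - \1_(wnd A) t : R)| <= 1.
  by rewrite indicE; case: (_ \in _); rewrite ?subrr ?normr0 ?subr0 ?normr1.
have h0 t : 0 <= 1 - \1_(wnd A) t :> R.
  by rewrite indicE; case: (_ \in _); rewrite ?subrr ?subr0.
have mw : measurable_fun setT (fun t => 1 - \1_(wnd A) t : R).
  by apply: measurable_funB => //; apply: measurable_indic; exact: measurable_wnd.
have hf : mu.-rint f.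
  by apply: (rintM (m := mu) mw h01); apply: rintD; exact: rint_abs.
have fS t : f t <= `|lgC 1 l t| + `|lgS 1 l t|.
  by rewrite /f indicE; case: (_ \in _); rewrite ?subrr ?mul0r ?subr0 ?mul1r ?addr_ge0.
have f_even t : f (- t) = f t.
  by rewrite /f indic_wndN lgCN lgSN// normrN.
have c1 : 1 <= pi / 2 :> R by exact: pihalf_ge1.
have c0 : 0 < pi / 2 :> R by rewrite (lt_le_trans _ c1).
have [hj Ij] := integral_linexp_tail c0 A1.
pose e := expR (- (pi / 2 * A)).
have F : \int[mu]_t f t <= 6 * K * Num.sqrt A * e.
  (* [f] is even and vanishes on the window, so the fold of the line leaves the half-line from A
     on. *)
  have -> : \int[mu]_t f t = \int[mu]_(t in `[A, +oo[) (f t + f (- t)).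
    rewrite Rintegral_fold// Rintegral_indic (Rintegral_indic mu _ (fun t : R => f t + f (- t))).
    apply: eq_Rintegral => t _; rewrite f_even !indicE.
    have [At|At] := leP A t.
      by rewrite !mem_set//= in_itv/= ?At// (le_trans _ At)// ltW.
    rewrite [t \in `[A, +oo[%classic]memNset ?mul0r; last by rewrite /= in_itv/= leNgt At.
    have [t0|t0] := leP 0 t; last by rewrite memNset ?mul0r//= in_itv/= leNgt t0.
    by rewrite /f indicE (mem_set (_ : wnd A t)) ?subrr ?mul0r ?addr0 ?mulr0// /wnd/= ger0_norm// ltW.
  apply: (@le_trans _ _ (\int[mu]_(t in `[A, +oo[) (2 * (K / Num.sqrt A) * ((t + A) * expR (- (pi / 2 * t)))))).
    apply: le_Rintegral => //.
    - by apply: integrableS (rintD hf (rint_opp hf)).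
    - exact: (integrableZl _ _ hj).
    move=> t; rewrite /= in_itv/= andbT => At.
    rewrite f_even -mulrA mulr_natl mulr2n.
    by apply: lerD; rewrite (le_trans (fS t))//; exact: HK.
  rewrite RintegralZl// Ij -/e.
  have : 2 * A / (pi / 2) + 1 / (pi / 2) ^+ 2 <= 3 * A.
    have h1 : 2 * A / (pi / 2) <= 2 * A by rewrite ler_piMr ?invf_le1//; lra.
    have h2 : 1 / (pi / 2) ^+ 2 <= 1 :> R.
      by rewrite div1r invf_le1 ?exprn_gt0// exprn_ege1.
    by move: h1 h2 A1; clear; set u := _ / _; set v := _ / _; lra.
  move=> H; have {}H := ler_wpM2r (expR_ge0 (- (pi / 2 * A))) H.
  apply: (le_trans (ler_wpM2l _ H)).
    by rewrite !mulr_ge0 ?invr_ge0 ?sqrtr_ge0.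
  rewrite -/e -[A in 3 * A](sqr_sqrtr (ltW A0)).
  have -> : 2 * (K / Num.sqrt A) * (3 * Num.sqrt A ^+ 2 * e) = 6 * K * Num.sqrt A * e.
    by field; rewrite gt_eqF.
  by [].
have D : `|lgw 1 l x - (2 * pi)^-1 * \int[mu]_t (\1_(wnd A) t * lgI 1 l t x)| <=
    (2 * pi)^-1 * (6 * K * Num.sqrt A * e).
  have -> : lgw 1 l x = (2 * pi)^-1 * \int[mu]_t lgI 1 l t x.
    by rewrite lgI_inversion// mulKf// mulf_neq0// gt_eqF.
  rewrite -mulrBr -RintegralTB// normrM ger0_norm; last by rewrite invr_ge0 mulr_ge0// ltW.
  rewrite ler_wpM2l ?invr_ge0 ?mulr_ge0 ?(ltW pi0)//.
  apply: le_trans F; apply: le_norm_RintegralT => //; first exact: rintB.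
  move=> t; rewrite -[X in `|X - _|]mul1r -mulrBl normrM /f.
  by rewrite (ger0_norm (h0 t)) ler_wpM2l ?h0 ?lgI_le.
have R0 : 0 <= (2 * pi)^-1 * (6 * K * Num.sqrt A * e).
  by apply: le_trans D.
rewrite -sqr_normr; apply: (@le_trans _ _ (((2 * pi)^-1 * (6 * K * Num.sqrt A * e)) ^+ 2)).
  by rewrite ler_sqr ?nnegrE.
have e2 : e ^+ 2 = expR (- (pi ^+ 2 * m%:R)).
  by rewrite /e -expRM_natl /A; congr expR; move: (pi : R) => q; field.
have E (c s : R) : (c * (6 * K * s * e)) ^+ 2 = c ^+ 2 * (6 * K) ^+ 2 * s ^+ 2 * e ^+ 2.
  by ring.
rewrite E (sqr_sqrtr (ltW A0)) e2 ler_wpM2r ?expR_ge0// /A [leLHS]mulrA.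
by rewrite ler_wpM2r// lerDl.
Qed.

End truncation_bounds.

(** * Growth of the integral that bounds the variance *)

Section power_integral.
Context {R : realType}.
Notation mu := (@lebesgue_measure R).
Implicit Types a l t x y p A c : R.

(** Local form of [RFTC]: the antiderivatives below involve ln(1 + t), which is differentiable only
    for t > -1. *)
Lemma RFTC_segment (f F : R -> R) (a b : R) :
  (forall x, a <= x <= b -> der1 F x (f x)) ->
  (forall x, a <= x <= b -> {for x, continuous f}) -> a <= b ->
  \int[mu]_(x in `[a, b]) f x = F b - F a.
Proof.
move=> dF cf; rewrite le_eqVlt => /predU1P[->|ab].
  by rewrite set_itv1 Rintegral_set1 subrr.
have cF x : a <= x <= b -> {for x, continuous F}.
  by move=> /dF; exact: der1_continuous.
rewrite /Rintegral (@continuous_FTC2 _ _ F)//.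
- by apply: continuous_in_subspaceT => x /set_mem/= /[!in_itv]/=; exact: cf.
- split.
  + move=> x /[!in_itv]/= /andP[ax xb]; have := dF x.
    by rewrite (ltW ax) (ltW xb) => /(_ isT)[].
  + by apply/cvg_at_right_filter/cF; rewrite lexx ltW.
  + by apply/cvg_at_left_filter/cF; rewrite lexx ltW.
- move=> x /[!in_itv]/= /andP[ax xb]; have := dF x.
  by rewrite (ltW ax) (ltW xb) => /(_ isT)[_]; rewrite derive1E.
Qed.

Lemma integrable_segment (f : R -> R) (a b : R) :
  (forall x, a <= x <= b -> {for x, continuous f}) ->
  mu.-integrable `[a, b] (EFin \o f).
Proof.
move=> cf; apply: continuous_compact_integrable; first exact: segment_compact.
by apply: continuous_in_subspaceT => x /set_mem/= /[!in_itv]/=; exact: cf.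
Qed.

Lemma rint_wnd_continuous A (E : R -> R) : continuous E ->
  mu.-rint (fun t => \1_(wnd A) t * E t).
Proof.
move=> cE; have := @integrable_segment E (- A) A (fun x _ => cE x).
rewrite -wndE => h.
have {h} : mu.-integrable setT ((EFin \o E) \_ (wnd A)).
  exact: ((@integrable_mkcond _ _ _ mu (wnd A) (EFin \o E) (measurable_wnd A)).1 h).
apply: eq_integrable => // t _; rewrite /= patchE indicE.
by case: (_ \in _); rewrite ?mul1r ?mul0r.
Qed.

(** For t >= 0, 1 + t^2 and (1 + t)^2 agree up to a factor 2, so their powers of exponent 1 - p
    agree up to 2^|1 - p|; powers of 1 + t have an elementary antiderivative. *)
Lemma power_integral_le p : exists2 K, 0 <= K & forall A, 0 <= A ->
  \int[mu]_t (\1_(wnd A) t * expR ((1 - p) * ln (1 + t ^+ 2))) <=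
  K * \int[mu]_(t in `[0, A]) expR ((2 - 2 * p) * ln (1 + t)).
Proof.
pose c := expR (`|1 - p| * ln 2).
exists (2 * c) => [|A A0]; first by rewrite mulr_ge0// expR_ge0.
pose E t := expR ((1 - p) * ln (1 + t ^+ 2)).
have q0 t : 0 < 1 + t ^+ 2 by rewrite ltr_wpDr// sqr_ge0.
have cE : continuous E.
  move=> t; apply: der1_continuous; apply: der1_expR; apply: der1M; first exact: der1_cst.
  apply: der1_ln; first exact: q0.
  by apply: der1D; [exact: der1_cst|apply: der1_sqr; exact: der1_id].
have cg t : 0 <= t <= A -> {for t, continuous (fun t => expR ((2 - 2 * p) * ln (1 + t)))}.
  move=> /andP[t0 _]; apply: der1_continuous; apply: der1_expR; apply: der1M; first exact: der1_cst.
  apply: der1_ln; first by lra.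
  by apply: der1D; [exact: der1_cst|exact: der1_id].
have hE := rint_wnd_continuous A cE.
have -> : \int[mu]_t (\1_(wnd A) t * E t) = \int[mu]_(t in `[0, A]) (2 * E t).
  rewrite Rintegral_fold// Rintegral_indic (Rintegral_indic mu _ (fun t : R => 2 * E t)).
  apply: eq_Rintegral => t _; rewrite indic_wndN.
  have -> : E (- t) = E t by rewrite /E sqrrN.
  rewrite !indicE.
  have [t0|t0] := leP 0 t; last first.
    have n1 : ~ `[0, +oo[%classic t by rewrite /= in_itv/= leNgt t0.
    have n2 : ~ `[0, A]%classic t by rewrite /= in_itv/= leNgt t0.
    by rewrite (memNset n1) (memNset n2) !mul0r.
  rewrite (mem_set (_ : `[0, +oo[%classic t)) ?mul1r; last by rewrite /= in_itv/= t0.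
  rewrite wndE.
  have -> : (t \in `[- A, A]%classic) = (t \in `[0, A]%classic).
    apply/idP/idP => /set_mem/= /[!in_itv]/= /andP[h1 h2]; apply/mem_set => /=; rewrite in_itv/= h2 ?t0//.
    by rewrite andbT (le_trans _ t0)// oppr_le0.
  by ring.
have H t : 0 <= t <= A -> 2 * E t <= 2 * c * expR ((2 - 2 * p) * ln (1 + t)).
  move=> /andP[t0 _]; rewrite -mulrA ler_wpM2l// /E /c -expRD ler_expR.
  have t1 : 0 < 1 + t by lra.
  have l1 : ln (1 + t ^+ 2) <= 2 * ln (1 + t).
    rewrite mulr_natl -lnXn// ler_ln ?posrE ?exprn_gt0//.
    by nra.
  have l2 : 2 * ln (1 + t) <= ln 2 + ln (1 + t ^+ 2).
    rewrite mulr_natl -lnXn// -lnM ?posrE// ler_ln ?posrE ?exprn_gt0 ?mulr_gt0//.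
    by have := sqr_ge0 (t - 1); nra.
  have ln20 : 0 <= ln 2 :> R by rewrite ln_ge0// ler1n.
  have [p1|p1] := leP 0 (1 - p).
    rewrite ger0_norm//; move: (ler_wpM2l p1 l1) (mulr_ge0 p1 ln20); clear; lra.
  rewrite ltr0_norm//; have p2 : 0 <= - (1 - p) by lra.
  by move: (ler_wpM2l p2 l2); clear; lra.
rewrite -RintegralZl; [|by []|exact: integrable_segment].
apply: le_Rintegral => //.
- by apply: (integrable_segment (f := fun t => 2 * E t)) => t _; apply: cvgMl_tmp; exact: cE.
- apply: (integrable_segment (f := fun t => 2 * c * expR ((2 - 2 * p) * ln (1 + t)))) => t tA.
  by apply: cvgMl_tmp; exact: cg.
Qed.

Lemma power_integral_value p A : 0 <= A ->
  \int[mu]_(t in `[0, A]) expR ((2 - 2 * p) * ln (1 + t)) =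
  if p == 3 / 2 then ln (1 + A) else (expR ((3 - 2 * p) * ln (1 + A)) - 1) / (3 - 2 * p).
Proof.
move=> A0.
have cf t : 0 <= t <= A -> {for t, continuous (fun t => expR ((2 - 2 * p) * ln (1 + t)))}.
  move=> /andP[t0 _]; apply: der1_continuous; apply: der1_expR; apply: der1M; first exact: der1_cst.
  apply: der1_ln; first by lra.
  by apply: der1D; [exact: der1_cst|exact: der1_id].
have dl t : 0 <= t -> der1 (fun t => ln (1 + t)) t (1 + t)^-1.
  move=> t0; have t1 : 0 < 1 + t by lra.
  have D := @der1_ln _ (fun t => 1 + t) t _ t1 (der1D (der1_cst 1 t) (der1_id t)).
  by apply: (der1_eq D); ring.
have expl t : 0 <= t -> (1 + t)^-1 = expR (- ln (1 + t)).
  by move=> t0; rewrite expRN lnK// posrE; lra.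
move: cf; case: eqVneq => [->|p32] cf.
  rewrite (@RFTC_segment _ (fun t => ln (1 + t)) _ _ _ cf A0).
    by rewrite addr0 ln1 subr0.
  move=> t /andP[t0 _]; apply: (der1_eq (dl t t0)).
  by rewrite expl//; congr expR; field.
have p0 : 3 - 2 * p != 0 by apply: contra p32 => /eqP h; apply/eqP; lra.
rewrite (@RFTC_segment _ (fun t => expR ((3 - 2 * p) * ln (1 + t)) / (3 - 2 * p)) _ _ _ cf A0).
  by rewrite addr0 ln1 mulr0 expR0 -mulrBl.
move=> t /andP[t0 _].
have D := der1M (der1_expR (der1M (der1_cst (3 - 2 * p) t) (dl t t0))) (der1_cst (3 - 2 * p)^-1 t).
apply: (der1_eq D).
have -> : expR ((2 - 2 * p) * ln (1 + t)) = expR ((3 - 2 * p) * ln (1 + t)) * (1 + t)^-1.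
  by rewrite expl// -expRD; congr expR; ring.
by field; rewrite p0 gt_eqF//; lra.
Qed.

(** At p = 3/2 and m = 1 the rate is ln 1 = 0 while the integral is positive; the Boolean summand
    supplies the missing constant, to be absorbed at the very end. For 3 - 2p < 0 the integral stays
    bounded, which is the exponent 0 of the rate. *)
Lemma power_integral_rate p : exists2 K, 0 <= K & forall m : nat, (0 < m)%N ->
  \int[mu]_t (\1_(wnd (pi * m%:R)) t * expR ((1 - p) * ln (1 + t ^+ 2))) <=
  K * (variance_rate p m + (p == 3 / 2)%:R).
Proof.
have [K K0 HK] := power_integral_le p.
have pi0 := @pi_gt0 R.
have P1 : 0 < 1 + pi :> R by lra.
have lP : 0 <= ln (1 + pi) :> R by rewrite ln_ge0// lerDl ltW.
have Am (m : nat) : (0 < m)%N -> 0 <= ln (1 + pi * m%:R : R) <= ln (1 + pi : R) + ln m%:R.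
  move=> m0; have m1 : 1 <= m%:R :> R by rewrite ler1n.
  rewrite ln_ge0 ?lerDl ?mulr_ge0 ?(ltW pi0)//= -lnM ?posrE//; last by lra.
  rewrite ler_ln ?posrE ?mulr_gt0//; last 2 first.
  - by rewrite ltr_wpDr// mulr_ge0// ltW.
  - by lra.
  by move: m1; clear; move: (pi : R) (m%:R) => q u; lra.
have [p32|p32] := eqVneq p (3 / 2).
  exists (K * (1 + ln (1 + pi))) => [|m m0]; first by rewrite mulr_ge0// addr_ge0.
  have A0 : 0 <= pi * m%:R :> R by rewrite mulr_ge0// ltW.
  rewrite (le_trans (HK _ A0))// -mulrA ler_wpM2l// power_integral_value// p32 eqxx.
  rewrite /variance_rate eqxx/= mulr0 add0r mulr1.
  have /andP[_ h] := Am m m0; apply: (le_trans h).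
  have lm : 0 <= ln m%:R :> R by rewrite ln_ge0// ler1n.
  by move: (ln m%:R) (ln (1 + pi)) lP lm; clear; move=> u v; nra.
have c0 : 3 - 2 * p != 0 by apply: contra p32 => /eqP h; apply/eqP; lra.
exists (K * (expR (`|3 - 2 * p| * ln (1 + pi)) / `|3 - 2 * p|)) => [|m m0].
  by rewrite mulr_ge0// divr_ge0// expR_ge0.
have A0 : 0 <= pi * m%:R :> R by rewrite mulr_ge0// ltW.
rewrite (le_trans (HK _ A0))// -mulrA ler_wpM2l// power_integral_value// (negbTE p32).
rewrite /variance_rate (negbTE p32)/= mulr0 mulr1 !addr0.
have /andP[h0 h] := Am m m0.
have mr0 : 0 < m%:R :> R by rewrite ltr0n.
have m1 : 1 <= m%:R :> R by rewrite ler1n.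
have [c1|c1] := leP 0 (3 - 2 * p).
  have c2 : 0 < 3 - 2 * p by rewrite lt_neqAle eq_sym c0.
  rewrite ger0_norm// mulrAC ler_wpM2r ?invr_ge0//.
  rewrite /powR (gt_eqF mr0) -expRD -mulrDr.
  rewrite (@le_trans _ _ (expR ((3 - 2 * p) * ln (1 + pi * m%:R))))//; first by lra.
  by rewrite ler_expR ler_wpM2l.
rewrite ltr0_norm// powRr0 mulr1.
set u := expR _; have u0 : 0 < u by exact: expR_gt0.
rewrite -[X in X / _]opprB mulNr -mulrN -invrN.
rewrite ler_wpM2r ?invr_ge0 ?oppr_ge0 ?(ltW c1)//.
rewrite (@le_trans _ _ 1)//; first by lra.
by rewrite -[leLHS]expR0 ler_expR mulr_ge0// oppr_ge0 ltW.
Qed.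

End power_integral.

(** * Laws, independence and mixing *)

Section laws.
Context (R : realType).

Section image_law.
Context d (T : measurableType d) (P : probability T R) d' (S : measurableType d').

(** Stated as an existence so that [X] remains a bare function and its bundling as a measurable map
    stays inside the proof. *)
Lemma distribution_exists (X : T -> S) : measurable_fun setT X ->
  exists Q : probability S R,
    (forall A, Q A = P (X @^-1` A)) /\
    (forall (f : S -> R) M, measurable_fun setT f -> (forall s, `|f s| <= M) ->
      \int[Q]_s f s = \int[P]_w f (X w)).
Proof.
move=> mX; pose X' : {mfun T >-> S} := mfun_Sub (mem_set mX : X \in mfun).
exists (distribution P X'); split => // f M mf fM.
rewrite /Rintegral integral_distribution//; first exact/measurable_EFinP.
by apply: (rint_bounded P (M := M)) => //; exact: measurableT_comp.
Qed.

End image_law.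

Lemma eq_law d1 (T1 : measurableType d1) (P1 : probability T1 R)
  d2 (T2 : measurableType d2) (P2 : probability T2 R)
  d (S : measurableType d) (X : T1 -> S) (Y : T2 -> S) (f : S -> R) M :
  measurable_fun setT X -> measurable_fun setT Y ->
  (forall A, measurable A -> P1 (X @^-1` A) = P2 (Y @^-1` A)) ->
  measurable_fun setT f -> (forall s, `|f s| <= M) ->
  \int[P1]_w f (X w) = \int[P2]_w f (Y w).
Proof.
move=> mX mY XY mf fM.
have [Q1 [Q1E I1]] := distribution_exists P1 mX.
have [Q2 [Q2E I2]] := distribution_exists P2 mY.
rewrite -(I1 f M mf fM) -(I2 f M mf fM) /Rintegral; congr fine; apply: eq_measure_integral => A mA _.
have := XY A mA; rewrite -Q1E -Q2E; exact.
Qed.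

(** Independence makes the joint law agree with the product of the marginal laws on rectangles,
    hence everywhere, and Fubini applies to that product. The inner integral runs over an
    independent copy of [W]; its measurability in [u] is recorded because later conditional means
    are built from it. *)
Lemma Fubini_indep d (T : measurableType d) (P : probability T R)
  d1 (S1 : measurableType d1) d2 (S2 : measurableType d2)
  (U : T -> S1) (W : T -> S2) (f : S1 -> S2 -> R) M :
  measurable_fun setT U -> measurable_fun setT W ->
  (forall A B, measurable A -> measurable B ->
    P (U @^-1` A `&` W @^-1` B) = (P (U @^-1` A) * P (W @^-1` B))%E) ->
  measurable_fun setT (fun z : S1 * S2 => f z.1 z.2) ->
  (forall u v, `|f u v| <= M) ->
  \int[P]_w f (U w) (W w) = \int[P]_w \int[P]_v f (U w) (W v) /\
  measurable_fun setT (fun u => \int[P]_v f u (W v)).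
Proof.
move=> mU mW UW mf fM.
have [Q1 [Q1E I1]] := distribution_exists P mU.
have [Q2 [Q2E I2]] := distribution_exists P mW.
have mUW : measurable_fun setT (fun w => (U w, W w)) by exact: measurable_fun_pair.
have [Q [QE I]] := distribution_exists P mUW.
have mfu u : measurable_fun setT (f u).
  exact: (measurable_fun_pair2 (f := fun z : S1 * S2 => f z.1 z.2)).
have [h1 _ _] := @Fubini_dominated _ _ S1 S2 R Q1 Q2 f (fun=> M) (fun=> 1) mf
  (rint_cst _ _) (rint_cst _ _) (fun u v => eq_ind_r (fun z => _ <= z) (fM u v) (mulr1 M)).
have E u : \int[Q2]_v f u v = \int[P]_v f u (W v).
  by rewrite (I2 _ M (mfu u) (fM u)).
have mE : measurable_fun setT (fun u => \int[P]_v f u (W v)).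
  rewrite (_ : (fun u => _) = fun u => \int[Q2]_v f u v); last first.
    by apply/funext => u; rewrite E.
  exact: rint_measurable h1.
split => //.
rewrite -(I (fun z => f z.1 z.2) M)//.
rewrite -(I1 (fun u => \int[P]_v f u (W v)) M)//; last first.
  move=> u; apply: norm_Rintegral_bounded => //.
  by apply: measurableT_comp => //.
have hf : (Q1 \x Q2)%E.-integrable setT (fun z : S1 * S2 => (f z.1 z.2)%:E).
  by apply: (rint_bounded (Q1 \x Q2)%E (M := M)) => // -[].
transitivity (\int[(Q1 \x Q2)%E]_z f z.1 z.2).
  rewrite /Rintegral; congr fine; apply: eq_measure_integral => A mA _.
  symmetry; apply: product_measure_unique => // B C mB mC.
  have := UW B C mB mC; rewrite -Q1E -Q2E => <-.
  exact: QE.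
under [RHS]eq_Rintegral do rewrite -E.
apply: EFin_inj; rewrite !EFin_RintegralT//.
rewrite -(integral12_prod_meas1 hf) /fubini_F; apply: eq_integral => u _.
rewrite EFin_RintegralT//; exact: (rint_bounded Q2 (mfu u) (fM u)).
Qed.

End laws.

(** * Layer-cake representation *)

Section layer_cake.
Context (R : realType) d (T : measurableType d) (m : {sigma_finite_measure set T -> \bar R}).
Notation mu := (@lebesgue_measure R).
Notation mR := (measurableTypeR R).

(** For each x, U(x) + M is the length of [-M, U(x)], that is the integral over [-M, M] of the
    indicator of s <= U(x); then the order of integration is exchanged. Integrals of bounded
    functions are thereby reduced to level sets. *)
Lemma layer_cake (U w : T -> R) M : 0 <= M -> measurable_fun setT U ->
  (forall x, `|U x| <= M) -> m.-rint w ->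
  mu.-rint (fun s => \1_`[- M, M] s * \int[m]_x (\1_[set x | s <= U x] x * w x)) /\
  \int[m]_x (U x * w x) =
  \int[mu]_s (\1_`[- M, M] s * \int[m]_x (\1_[set x | s <= U x] x * w x))
  - M * \int[m]_x w x.
Proof.
move=> M0 mU UM hw.
have mle : measurable [set z : T * mR | z.2 <= U z.1].
  have := @measurable_fun_ler _ _ R setT (fun z : T * mR => z.2 : R) (fun z => U z.1)
    measurable_snd (measurableT_comp mU measurable_fst).
  by move=> /(_ measurableT [set true]); rewrite setTI; apply.
pose f x (s : R) := \1_`[- M, M] s * (\1_[set x | s <= U x] x * w x).
have i01 (D : set T) x : `|\1_D x : R| <= 1.
  by rewrite indicE; case: (_ \in _); rewrite ?normr1 ?normr0.
have hI : mu.-rint (fun s : R => \1_`[- M, M] s) by exact: integrable_indic_itv.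
have [|||h1 h2 h3] := @Fubini_dominated _ _ T mR R m mu f (fun x => `|w x|)
  (fun s => \1_`[- M, M] s) _ _ hI.
- apply: measurable_funM.
    by apply: (measurableT_comp (f := \1_`[- M, M] : mR -> R)).
  apply: measurable_funM; last exact: measurableT_comp (rint_measurable hw) measurable_fst.
  rewrite (_ : (fun z : T * mR => _) = (\1_[set z : T * mR | z.2 <= U z.1] : T * mR -> R)).
    exact: measurable_indic.
  by apply/funext => z; rewrite !indicE; congr (nat_of_bool _)%:R.
- exact: rint_abs.
- move=> x s; have I0 : 0 <= \1_`[- M, M] s :> R by rewrite indicE.
  rewrite /f normrM (ger0_norm I0) mulrC ler_wpM2r// normrM.
  by rewrite ler_piMl.
have mI s : measurable [set x | s <= U x].
  have := @measurable_fun_ler _ _ R setT (fun _ : T => s) U (measurable_cst s) mU.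
  by move=> /(_ measurableT [set true]); rewrite setTI; apply.
have hIw s : m.-rint (fun x => \1_[set x | s <= U x] x * w x) by exact: rint_indic.
have E2 s : \int[m]_x f x s = \1_`[- M, M] s * \int[m]_x (\1_[set x | s <= U x] x * w x).
  by rewrite /f RintegralTZ.
have E1 x : \int[mu]_s f x s = (U x + M) * w x.
  have /andP[UM1 UM2] : - M <= U x <= M by rewrite -ler_norml.
  rewrite (_ : f x = fun s => w x * \1_`[- M, U x] s); last first.
    apply/funext => s; rewrite /f mulrA mulrC; congr (_ * _).
    rewrite !indicE -natrM mulnb; congr (nat_of_bool _)%:R.
    apply/idP/idP.
      by move=> /andP[/set_mem/= /[!in_itv]/= /andP[h _] /set_mem/= h']; apply/mem_set; rewrite /= in_itv/= h h'.
    move=> /set_mem/= /[!in_itv]/= /andP[h h']; apply/andP; split; apply/mem_set => //=.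
    by rewrite in_itv/= h (le_trans h').
  rewrite RintegralTZ; last exact: integrable_indic_itv.
  rewrite mulrC; congr (_ * _).
  rewrite (_ : \int[mu]_s _ = \int[mu]_(s in `[- M, U x]) 1); last first.
    rewrite (Rintegral_indic mu _ (fun=> 1 : R)).
    by under [RHS]eq_Rintegral do rewrite mulr1.
  rewrite Rintegral_cst//= lebesgue_measure_itv/= lte_fin mul1r.
  case: ltP => [_|h]; rewrite /= ?opprK// .
  by have -> : U x = - M by [apply/eqP; rewrite eq_le h UM1]; rewrite addNr.
split.
  by rewrite (_ : (fun s => _) = fun s => \int[m]_x f x s)//; apply/funext => s; rewrite E2.
under [X in X - _]eq_Rintegral do rewrite -E2.
rewrite -h3; under [X in X - _]eq_Rintegral do rewrite E1 mulrDl.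
have hUw : m.-rint (fun x => U x * w x) by exact: rintM hw.
by rewrite RintegralTD//; [rewrite RintegralTZ// addrK|exact: rintZ].
Qed.

End layer_cake.

Section density.
Context (R : realType) d (T : measurableType d) (P : probability T R).
Notation mu := (@lebesgue_measure R).

Lemma measurable_ge_set d' (S : measurableType d') (f : S -> R) s :
  measurable_fun setT f -> measurable [set x | s <= f x].
Proof.
move=> mf; have := @measurable_fun_ler _ _ R setT (fun=> s) f (measurable_cst s) mf.
by move=> /(_ measurableT [set true]); rewrite setTI; apply.
Qed.

Lemma has_density_rint (X : T -> R) f : has_density P X f ->
  mu.-rint f /\ \int[mu]_x f x = 1.
Proof.
move=> [mf f0 PX].
have E : (\int[mu]_x (f x)%:E = 1)%E.
  by rewrite -PX// preimage_setT probability_setT.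
split; last by rewrite /Rintegral E.
apply/integrableP; split; first exact/measurable_EFinP.
by under eq_integral do rewrite /= ger0_norm//; rewrite E ltry.
Qed.

Lemma density_Rintegral (X : T -> R) (f phi : R -> R) (M : R) : measurable_fun setT X ->
  has_density P X f -> measurable_fun setT phi -> (forall x, `|phi x| <= M) ->
  \int[P]_w phi (X w) = \int[mu]_x (phi x * f x).
Proof.
move=> mX hX mphi phiM.
have [hf If] := has_density_rint hX.
have M0 : 0 <= M by exact: le_trans (phiM 0).
have [_] := @layer_cake R _ T P (fun w => phi (X w)) (fun=> 1) M M0
  (measurableT_comp mphi mX) (fun w => phiM _) (rint_cst P 1).
under eq_Rintegral do rewrite mulr1.
move=> ->.
have [_ ->] := @layer_cake R _ (measurableTypeR R) mu phi f M M0 mphi phiM hf.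
rewrite If Rintegral_cstT; congr (_ - _).
apply: eq_Rintegral => s _; congr (_ * _).
have mS := measurable_ge_set s mphi.
have [_ _ /(_ _ mS) PX] := hX.
rewrite -!Rintegral_indic Rintegral_cst ?mul1r; last first.
  by apply: measurable_ge_set; exact: measurableT_comp.
by rewrite /Rintegral -PX.
Qed.

End density.

(** * Covariances under absolute regularity *)

Section beta_covariance.
Context (R : realType) d (T : measurableType d) (P : probability T R).
Notation mu := (@lebesgue_measure R).

(** A weight of mean zero cancels the boundary term of the layer-cake formula, and 2 M is the length
    of the range of levels. *)
Lemma layer_cake_bound (U w : T -> R) M c : 0 <= M -> measurable_fun setT U ->
  (forall x, `|U x| <= M) -> P.-rint w -> \int[P]_x w x = 0 ->
  (forall s, `|\int[P]_x (\1_[set x | s <= U x] x * w x)| <= c) ->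
  `|\int[P]_x (U x * w x)| <= 2 * M * c.
Proof.
move=> M0 mU UM hw w0 Hc.
have [h ->] := @layer_cake R _ T P U w M M0 mU UM hw.
rewrite w0 mulr0 subr0.
have -> : 2 * M * c = \int[mu]_s (c * \1_`[- M, M] s).
  rewrite RintegralTZ; last exact: integrable_indic_itv.
  rewrite (_ : \int[mu]_s _ = \int[mu]_(s in `[- M, M]) 1); last first.
    rewrite (Rintegral_indic mu _ (fun=> 1 : R)).
    by under [RHS]eq_Rintegral do rewrite mulr1.
  rewrite Rintegral_cst//= lebesgue_measure_itv/= lte_fin mul1r.
  case: ltP => [_|h']; rewrite /= ?opprK; first by ring.
  by have -> : M = 0 by [lra]; ring.
apply: le_norm_RintegralT => //; first by apply: rintZ; exact: integrable_indic_itv.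
move=> s; have [->|->] : \1_`[- M, M] s = 0 :> R \/ \1_`[- M, M] s = 1 :> R.
  by rewrite indicE; case: (_ \in _); [right|left].
  by rewrite mul0r normr0 mulr0.
by rewrite mul1r mulr1.
Qed.

(** The partitions into an event and its complement are admissible, and one of the four terms of the
    double sum is the one wanted; the factor 2 undoes the normalisation by 1/2. *)
Lemma beta_coef_event (F G : set (set T)) A B :
  F A -> F (~` A) -> G B -> G (~` B) ->
  (`|P (A `&` B) - P A * P B| <= 2%:E * beta_coef P F G)%E.
Proof.
move=> FA FcA GB GcB.
pose A' (i : 'I_2) := if i == ord0 then A else ~` A.
pose B' (i : 'I_2) := if i == ord0 then B else ~` B.
have part (H : set (set T)) (C : set T) : H C -> H (~` C) ->
    finite_partition H (fun i : 'I_2 => if i == ord0 then C else ~` C).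
  move=> HC HcC; split.
  - by move=> i; case: ifP.
  - apply/trivIsetP => -[[|[|//]] i1] [[|[|//]] j1] _ _ //= _.
      by rewrite setICr.
    by rewrite setICl.
  - rewrite -subTset => x _; have [Cx|nCx] := pselect (C x).
      by exists ord0.
    by exists (lift ord0 ord0).
have -> : (`|P (A `&` B) - P A * P B| = 2%:E * ((2^-1)%:E * `|P (A `&` B) - P A * P B|))%E.
  by rewrite muleA -EFinM mulfV// mul1e.
rewrite lee_pmul2l//.
apply: (@le_trans _ _ ((2^-1)%:E * \sum_(i < 2) \sum_(j < 2)
    `|P (A' i `&` B' j) - P (A' i) * P (B' j)|)%E); last first.
  by apply: ereal_sup_ubound; exists 2%N, 2%N, A', B'; split => //; exact: part.
rewrite lee_pmul2l//.
rewrite (bigD1 ord0)//= (bigD1 ord0)//= -[leLHS]adde0 -[X in (X <= _)%E]adde0.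
apply: leeD; last by apply: sume_ge0 => i _; apply: sume_ge0.
by apply: leeD => //; apply: sume_ge0.
Qed.

Lemma Rintegral_indic1 (A : set T) : measurable A -> \int[P]_x \1_A x = fine (P A).
Proof.
move=> mA; transitivity (\int[P]_(x in A) (1 : R)).
  rewrite (Rintegral_indic P _ (fun=> 1 : R)).
  by under [RHS]eq_Rintegral do rewrite mulr1.
by rewrite Rintegral_cst// mul1r.
Qed.

(** The layer-cake bound is used once per variable, which gives 2 M and 2 N; the covariance of two
    level sets is at most 2 b. *)
Lemma beta_covariance (F G : set (set T)) (U Y : T -> R) (M N b : R) :
  0 <= M -> 0 <= N ->
  measurable_fun setT U -> measurable_fun setT Y ->
  (forall x, `|U x| <= M) -> (forall x, `|Y x| <= N) ->
  (forall s, F [set x | s <= U x] /\ F (~` [set x | s <= U x])) ->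
  (forall s, G [set x | s <= Y x] /\ G (~` [set x | s <= Y x])) ->
  (beta_coef P F G <= b%:E)%E ->
  `|\int[P]_x (U x * Y x) - (\int[P]_x U x) * \int[P]_x Y x| <= 8 * M * N * b.
Proof.
move=> M0 N0 mU mY UM YN FU GY Hb.
have hU := rint_bounded P mU UM; have hY := rint_bounded P mY YN.
have hYc : P.-rint (fun x => Y x - \int[P]_x Y x) by apply: rintB => //; exact: rint_cst.
have -> : \int[P]_x (U x * Y x) - (\int[P]_x U x) * \int[P]_x Y x =
    \int[P]_x (U x * (Y x - \int[P]_x Y x)).
  under [RHS]eq_Rintegral do rewrite mulrBr.
  rewrite RintegralTB; last 2 first.
  - by apply: (rintM mU UM).
  - by apply: (rintM mU UM); exact: rint_cst.
  congr (_ - _); under [RHS]eq_Rintegral do rewrite mulrC.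
  by rewrite RintegralTZ// mulrC.
have -> : 8 * M * N * b = 2 * M * (2 * N * (2 * b)) by ring.
apply: layer_cake_bound => //.
  by rewrite RintegralTB ?Rintegral_cstT ?subrr//; exact: rint_cst.
move=> s; have mA := measurable_ge_set s mU.
set A := [set x | s <= U x] in mA *.
have i01 (D : set T) x : `|\1_D x : R| <= 1.
  by rewrite indicE; case: (_ \in _); rewrite ?normr1 ?normr0.
have hA : P.-rint (fun x => \1_A x : R).
  by apply: (rint_bounded P (M := 1)) => //; exact: measurable_indic.
(* The centring is moved from [Y] to the indicator, so that the second layer-cake bound, now in [Y],
   again has a weight of mean zero. *)
have -> : \int[P]_x (\1_A x * (Y x - \int[P]_x Y x)) =
    \int[P]_x (Y x * (\1_A x - \int[P]_x \1_A x)).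
  have h1 : P.-rint (fun x => \1_A x * Y x) by exact: rint_indic.
  transitivity (\int[P]_x (\1_A x * Y x) - (\int[P]_x Y x) * \int[P]_x \1_A x).
    rewrite -RintegralTZ// -RintegralTB//; last exact: rintZ.
    by apply: eq_Rintegral => x _; ring.
  rewrite mulrC -RintegralTZ// -RintegralTB//; last exact: rintZ.
  by apply: eq_Rintegral => x _; ring.
apply: layer_cake_bound => //.
  by apply: rintB => //; exact: rint_cst.
  by rewrite RintegralTB ?Rintegral_cstT ?subrr//; exact: rint_cst.
move=> r; have mB := measurable_ge_set r mY.
set B := [set x | r <= Y x] in mB *.
have hB : P.-rint (fun x => \1_B x : R).
  by apply: (rint_bounded P (M := 1)) => //; exact: measurable_indic.
have -> : \int[P]_x (\1_B x * (\1_A x - \int[P]_x \1_A x)) =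
    fine (P (A `&` B)) - fine (P A) * fine (P B).
  rewrite -!Rintegral_indic1//; last exact: measurableI.
  have hAB : P.-rint (fun x => \1_(A `&` B) x : R).
    apply: (rint_bounded P (M := 1)) => //; apply: measurable_indic.
    exact: measurableI.
  rewrite -RintegralTZ// -RintegralTB//; last exact: rintZ.
  apply: eq_Rintegral => x _; rewrite indicI /= mulrBr mulrC; congr (_ - _).
  by rewrite mulrC.
have [FA FcA] := FU s; have [GB GcB] := GY r.
have H := beta_coef_event FA FcA GB GcB.
have H2 : (2%:E * beta_coef P F G <= (2 * b)%:E)%E.
  by rewrite EFinM lee_pmul2l.
have := le_trans H H2.
rewrite -(@fineK _ (P (A `&` B))) ?fin_num_measure//; last exact: measurableI.
by rewrite -(@fineK _ (P A)) ?fin_num_measure// -(@fineK _ (P B)) ?fin_num_measure.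
Qed.

Lemma Rintegral_stationary (V : int -> T -> R) (f : R -> R -> R) M :
  (forall i, measurable_fun setT (V i)) -> stationary P V ->
  measurable_fun setT (fun z : R * R => f z.1 z.2) ->
  (forall x y, `|f x y| <= M) -> forall i k : int,
  \int[P]_w f (V i w) (V (k + i) w) = \int[P]_w f (V 0 w) (V k w).
Proof.
move=> mV sV mf fM i k.
have mp a b : measurable_fun setT (fun w => (V a w, V b w)) by exact: measurable_fun_pair.
apply: (@eq_law R _ T P _ T P _ (R * R)%type (fun w => (V i w, V (k + i) w))
  (fun w => (V 0 w, V k w)) (fun z => f z.1 z.2) M) => // A mA.
pose t (j : 'I_2) : int := if j == ord0 then 0 else k.
pose B : set (2.-tuple R) := (fun u => (tnth u ord0, tnth u (lift ord0 ord0))) @^-1` A.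
have mB : measurable B.
  rewrite -[B]setTI; apply: measurable_fun_pair => //; exact: measurable_tnth.
have := sV 2%N t i B mB.
rewrite /B /= => H.
rewrite (_ : _ @^-1` _ = [set w | A (tnth [tuple V (t j + i) w | j < 2] ord0, tnth [tuple V (t j + i) w | j < 2] (lift ord0 ord0))]).
  rewrite H; congr (P _); by apply/seteqP; split => w /=; rewrite !tnth_mktuple.
by apply/seteqP; split => w /=; rewrite !tnth_mktuple /t/= add0r.
Qed.

End beta_covariance.

(** * The noise and the deconvolution kernel *)

Section fourier_parts.
Context (R : realType).
Notation mu := (@lebesgue_measure R).

Lemma Re_fourier (u : R -> R) t :
  complex.Re (fourier u t) = \int[mu]_x (cos (t * x) * u x).
Proof. by apply: eq_Rintegral => x _ /=; rewrite mulr0 subr0. Qed.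

Lemma Im_fourier (u : R -> R) t :
  complex.Im (fourier u t) = \int[mu]_x (sin (t * x) * u x).
Proof. by apply: eq_Rintegral => x _ /=; rewrite mulr0 add0r. Qed.

Lemma psiE (l x : R) : psi l x = lgw 1 l x.
Proof. by rewrite /psi /lgw mul1r. Qed.

Lemma fourier_psi (l t : R) : fourier (psi l) t = lgC 1 l t +i* lgS 1 l t.
Proof.
apply/eqP; rewrite eq_complex Re_fourier Im_fourier lgCE lgSE /=.
by apply/andP; split; apply/eqP; apply: eq_Rintegral => x _; rewrite psiE.
Qed.

End fourier_parts.

(** * The law of the logarithm of a Gamma variable *)

Section log_gamma_law.
Context (R : realType) d (T : measurableType d) (P : probability T R).
Notation mu := (@lebesgue_measure R).

Lemma Rintegral_substitution_expR (G : R -> R) (a b : R) : a < b ->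
  (forall x, 0 < x -> {for x, continuous G}) ->
  \int[mu]_(x in `[expR a, expR b]) G x = \int[mu]_(u in `[a, b]) (G (expR u) * expR u).
Proof.
move=> ab cG.
have dE : (@expR R)^`()%classic = expR.
  by apply/funext => x; rewrite derive1E; exact: derive_val.
have cE x : {for x, continuous (@expR R)} by exact: continuous_expR.
rewrite /Rintegral (integration_by_substitution_increasing (ltW ab)).
- by rewrite dE.
- by move=> x y _ _; rewrite ltr_expR.
- by rewrite dE => x _; exact: cE.
- by rewrite dE; apply/cvg_ex; exists (expR a); exact/cvg_at_right_filter/cE.
- by rewrite dE; apply/cvg_ex; exists (expR b); exact/cvg_at_left_filter/cE.
- split; first by move=> x _; exact: derivable_expR.
    exact/cvg_at_right_filter/cE.
  exact/cvg_at_left_filter/cE.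
- apply: continuous_in_subspaceT => x /set_mem/= /[!in_itv]/= /andP[x0 _].
  by apply: cG; exact: lt_le_trans (expR_gt0 _) x0.
Qed.

(** The substitution x = e^u is made on the segments [e^(-n), e^n], where the integrand is
    continuous, and these exhaust the positive axis. *)
Lemma log_gamma_Rintegral (Y : T -> R) (p M : R) (phi : R -> R) : 0 < p ->
  measurable_fun setT Y ->
  has_density P Y (gamma_density p) -> continuous phi -> (forall x, `|phi x| <= M) ->
  \int[P]_w phi (ln (Y w)) = (\int[mu]_u (phi u * lgw p 1 u)) / Gamma p.
Proof.
move=> p0 mY hY cphi phiM.
have mphi : measurable_fun setT phi by exact: continuous_measurable_fun.
have mphil : measurable_fun setT (fun x => phi (ln x)).
  by apply: (measurableT_comp mphi); exact: measurable_ln.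
rewrite (density_Rintegral (phi := fun x => phi (ln x)) (M := M) mY hY)//.
have [hg _] := has_density_rint hY.
have hf : mu.-rint (fun x => phi (ln x) * gamma_density p x).
  by apply: (rintM (m := mu) mphil (fun x => phiM _)) => //.
have hw : mu.-rint (fun u => phi u * lgw p 1 u).
  exact: rint_lgwM mphi phiM.
have L1 : \int[mu]_(x in `[expR (- n%:R), expR n%:R]) (phi (ln x) * gamma_density p x)
    @[n --> \oo] --> \int[mu]_(x in `]0, +oo[) (phi (ln x) * gamma_density p x).
  apply: cvg_Rintegral_sets => // x; have [x0|x0] := ltP 0 x.
    apply: filterS (near_ge_norm (ln x)) => n; rewrite ler_norml => /andP[n1 n2].
    rewrite !indicE !mem_set//= in_itv/= ?x0//.
    by rewrite -[x in _ <= x <= _]lnK ?posrE// !ler_expR n1.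
  apply: nearW => n; rewrite !indicE !memNset//= in_itv/=.
    by rewrite andbT ltNge x0.
  by apply/negP; rewrite negb_and -ltNge (le_lt_trans x0)// expR_gt0.
have E1 : \int[mu]_(x in `]0, +oo[) (phi (ln x) * gamma_density p x) =
    \int[mu]_x (phi (ln x) * gamma_density p x).
  rewrite Rintegral_indic; apply: eq_Rintegral => x _.
  have [x0|x0] := ltP 0 x; first by rewrite indicE mem_set ?mul1r//= in_itv/= x0.
  by rewrite /gamma_density ltNge x0/= !mulr0.
have L2 := cvg_Rintegral_sym hw.
have E2 (n : nat) : \int[mu]_(x in `[expR (- n%:R), expR n%:R]) (phi (ln x) * gamma_density p x) =
    (\int[mu]_(u in `[- n%:R, n%:R]) (phi u * lgw p 1 u)) / Gamma p.
  case: n => [|n].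
    rewrite oppr0 expR0 !set_itv1 !Rintegral_set1 mul0r//.
  pose G (x : R) := phi (ln x) * (expR (- x) * expR ((p - 1) * ln x) / Gamma p).
  transitivity (\int[mu]_(x in `[expR (- n.+1%:R), expR n.+1%:R]) G x).
    apply: eq_Rintegral => x; rewrite inE/= in_itv/= => /andP[x1 _].
    have x0 : 0 < x by exact: lt_le_trans (expR_gt0 _) x1.
    by rewrite /G /gamma_density x0 /powR gt_eqF.
  rewrite Rintegral_substitution_expR//.
  - rewrite mulrC -RintegralZl//; last by apply: integrableS hw.
    apply: eq_Rintegral => u _; rewrite /G expRK /lgw mul1r.
    have -> : p * u - expR u = - expR u + (p - 1) * u + u by ring.
    by rewrite !expRD; ring.
  - by rewrite (@lt_trans _ _ 0)// oppr_lt0.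
  - move=> x x0; apply: cvgM.
      by apply: (continuous_comp (g := phi)); [exact: continuous_ln|exact: cphi].
    apply: cvgMr_tmp; apply: cvgM.
      by apply: (@der1_continuous _ (fun x => expR (- x))); apply: der1_expR; apply: der1N; exact: der1_id.
    apply: (@der1_continuous _ (fun x => expR ((p - 1) * ln x))); apply: der1_expR.
    by apply: der1M; [exact: der1_cst|apply: der1_ln => //; exact: der1_id].
have L1' : (\int[mu]_(u in `[- n%:R, n%:R]) (phi u * lgw p 1 u)) / Gamma p
    @[n --> \oo] --> \int[mu]_x (phi (ln x) * gamma_density p x).
  rewrite -E1 (_ : (fun n : nat => _) = fun n : nat =>
    \int[mu]_(x in `[expR (- n%:R), expR n%:R]) (phi (ln x) * gamma_density p x)) //.
  by apply/funext => n; rewrite E2.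
have L2' : (\int[mu]_(u in `[- n%:R, n%:R]) (phi u * lgw p 1 u)) / Gamma p
    @[n --> \oo] --> (\int[mu]_x (phi x * lgw p 1 x)) / Gamma p.
  by apply: cvgMr_tmp; exact: L2.
by rewrite -(cvg_lim _ L1')// (cvg_lim _ L2').
Qed.

(** The constant test function 1 turns the total mass 1 of the density into this identity. *)
Lemma Gamma_lgG (Y : T -> R) (p : R) : 0 < p -> measurable_fun setT Y ->
  has_density P Y (gamma_density p) -> Gamma p = lgG p 1.
Proof.
move=> p0 mY hY.
have n1 (x : R) : `|(1 : R)| <= 1 by rewrite normr1.
have c1 : continuous (fun _ : R => 1 : R) by exact: cst_continuous.
have := @log_gamma_Rintegral Y p 1 (fun=> 1) p0 mY hY c1 n1.
rewrite Rintegral_cstT (_ : \int[mu]_u (1 * lgw p 1 u) = lgG p 1); last first.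
  by rewrite lgGE; apply: eq_Rintegral => u _; rewrite mul1r.
by move=> /esym/divr1_eq ->.
Qed.

Lemma log_gamma_char (Y : T -> R) (p t : R) : 0 < p -> measurable_fun setT Y ->
  has_density P Y (gamma_density p) ->
  \int[P]_w cos (t * ln (Y w)) = lgC p 1 t / lgG p 1 /\
  \int[P]_w sin (t * ln (Y w)) = lgS p 1 t / lgG p 1.
Proof.
move=> p0 mY hY; rewrite -(Gamma_lgG p0 mY hY) lgCE lgSE.
split.
  apply: (@log_gamma_Rintegral Y p 1 (fun x => cos (t * x))) => //; first by der_cont.
  by move=> x; exact: cos_max.
apply: (@log_gamma_Rintegral Y p 1 (fun x => sin (t * x))) => //; first by der_cont.
by move=> x; exact: sin_max.
Qed.

(** The density is an arbitrary version, which may differ from the explicit formula on a null set;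
    its Fourier transform is therefore read off the law. *)
Lemma fourier_density (X : T -> R) (f : R -> R) t : measurable_fun setT X ->
  has_density P X f ->
  fourier f t = (\int[P]_w cos (t * X w)) +i* (\int[P]_w sin (t * X w)).
Proof.
move=> mX hX; apply/eqP; rewrite eq_complex Re_fourier Im_fourier /=.
apply/andP; split; apply/eqP; apply/esym.
  apply: (@density_Rintegral _ _ _ _ X f (fun x => cos (t * x)) 1) => //.
    by apply: continuous_measurable_fun; der_cont.
  by move=> x; exact: cos_max.
apply: (@density_Rintegral _ _ _ _ X f (fun x => sin (t * x)) 1) => //.
  by apply: continuous_measurable_fun; der_cont.
by move=> x; exact: sin_max.
Qed.

End log_gamma_law.

(** The left-hand side is the shape taken by the mean of a product of two trigonometric kernels
    after the product-to-sum formulas, with e1, ..., e4 parts of the characteristic function at the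
    difference and at the sum of the frequencies. *)
Lemma norm_product_to_sum (R : realFieldType) (a b a' b' e1 e2 e3 e4 k1 k2 : R) :
  `|e1| <= k1 -> `|e2| <= k2 -> `|e3| <= k1 -> `|e4| <= k2 ->
  `|2^-1 * ((a * a' + b * b') * e1 + (a * a' - b * b') * e2 +
      ((b * a' - a * b') * e3 - (a * b' + b * a') * e4))| <=
  2^-1 * ((`|a| + `|b|) * (`|a'| + `|b'|) * (k1 + k2)).
Proof.
move=> h1 h2 h3 h4; rewrite normrM ger0_norm ?invr_ge0// ler_wpM2l ?invr_ge0//.
have n (x y e k : R) : `|e| <= k -> `|x + y| * `|e| <= (`|x| + `|y|) * k.
  by move=> h; rewrite ler_pM// ler_normD.
apply: (le_trans (ler_normD _ _)).
apply: (le_trans (lerD (ler_normD _ _) (ler_normB _ _))); rewrite !normrM.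
apply: (le_trans (lerD (lerD (n _ _ _ _ h1) (n _ _ _ _ h2)) (lerD (n _ _ _ _ h3) (n _ _ _ _ h4)))).
rewrite !normrN !normrM le_eqVlt; apply/orP; left; apply/eqP; ring.
Qed.

(** [e] and [f] are values of indicators: each square keeps the indicator of the other variable, so
    the majorant stays supported where the product is. *)
Lemma mul_le_sqr_support (R : realFieldType) (x y e f : R) :
  0 <= e * f -> e ^+ 2 = e -> f ^+ 2 = f ->
  x * e * (y * f) <= 2^-1 * ((x * e) ^+ 2 * f + (y * f) ^+ 2 * e).
Proof.
move=> ef ee ff; rewrite !exprMn ee ff -subr_ge0; move: ef; clear => ef.
have -> : 2^-1 * (x ^+ 2 * e * f + y ^+ 2 * f * e) - x * e * (y * f) =
  (x - y) ^+ 2 * (e * f) / 2 by field.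
by apply: divr_ge0 => //; apply: mulr_ge0 => //; exact: sqr_ge0.
Qed.

(** * Schur's test *)

Section schur_test.
Context (R : realType).
Notation mu := (@lebesgue_measure R).
Notation mR := (measurableTypeR R).

Let g (u : R) : R := (1 + u ^+ 2)^-1.

Let g0 u : 0 <= g u.
Proof. by rewrite invr_ge0 addr_ge0// sqr_ge0. Qed.

Let g1 u : g u <= 1.
Proof. by rewrite invf_le1 ?ltr_wpDr ?sqr_ge0// lerDl sqr_ge0. Qed.

Let mg : measurable_fun setT g.
Proof. exact: measurable_oneDsqrV. Qed.

Let rint_g (x : R) : mu.-rint (fun s => g (s - x)).
Proof.
have [h _] := @Rintegral_poisson R 1 x ltr01.
by apply: eq_integrable h => // s _; rewrite /= mul1r expr1n.
Qed.

Let Rintegral_g (x : R) : \int[mu]_s g (s - x) = pi.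
Proof.
have [_ <-] := @Rintegral_poisson R 1 x ltr01.
by apply: eq_Rintegral => s _; rewrite mul1r expr1n.
Qed.

Variables (D : set R) (r : R -> R) (M : R).
Hypotheses (mD : measurable (D : set mR)) (hD : mu.-rint (\1_D : R -> R)).
Hypotheses (r0 : forall t, 0 <= r t) (hr : mu.-rint r)
  (rM : forall t, r t <= M * \1_D t).

Let i0 t : 0 <= \1_D t :> R. Proof. by rewrite indicE. Qed.

Let i1 t : \1_D t <= 1 :> R. Proof. by rewrite indicE lern1 leq_b1. Qed.

Lemma rint_sqr_support : mu.-rint (fun t => r t ^+ 2).
Proof.
apply: (rintM (m := mu) (M := `|M|) (rint_measurable hr) _ hr) => t.
rewrite ger0_norm// (le_trans (rM t))// (le_trans (ler_norm _))//.
by rewrite normrM ler_piMr// ger0_norm.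
Qed.

Let rD t : r t = r t * \1_D t.
Proof.
move: (rM t); rewrite indicE; case: (t \in D); first by rewrite !mulr1.
by rewrite !mulr0 => h; apply/le_anti; rewrite h r0.
Qed.

(** One half of the majorant after the arithmetic-geometric inequality, the other being its
    transpose. Each of the two bumps has integral pi in s, whatever their centre; the second is
    written with [- t] as centre for that reason. *)
Let Phi t s : R := (r t ^+ 2 * \1_D s) * (g (s - t) + g (s - (- t))).

Let measurable_r1 : measurable_fun setT (fun z : mR * mR => r z.1).
Proof. exact: (measurableT_comp (rint_measurable hr)). Qed.

Let measurable_gg :
  measurable_fun setT (fun z : mR * mR => g (z.2 - z.1) + g (z.2 - (- z.1))).
Proof.
have m1 : measurable_fun setT (fun z : mR * mR => z.1 : R) by exact: measurable_fst.
have m2 : measurable_fun setT (fun z : mR * mR => z.2 : R) by exact: measurable_snd.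
apply: measurable_funD; apply: (measurableT_comp mg); apply: measurable_funB => //.
exact: measurableT_comp.
Qed.

Let gg2 t s : 0 <= g (s - t) + g (s - (- t)) <= 2.
Proof. by rewrite addr_ge0//= -[2]/(1 + 1) lerD. Qed.

Let mPhi : measurable_fun setT (fun z : mR * mR => Phi z.1 z.2).
Proof.
apply: measurable_funM; last exact: measurable_gg.
apply: measurable_funM; first by apply: measurable_funX; exact: measurable_r1.
apply: (measurableT_comp (f := \1_D : mR -> R)) => //; exact: measurable_indic.
Qed.

Let Phi0 t s : 0 <= Phi t s.
Proof. by have /andP[h _] := gg2 t s; rewrite !mulr_ge0// exprn_ge0. Qed.

Let Phi_le t s : `|Phi t s| <= (2 * r t ^+ 2) * \1_D s.
Proof.
have /andP[h1 h2] := gg2 t s.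
by rewrite ger0_norm// /Phi mulrC -mulrA ler_wpM2r// mulr_ge0// exprn_ge0.
Qed.

Let rint_Phi t : mu.-rint (Phi t).
Proof.
apply: (rint_dom (m := mu) _ (Phi_le t)); last exact: rintZ.
exact: (measurable_fun_pair2 (f := fun z : mR * mR => Phi z.1 z.2)).
Qed.

Let rint_Phi2 s : mu.-rint (Phi ^~ s).
Proof.
apply: (rint_dom (m := mu) (g := fun t => \1_D s * (2 * r t ^+ 2))).
- exact: (measurable_fun_pair1 (f := fun z : mR * mR => Phi z.1 z.2)).
- by move=> t; rewrite mulrC.
- by apply: rintZ; apply: rintZ; exact: rint_sqr_support.
Qed.

Let Fubini_Phi : [/\ mu.-rint (fun t => \int[mu]_s Phi t s),
  mu.-rint (fun s => \int[mu]_t Phi t s)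
  & \int[mu]_t \int[mu]_s Phi t s = \int[mu]_s \int[mu]_t Phi t s].
Proof.
apply: (@Fubini_dominated _ _ mR mR R mu mu Phi (fun t => 2 * r t ^+ 2) \1_D).
- exact: mPhi.
- by apply: rintZ; exact: rint_sqr_support.
- exact: hD.
- exact: Phi_le.
Qed.

Let Rintegral_Phi : \int[mu]_t \int[mu]_s Phi t s <= 2 * pi * \int[mu]_t (r t ^+ 2).
Proof.
have [h1 _ _] := Fubini_Phi.
rewrite -RintegralTZ; last exact: rint_sqr_support.
apply: le_RintegralT; [exact: h1|by apply: rintZ; exact: rint_sqr_support|].
move=> t; have -> : 2 * pi * r t ^+ 2 = \int[mu]_s (r t ^+ 2 * (g (s - t) + g (s - - t))).
  rewrite RintegralTZ; last by apply: rintD; exact: rint_g.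
  rewrite RintegralTD ?Rintegral_g; try exact: rint_g.
  by rewrite -mulr2n -[pi *+ 2]mulr_natl mulrC.
apply: le_RintegralT; first exact: rint_Phi.
  by apply: rintZ; apply: rintD; exact: rint_g.
move=> s; have /andP[h _] := gg2 t s.
by rewrite ler_wpM2r// ler_piMr// exprn_ge0.
Qed.

(** The product r(t) r(s) is at most half the sum of the squares, and the bumps have total integral
    2 pi in either variable, so both halves contribute equally. *)
Lemma schur_test (F : R -> R -> R) (K : R) : 0 <= K ->
  mu.-rint (fun t => \int[mu]_s F t s) -> (forall t, mu.-rint (F t)) ->
  (forall t s, `|F t s| <= K * (r t * r s) * (g (s - t) + g (s + t))) ->
  \int[mu]_t \int[mu]_s F t s <= 2 * pi * K * \int[mu]_t (r t ^+ 2).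
Proof.
move=> K0 hF hFt HF; have [h1 h2 _] := Fubini_Phi.
apply: (@le_trans _ _ (\int[mu]_t (K / 2 * (\int[mu]_s Phi t s + \int[mu]_s Phi s t)))).
  apply: le_RintegralT => //; first by apply: rintZ; exact: rintD.
  move=> t; rewrite -RintegralTD; [|exact: rint_Phi|exact: rint_Phi2].
  have hS : mu.-rint (fun s => Phi t s + Phi s t).
    by apply: rintD; [exact: rint_Phi|exact: rint_Phi2].
  rewrite -RintegralTZ//; apply: le_RintegralT => //; first exact: rintZ.
  move=> s; apply: (le_trans (ler_norm _)); apply: (le_trans (HF t s)).
  have -> : Phi t s + Phi s t =
      (r t ^+ 2 * \1_D s + r s ^+ 2 * \1_D t) * (g (s - t) + g (s + t)).
    rewrite /Phi !opprK [t + s]addrC.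
    have -> : g (t - s) = g (s - t) by rewrite /g -opprB sqrrN.
    by rewrite mulrDl.
  have /andP[gg _] := gg2 t s; rewrite opprK in gg.
  rewrite [leRHS]mulrA ler_wpM2r// -[K / 2 * _]mulrA ler_wpM2l//.
  have ee u : \1_D u ^+ 2 = \1_D u :> R.
    by rewrite indicE; case: (_ \in _); rewrite ?expr0n ?expr1n.
  by rewrite (rD t) (rD s); apply: mul_le_sqr_support => //; exact: mulr_ge0.
rewrite RintegralTZ; last exact: rintD.
rewrite RintegralTD//; have [_ _ <-] := Fubini_Phi.
move: Rintegral_Phi; set I := \int[mu]_t \int[mu]_s Phi t s.
move=> h; have -> : 2 * pi * K * \int[mu]_t (r t ^+ 2) =
    K / 2 * (2 * pi * \int[mu]_t (r t ^+ 2) + 2 * pi * \int[mu]_t (r t ^+ 2)).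
  by move: (pi : R) (\int[mu]_t (r t ^+ 2)) => q J; field.
by rewrite ler_wpM2l ?lerD// divr_ge0.
Qed.

End schur_test.

(** * Trigonometric integrals of a random argument *)

Section trigonometric_transform.
Context (R : realType).
Notation mu := (@lebesgue_measure R).
Notation mR := (measurableTypeR R).

(* The real part of [e^(i t z) * (a t + i b t)]. *)
Definition trigk (a b : R -> R) (t z : R) : R := cos (t * z) * a t - sin (t * z) * b t.

Definition trigT (a b : R -> R) (z : R) : R := \int[mu]_t trigk a b t z.

Definition rho (a b : R -> R) (t : R) : R := `|a t| + `|b t|.

Lemma rho_ge0 a b t : 0 <= rho a b t.
Proof. by rewrite addr_ge0. Qed.

Lemma trigk_le a b t z : `|trigk a b t z| <= rho a b t.
Proof.
rewrite (le_trans (ler_normB _ _))// !normrM lerD// ler_piMl//.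
- exact: cos_max.
- exact: sin_max.
Qed.

Variables a b : R -> R.
Hypotheses (ha : mu.-rint a) (hb : mu.-rint b).

Lemma rint_rho : mu.-rint (rho a b).
Proof. by apply: rintD; exact: rint_abs. Qed.

Lemma measurable_trigk : measurable_fun setT (fun z : mR * mR => trigk a b z.1 z.2).
Proof.
have m1 (f : R -> R) : measurable_fun setT f ->
    measurable_fun setT (fun z : mR * mR => f z.1).
  by move=> mf; apply: measurableT_comp.
have mm : measurable_fun setT (fun z : mR * mR => z.1 * z.2 : R).
  by apply: measurable_funM; [exact: measurable_fst|exact: measurable_snd].
apply: measurable_funB; apply: measurable_funM.
- exact: measurable_cos_comp.
- exact: m1 (rint_measurable ha).
- exact: measurable_sin_comp.
- exact: m1 (rint_measurable hb).
Qed.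

Lemma measurable_trigk_comp d (T : measurableType d) (f g : T -> R) :
  measurable_fun setT f -> measurable_fun setT g ->
  measurable_fun setT (fun w => trigk a b (f w) (g w)).
Proof.
move=> mf mg; apply: (measurableT_comp (f := fun z : mR * mR => trigk a b z.1 z.2)
  (g := fun w => (f w, g w))); first exact: measurable_trigk.
exact: measurable_fun_pair.
Qed.

Lemma rint_trigk z : mu.-rint (trigk a b ^~ z).
Proof.
apply: (rint_dom (m := mu) (g := rho a b)); last exact: rint_rho; last by move=> t; exact: trigk_le.
exact: (measurable_trigk_comp (f := fun t : R => t : R) (g := fun=> z)).
Qed.

Lemma trigT_le z : `|trigT a b z| <= \int[mu]_t rho a b t.
Proof.
apply: le_norm_RintegralT; [exact: rint_trigk|exact: rint_rho|].
by move=> t; exact: trigk_le.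
Qed.

Lemma measurable_trigT : measurable_fun setT (trigT a b).
Proof.
apply: (@measurable_fun_param _ (fun z t => trigk a b t z) (rho a b)).
- apply: (measurable_trigk_comp (f := fun z : mR * mR => z.2 : R) (g := fun z : mR * mR => z.1 : R)).
    exact: measurable_snd.
  exact: measurable_fst.
- exact: rint_rho.
- by move=> z t; exact: trigk_le.
Qed.

Section random_argument.
Context d (T : measurableType d) (P : probability T R) (Z : T -> R).
Hypothesis mZ : measurable_fun setT Z.

Lemma rint_cos_rv t : P.-rint (fun w => cos (t * Z w)).
Proof.
apply: (rint_bounded P (M := 1)); last by move=> w; exact: cos_max.
by apply: measurable_cos_comp; exact: measurable_funM.
Qed.

Lemma rint_sin_rv t : P.-rint (fun w => sin (t * Z w)).
Proof.
apply: (rint_bounded P (M := 1)); last by move=> w; exact: sin_max.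
by apply: measurable_sin_comp; exact: measurable_funM.
Qed.

Lemma trigT_mean : \int[P]_w trigT a b (Z w) =
  \int[mu]_t ((\int[P]_w cos (t * Z w)) * a t - (\int[P]_w sin (t * Z w)) * b t).
Proof.
have [||||_ _ <-] := @Fubini_dominated _ _ mR T R mu P (fun t w => trigk a b t (Z w))
    (rho a b) (fun=> 1).
- apply: (measurable_trigk_comp (f := fun z : mR * T => z.1 : R) (g := fun z : mR * T => Z z.2)).
    exact: measurable_fst.
  exact: (measurableT_comp mZ).
- exact: rint_rho.
- exact: rint_cst.
- by move=> t w; rewrite mulr1; exact: trigk_le.
apply: eq_Rintegral => t _; rewrite /trigk.
have hc := rint_cos_rv t; have hs := rint_sin_rv t.
rewrite RintegralTB; last 2 first.
- by under eq_fun do rewrite mulrC; exact: rintZ.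
- by under eq_fun do rewrite mulrC; exact: rintZ.
by congr (_ - _); rewrite mulrC -RintegralTZ//; apply: eq_Rintegral => w _; rewrite mulrC.
Qed.

Variables (D : set R) (M : R).
Hypotheses (mD : measurable (D : set mR)) (hD : mu.-rint (\1_D : R -> R)).
Hypotheses (aM : forall t, `|a t| <= M * \1_D t) (bM : forall t, `|b t| <= M * \1_D t).

(** The square is opened into a double integral over frequencies by two exchanges, one per factor.
    The product-to-sum formulas then leave the characteristic function of [Z] at s - t and s + t,
    which produces the two bumps of Schur's test. *)
Lemma trigT_second_moment (K : R) : 0 <= K ->
  (forall u, `|\int[P]_w cos (u * Z w)| <= K * (1 + u ^+ 2)^-1) ->
  (forall u, `|\int[P]_w sin (u * Z w)| <= K * (1 + u ^+ 2)^-1) ->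
  \int[P]_w (trigT a b (Z w) ^+ 2) <= pi * K * \int[mu]_t (rho a b t ^+ 2).
Proof.
move=> K0 Kc Ks; pose r := rho a b; pose N := \int[mu]_t r t.
have r0 t : 0 <= r t by exact: rho_ge0.
have hr : mu.-rint r by exact: rint_rho.
have N0 : 0 <= N by exact: RintegralT_ge0.
pose k := trigk a b; pose H := trigT a b.
have mH : measurable_fun setT H by exact: measurable_trigT.
have mHZ : measurable_fun setT (fun w => H (Z w)) by exact: measurableT_comp.
have mk d' (S : measurableType d') (f g : S -> R) : measurable_fun setT f -> measurable_fun setT g ->
  measurable_fun setT (fun w => k (f w) (g w)) by exact: measurable_trigk_comp.
have kr t z : `|k t z| <= r t by exact: trigk_le.
have [step1 hKH] : \int[P]_w (H (Z w) ^+ 2) = \int[mu]_t \int[P]_w (k t (Z w) * H (Z w)) /\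
    mu.-rint (fun t => \int[P]_w (k t (Z w) * H (Z w))).
  have [||||h _ ->] := @Fubini_dominated _ _ mR T R mu P (fun t w => k t (Z w) * H (Z w))
    (fun t => N * r t) (fun=> 1).
  - apply: measurable_funM; last exact: (measurableT_comp mHZ).
    by apply: mk => //; exact: (measurableT_comp mZ).
  - exact: rintZ.
  - exact: rint_cst.
  - by move=> t w; rewrite mulr1 normrM mulrC ler_pM//; exact: trigT_le.
  split=> [|//]; apply: eq_Rintegral => w _.
  rewrite expr2 {1}/H /trigT mulrC -RintegralTZ//; last exact: rint_trigk.
  by apply: eq_Rintegral => t _; rewrite mulrC.
have step2 t : \int[P]_w (k t (Z w) * H (Z w)) = \int[mu]_s \int[P]_w (k t (Z w) * k s (Z w)) /\
    mu.-rint (fun s => \int[P]_w (k t (Z w) * k s (Z w))).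
  have [||||h _ ->] := @Fubini_dominated _ _ mR T R mu P (fun s w => k t (Z w) * k s (Z w))
    (fun s => r t * r s) (fun=> 1).
  - apply: measurable_funM; apply: mk => //; exact: (measurableT_comp mZ).
  - exact: rintZ.
  - exact: rint_cst.
  - by move=> s w; rewrite mulr1 normrM ler_pM.
  split=> [|//]; apply: eq_Rintegral => w _; rewrite -RintegralTZ//; exact: rint_trigk.
have {}step2E t := (step2 t).1; have {step2} hF t := (step2 t).2.
rewrite step1; under eq_Rintegral do rewrite step2E.
pose F t s := \int[P]_w (k t (Z w) * k s (Z w)).
have Fle t s : `|F t s| <= K / 2 * (r t * r s) * ((1 + (s - t) ^+ 2)^-1 + (1 + (s + t) ^+ 2)^-1).
  pose Ec u := \int[P]_w cos (u * Z w); pose Es u := \int[P]_w sin (u * Z w).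
  have FE : F t s = 2^-1 * ((a t * a s + b t * b s) * Ec (s - t) + (a t * a s - b t * b s) * Ec (s + t)
      + ((b t * a s - a t * b s) * Es (s - t) - (a t * b s + b t * a s) * Es (s + t))).
    rewrite -!RintegralTZ; try exact: rint_cos_rv; try exact: rint_sin_rv.
    have hc x u : P.-rint (fun w => x * cos (u * Z w)) by apply: rintZ; exact: rint_cos_rv.
    have hs x u : P.-rint (fun w => x * sin (u * Z w)) by apply: rintZ; exact: rint_sin_rv.
    rewrite -RintegralTD; [|exact: hc..].
    rewrite -RintegralTB; [|exact: hs..].
    rewrite -RintegralTD; [|by apply: rintD; exact: hc|by apply: rintB; exact: hs].
    rewrite -RintegralTZ; last by apply: rintD; [apply: rintD; exact: hc|apply: rintB; exact: hs].
    apply: eq_Rintegral => w _; rewrite /k /trigk !mulrBl !mulrDl cosB cosD sinB sinD.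
    by field.
  rewrite FE; apply: (le_trans (norm_product_to_sum _ _ _ _ (Kc _) (Kc _) (Ks _) (Ks _))).
  by rewrite le_eqVlt; apply/orP; left; apply/eqP; rewrite /r /rho; ring.
have -> : pi * K * \int[mu]_t (rho a b t ^+ 2) = 2 * pi * (K / 2) * \int[mu]_t (r t ^+ 2).
  by rewrite /r; move: (pi : R) (\int[mu]_t _) => q J; field.
apply: (schur_test (M := M + M) mD hD r0 hr _ _ _ hF Fle).
- by move=> t; rewrite mulrDl lerD.
- exact: divr_ge0.
- by apply: eq_integrable hKH => // t _; rewrite /= step2E.
Qed.

End random_argument.
End trigonometric_transform.

(** * The deconvolution quotient and its moments *)

Section deconvolution_kernel.
Context (R : realType).
Notation mu := (@lebesgue_measure R).
Notation mR := (measurableTypeR R).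
Variables (p l : R).

(* Real and imaginary parts of the characteristic function of the noise. *)
Definition epsC (t : R) : R := lgC p 1 t / lgG p 1.
Definition epsS (t : R) : R := lgS p 1 t / lgG p 1.

(* [qre + i qim] is the Fourier transform of [psi l] at [- t] divided by the
   characteristic function of the noise at [t]. *)
Definition qre (t : R) : R :=
  (lgC 1 l t * epsC t - lgS 1 l t * epsS t) / (epsC t ^+ 2 + epsS t ^+ 2).
Definition qim (t : R) : R :=
  - (lgC 1 l t * epsS t + lgS 1 l t * epsC t) / (epsC t ^+ 2 + epsS t ^+ 2).

Definition ker_re (A t : R) : R := \1_(wnd A) t * qre t.
Definition ker_im (A t : R) : R := \1_(wnd A) t * qim t.

Hypotheses (p0 : 0 < p) (l0 : 0 < l).

Lemma eps_modulus t : epsC t ^+ 2 + epsS t ^+ 2 = lgR p 1 t.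
Proof. by rewrite lgRE lgNE mulrDl !exprMn exprVn. Qed.

Lemma eps_modulus_gt0 t : 0 < epsC t ^+ 2 + epsS t ^+ 2.
Proof. by rewrite eps_modulus lgR_gt0. Qed.

(** With [qS]: the quotient times the characteristic function of the noise is lgC - i lgS, the
    transform of psi at - t. *)
Lemma qC t : qre t * epsC t - qim t * epsS t = lgC 1 l t.
Proof. by rewrite /qre /qim; have := lt0r_neq0 (eps_modulus_gt0 t); move=> h; field. Qed.

Lemma qS t : qre t * epsS t + qim t * epsC t = - lgS 1 l t.
Proof. by rewrite /qre /qim; have := lt0r_neq0 (eps_modulus_gt0 t); move=> h; field. Qed.

Lemma q_modulus t : qre t ^+ 2 + qim t ^+ 2 = lgN 1 l t / lgR p 1 t.
Proof.
rewrite lgNE -eps_modulus /qre /qim; have := lt0r_neq0 (eps_modulus_gt0 t).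
by move=> h; field.
Qed.

Lemma epsCN t : epsC (- t) = epsC t.
Proof. by rewrite /epsC lgCN. Qed.

Lemma epsSN t : epsS (- t) = - epsS t.
Proof. by rewrite /epsS lgSN// mulNr. Qed.

Lemma qreN t : qre (- t) = qre t.
Proof. by rewrite /qre epsCN epsSN lgCN lgSN// mulrNN sqrrN. Qed.

Lemma qimN t : qim (- t) = - qim t.
Proof.
rewrite /qim epsCN epsSN lgCN lgSN// sqrrN -[RHS]mulNr; congr (_ * _); ring.
Qed.

Lemma measurable_epsC : measurable_fun setT epsC.
Proof. by apply: measurable_funM => //; exact: measurable_lgC. Qed.

Lemma measurable_epsS : measurable_fun setT epsS.
Proof. by apply: measurable_funM => //; exact: measurable_lgS. Qed.

Lemma measurable_modulusV : measurable_fun setT (fun t => (epsC t ^+ 2 + epsS t ^+ 2)^-1).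
Proof.
(* The modulus is positive, so its inverse is exp(-ln), a composition of measurable functions. *)
rewrite (_ : (fun t => _) = fun t => expR (- ln (epsC t ^+ 2 + epsS t ^+ 2))); last first.
  by apply/funext => t; rewrite expRN lnK// posrE eps_modulus_gt0.
apply: (measurableT_comp (f := expR)) => //; apply: measurableT_comp => //.
apply: (measurableT_comp (f := @ln R)); first exact: measurable_ln.
by apply: measurable_funD; apply: measurable_funX; [exact: measurable_epsC|exact: measurable_epsS].
Qed.

Lemma measurable_qre : measurable_fun setT qre.
Proof.
apply: measurable_funM; last exact: measurable_modulusV.
by apply: measurable_funB; apply: measurable_funM; [exact: measurable_lgC|exact: measurable_epsC|
  exact: measurable_lgS|exact: measurable_epsS].
Qed.

Lemma measurable_qim : measurable_fun setT qim.
Proof.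
apply: measurable_funM; last exact: measurable_modulusV.
apply: measurableT_comp => //.
by apply: measurable_funD; apply: measurable_funM; [exact: measurable_lgC|exact: measurable_epsS|
  exact: measurable_lgS|exact: measurable_epsC].
Qed.

Lemma q_modulus_le : exists2 K, 0 < K & forall t,
  qre t ^+ 2 + qim t ^+ 2 <= K * expR ((1 - p) * ln (1 + t ^+ 2)).
Proof.
have [K K0 HK] := lgR_ratio l0 p0.
have G0 := @lgG_gt0 R 1 l ltr01 l0.
exists (lgG 1 l ^+ 2 * K); first by rewrite mulr_gt0// exprn_gt0.
move=> t; rewrite q_modulus ler_pdivrMr ?lgR_gt0//.
have -> : lgN 1 l t = lgG 1 l ^+ 2 * lgR 1 l t.
  by rewrite lgRE mulrC mulfVK// expf_neq0// lt0r_neq0.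
by have := HK t; rewrite -(ler_pM2l (exprn_gt0 2 G0)) !mulrA.
Qed.

Lemma q_bounded A : exists2 M, 0 <= M & forall t, wnd A t -> `|qre t| <= M /\ `|qim t| <= M.
Proof.
have [K K0 HK] := q_modulus_le.
exists (Num.sqrt (K * expR (`|1 - p| * ln (1 + A ^+ 2)))); first exact: sqrtr_ge0.
move=> t tA; have t20 := sqr_ge0 t.
have tA2 : t ^+ 2 <= A ^+ 2.
  by rewrite -(sqr_normr t) -(sqr_normr A) ler_sqr ?nnegrE// (le_trans tA)// ler_norm.
have h : qre t ^+ 2 + qim t ^+ 2 <= K * expR (`|1 - p| * ln (1 + A ^+ 2)).
  apply: (le_trans (HK t)); rewrite ler_wpM2l ?(ltW K0)// ler_expR.
  have L0 : 0 <= ln (1 + t ^+ 2) by rewrite ln_ge0// lerDl.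
  apply: (@le_trans _ _ (`|1 - p| * ln (1 + t ^+ 2))).
    by rewrite ler_wpM2r// ler_norm.
  by rewrite ler_wpM2l// ler_ln ?posrE ?lerD2l// ltr_wpDr// (le_trans t20).
have s0 : 0 <= K * expR (`|1 - p| * ln (1 + A ^+ 2)).
  by rewrite mulr_ge0 ?(ltW K0)// expR_ge0.
split; rewrite -sqrtr_sqr ler_wsqrtr// (le_trans _ h)//.
  by rewrite lerDl sqr_ge0.
by rewrite lerDr sqr_ge0.
Qed.

Lemma measurable_ind_wnd A : measurable_fun setT (\1_(wnd A) : mR -> R).
Proof. by apply: measurable_indic; exact: measurable_wnd. Qed.

Lemma rint_wnd A : mu.-rint (\1_(wnd A) : R -> R).
Proof.
apply: (@rint_decay _ _ (1 + A ^+ 2)); first exact: measurable_ind_wnd.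
move=> t; have t0 : 0 < 1 + t ^+ 2 by rewrite ltr_wpDr// sqr_ge0.
rewrite ler_pdivlMr// indicE; have [tA|_] := boolP (t \in _); last first.
  by rewrite normr0 mul0r addr_ge0// sqr_ge0.
rewrite normr1 mul1r lerD2l -(sqr_normr t) -(sqr_normr A) ler_sqr ?nnegrE//.
by rewrite (le_trans (set_mem tA))// ler_norm.
Qed.

Lemma ker_bounded A : exists2 M, 0 <= M & forall t,
  `|ker_re A t| <= M * \1_(wnd A) t /\ `|ker_im A t| <= M * \1_(wnd A) t.
Proof.
have [M M0 HM] := q_bounded A; exists M => // t.
rewrite /ker_re /ker_im indicE; have [tA|_] := boolP (t \in _); last first.
  by rewrite !mul0r mulr0 normr0.
by rewrite !mul1r mulr1; exact: HM (set_mem tA).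
Qed.

Lemma rint_ker_re A : mu.-rint (ker_re A).
Proof.
have [M M0 HM] := ker_bounded A.
apply: (rint_dom (m := mu) _ (fun t => (HM t).1)); last by apply: rintZ; exact: rint_wnd.
by apply: measurable_funM; [exact: measurable_ind_wnd|exact: measurable_qre].
Qed.

Lemma rint_ker_im A : mu.-rint (ker_im A).
Proof.
have [M M0 HM] := ker_bounded A.
apply: (rint_dom (m := mu) _ (fun t => (HM t).2)); last by apply: rintZ; exact: rint_wnd.
by apply: measurable_funM; [exact: measurable_ind_wnd|exact: measurable_qim].
Qed.

Lemma ker_sqr_integral : exists2 K, 0 <= K & forall m : nat, (0 < m)%N ->
  \int[mu]_t (rho (ker_re (pi * m%:R)) (ker_im (pi * m%:R)) t ^+ 2) <=
  K * (variance_rate p m + (p == 3 / 2)%:R).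
Proof.
have [K K0 HK] := q_modulus_le; have [L L0 HL] := @power_integral_rate R p.
exists (2 * K * L); first by rewrite !mulr_ge0// ltW.
move=> m m0; set A := pi * m%:R; rewrite -mulrA.
apply: (@le_trans _ _ (2 * K * \int[mu]_t (\1_(wnd A) t * expR ((1 - p) * ln (1 + t ^+ 2))))).
  have hE : mu.-rint (fun t => \1_(wnd A) t * expR ((1 - p) * ln (1 + t ^+ 2))).
    apply: rint_wnd_continuous => t; apply: der1_continuous; apply: der1_expR.
    apply: der1M; first exact: der1_cst.
    apply: der1_ln; first by rewrite ltr_wpDr// sqr_ge0.
    by apply: der1D; [exact: der1_cst|apply: der1_sqr; exact: der1_id].
  rewrite -RintegralTZ//; apply: le_RintegralT; last 1 first.
  - move=> t; rewrite /rho /ker_re /ker_im [`|_ * qre t|]normrM [`|_ * qim t|]normrM.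
    have := HK t; have : 0 <= \1_(wnd A) t :> R by rewrite indicE.
    have : \1_(wnd A) t ^+ 2 = \1_(wnd A) t :> R.
      by rewrite indicE; case: (_ \in _); rewrite ?expr0n ?expr1n.
    rewrite -(sqr_normr (qre t)) -(sqr_normr (qim t)).
    move: (expR _) (\1_(wnd A) t : R) (`|qre t|) (`|qim t|) => E e x y ee e0 h.
    rewrite (ger0_norm e0) -mulrDr exprMn ee [leRHS]mulrCA ler_wpM2l// -[leRHS]mulrA.
    by move: h (sqr_ge0 (x - y)); move: (K * E); clear; move=> KE h h2; nra.
  - have [M M0 HM] := ker_bounded A.
    apply: (rint_sqr_support (M := M + M) (D := wnd A)).
    - exact: rho_ge0.
    - by apply: rint_rho; [exact: rint_ker_re|exact: rint_ker_im].
    - by move=> t; rewrite mulrDl lerD; [|exact: (HM t).1|exact: (HM t).2].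
  - exact: rintZ.
by rewrite ler_wpM2l ?HL// mulr_ge0// ltW.
Qed.

Section noise.
Context d (T : measurableType d) (P : probability T R) (eps : T -> R).
Hypotheses (meps : measurable_fun setT eps)
  (hC : forall t, \int[P]_w cos (t * eps w) = epsC t)
  (hS : forall t, \int[P]_w sin (t * eps w) = epsS t).

Lemma Rintegral_cos_shift x t :
  \int[P]_w cos (t * (x + eps w)) = cos (t * x) * epsC t - sin (t * x) * epsS t.
Proof.
rewrite -hC -hS -!RintegralTZ; [|exact: rint_sin_rv|exact: rint_cos_rv].
rewrite -RintegralTB; [|by apply: rintZ; exact: rint_cos_rv|by apply: rintZ; exact: rint_sin_rv].
by apply: eq_Rintegral => w _; rewrite mulrDr cosD.
Qed.

Lemma Rintegral_sin_shift x t :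
  \int[P]_w sin (t * (x + eps w)) = sin (t * x) * epsC t + cos (t * x) * epsS t.
Proof.
rewrite -hC -hS -!RintegralTZ; [|exact: rint_sin_rv|exact: rint_cos_rv].
rewrite -RintegralTD; [|by apply: rintZ; exact: rint_cos_rv|by apply: rintZ; exact: rint_sin_rv].
by apply: eq_Rintegral => w _; rewrite mulrDr sinD.
Qed.

(** Averaging e^(i t (x + eps)) over the noise multiplies e^(i t x) by the characteristic function
    at t, which cancels the denominator of the kernel. *)
Lemma kernel_mean A x :
  \int[P]_w trigT (ker_re A) (ker_im A) (x + eps w) =
  \int[mu]_t (\1_(wnd A) t * lgI 1 l t x).
Proof.
rewrite trigT_mean; last 3 first.
- exact: rint_ker_re.
- exact: rint_ker_im.
- exact: measurable_funD.
apply: eq_Rintegral => t _; rewrite Rintegral_cos_shift Rintegral_sin_shift.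
rewrite /ker_re /ker_im /lgI -(qC t) -[lgS 1 l t]opprK -(qS t).
by move: (\1_(wnd A) t : R) => e; ring.
Qed.

(** A shift by [x] only rotates the characteristic function. Bounding each of its parts by the two
    parts of the unshifted one costs a factor 2, uniformly in [x]. *)
Lemma kernel_second_moment : exists2 C, 0 <= C & forall (m : nat) x, (0 < m)%N ->
  \int[P]_w (trigT (ker_re (pi * m%:R)) (ker_im (pi * m%:R)) (x + eps w) ^+ 2) <=
  C * (variance_rate p m + (p == 3 / 2)%:R).
Proof.
have [L L0 HL] := ker_sqr_integral.
have [K K0 HK] := lgCS_decay p0 (@ltr01 R).
have G0 := @lgG_gt0 R p 1 p0 ltr01.
pose K' := K / lgG p 1; have K'0 : 0 <= K' by rewrite divr_ge0// ltW.
have cle u : `|epsC u| <= K' * (1 + u ^+ 2)^-1.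
  by rewrite normrM [`|_^-1|]gtr0_norm ?invr_gt0// mulrAC ler_wpM2r ?invr_ge0 ?(ltW G0)// (HK u).1.
have sle u : `|epsS u| <= K' * (1 + u ^+ 2)^-1.
  by rewrite normrM [`|_^-1|]gtr0_norm ?invr_gt0// mulrAC ler_wpM2r ?invr_ge0 ?(ltW G0)// (HK u).2.
have two (x y c e k : R) : `|x| <= 1 -> `|y| <= 1 -> `|c| <= k -> `|e| <= k ->
    `|x| * `|c| + `|y| * `|e| <= 2 * k.
  move=> x1 y1 ck ek; rewrite mulr_natl mulr2n lerD//.
    by rewrite (le_trans _ ck)// ler_piMl.
  by rewrite (le_trans _ ek)// ler_piMl.
have C0 : 0 <= pi * (2 * K').
  by apply: mulr_ge0; [exact: pi_ge0|exact: mulr_ge0].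
exists (pi * (2 * K') * L); first exact: mulr_ge0.
move=> m x m0; set A := pi * m%:R; have [M M0 HM] := ker_bounded A.
rewrite -[leRHS]mulrA; apply: (@le_trans _ _ (pi * (2 * K') * \int[mu]_t (rho (ker_re A) (ker_im A) t ^+ 2))).
  apply: (@trigT_second_moment _ _ _ _ _ _ _ _ _ _ (wnd A) M).
  - exact: rint_ker_re.
  - exact: rint_ker_im.
  - exact: measurable_funD.
  - exact: measurable_wnd.
  - exact: rint_wnd.
  - by move=> t; exact: (HM t).1.
  - by move=> t; exact: (HM t).2.
  - exact: mulr_ge0.
  - move=> u; rewrite Rintegral_cos_shift (le_trans (ler_normB _ _))// [`|_ * epsC u|]normrM [`|_ * epsS u|]normrM -mulrA two//.
    + exact: cos_max.
    + exact: sin_max.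
  - move=> u; rewrite Rintegral_sin_shift (le_trans (ler_normD _ _))// [`|_ * epsC u|]normrM [`|_ * epsS u|]normrM -mulrA two//.
    + exact: sin_max.
    + exact: cos_max.
by apply: ler_wpM2l => //; exact: HL.
Qed.

End noise.

End deconvolution_kernel.

(** * The estimator *)

Section estimator_value.
Context (R : realType).
Notation mu := (@lebesgue_measure R).
Notation mR := (measurableTypeR R).

Lemma Cintegral_kernel (p l A z : R) (f : R -> R) : 0 < p -> 0 < l ->
  (forall t, fourier f t = epsC p t +i* epsS p t) ->
  Cintegral (wnd A) (fun t => expi (t * z) * (fourier (psi l) (- t) / fourier f t)) =
  (trigT (ker_re p l A) (ker_im p l A) z)%:C.
Proof.
move=> p0 l0 hf; have hre := rint_ker_re p0 l0 A; have him := rint_ker_im p0 l0 A.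
have q0 t := eps_modulus_gt0 p0 t.
have E t : expi (t * z) * (fourier (psi l) (- t) / fourier f t) =
    (cos (t * z) * qre p l t - sin (t * z) * qim p l t) +i*
    (sin (t * z) * qre p l t + cos (t * z) * qim p l t).
  rewrite hf fourier_psi lgCN lgSN// /qre /qim /expi.
  apply/eqP; rewrite eq_complex/=; move: (lt0r_neq0 (q0 t)) => h.
  by apply/andP; split; apply/eqP; field.
rewrite (_ : (fun t => _) = fun t => (cos (t * z) * qre p l t - sin (t * z) * qim p l t) +i*
    (sin (t * z) * qre p l t + cos (t * z) * qim p l t)); last exact/funext.
apply/eqP; rewrite eq_complex /=; apply/andP; split; apply/eqP.
  rewrite Rintegral_indic; apply: eq_Rintegral => t _.
  by rewrite /trigk /ker_re /ker_im mulrBr !(mulrCA (\1_(wnd A) t)).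
rewrite Rintegral_indic; pose I := \int[mu]_t (sin (t * z) * ker_re p l A t + cos (t * z) * ker_im p l A t).
have -> : \int[mu]_t (\1_(wnd A) t * (sin (t * z) * qre p l t + cos (t * z) * qim p l t)) = I.
  by apply: eq_Rintegral => t _; rewrite /ker_re /ker_im mulrDr !(mulrCA (\1_(wnd A) t)).
have h : mu.-rint (fun t => sin (t * z) * ker_re p l A t + cos (t * z) * ker_im p l A t).
  apply: rintD.
    apply: (rintM (m := mu) (M := 1)) => //; last by move=> t; exact: sin_max.
    by apply: continuous_measurable_fun; der_cont.
  apply: (rintM (m := mu) (M := 1)) => //; last by move=> t; exact: cos_max.
  by apply: continuous_measurable_fun; der_cont.
suff : I = - I by move/eqP; rewrite -addr_eq0 -mulr2n mulrn_eq0/= => /eqP.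
rewrite {1}/I -Rintegral_opp// -RintegralTN//; apply: eq_Rintegral => t _.
rewrite /ker_re /ker_im !indic_wndN qreN// qimN// mulNr sinN cosN.
by move: (\1_(wnd A) t : R) => e; ring.
Qed.

Lemma h_hat_real T (Z : int -> T -> R) (f : R -> R) (p l : R) (m n : nat) w :
  0 < p -> 0 < l -> (forall t, fourier f t = epsC p t +i* epsS p t) ->
  h_hat Z f m n l w =
  (n%:R^-1 * \sum_(k < n) ((2 * pi)^-1 *
     trigT (ker_re p l (pi * m%:R)) (ker_im p l (pi * m%:R)) (Z k.+1%:Z w)))%:C.
Proof.
move=> p0 l0 hf; rewrite /h_hat big_add1 /= big_mkord.
rewrite (eq_bigr (fun k : 'I_n =>
  (trigT (ker_re p l (pi * m%:R)) (ker_im p l (pi * m%:R)) (Z k.+1%:Z w))%:C)); last first.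
  by move=> k _; exact: Cintegral_kernel.
rewrite -rmorph_sum -rmorphM/= -mulr_sumr mulrA; congr (_%:C); congr (_ * _).
by rewrite invfM mulrC.
Qed.

Lemma sqr_normc_real (x y : R) : Normc.normc (x%:C - y%:C) ^+ 2 = (x - y) ^+ 2.
Proof. by rewrite -rmorphB/= expr0n/= addr0 sqr_sqrtr// sqr_ge0. Qed.

End estimator_value.

(** * Second moments of sums of dependent variables *)

Section second_moment_of_sums.
Context (R : realType) d (T : measurableType d) (P : probability T R).

(** The n-th summand adds its own second moment and twice its products with the earlier ones, at
    most 2 S in all. With [c] concentrated at 0 this covers orthogonal summands, with [c] summable
    it covers mixing ones. *)
Lemma second_moment_sum (Y : nat -> T -> R) (M S : R) (c : nat -> R) :
  (forall k, measurable_fun setT (Y k)) -> (forall k w, `|Y k w| <= M) ->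
  (forall k, 0 <= c k) -> (forall N, \sum_(k < N) c k <= S) ->
  (forall k j, (k <= j)%N -> \int[P]_w (Y k w * Y j w) <= c (j - k)%N) ->
  forall n, \int[P]_w ((\sum_(k < n) Y k w) ^+ 2) <= 2 * n%:R * S.
Proof.
move=> mY YM c0 cS Yc; elim=> [|n IH].
  rewrite mulr0 mul0r; under eq_Rintegral do rewrite big_ord0 expr0n.
  by rewrite Rintegral_cstT.
have hYY k j : P.-rint (fun w => Y k w * Y j w).
  by apply: (rintM (mY k) (YM k)); exact: rint_bounded (mY j) (YM j).
have hS j : P.-rint (fun w => \sum_(k < n) (Y k w * Y j w)).
  by apply: (rint_sum (m := P)) => k.
have hSS : P.-rint (fun w => (\sum_(k < n) Y k w) ^+ 2).
  under eq_fun do rewrite expr2 mulr_suml.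
  apply: (rint_sum (m := P)) => k; under eq_fun do rewrite mulr_sumr.
  by apply: (rint_sum (m := P)) => j.
have E w : (\sum_(k < n.+1) Y k w) ^+ 2 = (\sum_(k < n) Y k w) ^+ 2 +
    (Y n w * Y n w + 2 * \sum_(k < n) (Y k w * Y n w)).
  rewrite big_ord_recr/= -mulr_suml; move: (\sum_(k < n) _) (Y n w) => a b.
  by rewrite sqrrD expr2; ring.
under eq_Rintegral do rewrite E.
rewrite RintegralTD//; last by apply: rintD => //; exact: rintZ.
rewrite RintegralTD//; last exact: rintZ.
rewrite RintegralTZ// Rintegral_sumT//.
have -> : 2 * n.+1%:R * S = 2 * n%:R * S + 2 * S by rewrite -(natr1 n); ring.
rewrite lerD//.
have h0 := Yc n n (leqnn n); rewrite subnn in h0.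
apply: (@le_trans _ _ (c 0%N + 2 * \sum_(k < n) c (n - k)%N)).
  rewrite lerD// ler_wpM2l//; apply: ler_sum => k _; apply: Yc.
  by rewrite ltnW.
have := cS n.+1; rewrite big_ord_recl /= => H.
have -> : \sum_(k < n) c (n - k)%N = \sum_(k < n) c (bump 0 k).
  rewrite (reindex_inj rev_ord_inj)/=; apply: eq_bigr => k _; congr c.
  by rewrite subnA// ?subnn// add0n.
by have := c0 0%N; move: H; clear; lra.
Qed.

End second_moment_of_sums.

Section sigma_families.
Context d (T : measurableType d) (R : realType).

(** Each [X i] with [i] in [J] is measurable for the generated sigma-algebra by construction. Two
    times are allowed because orthogonality involves pairs; j = k gives a single time. *)
Lemma sigma_family_comp (X : int -> T -> R) (J : set int) (j k : int)
  d' (S : measurableType d') (phi : R * R -> S) A : J j -> J k ->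
  measurable_fun setT phi -> measurable A ->
  sigma_family X J ((fun w => phi (X j w, X k w)) @^-1` A).
Proof.
move=> Jj Jk mphi mA.
pose G := \bigcup_(i in J) preimage_set_system setT (X i) measurable.
have mX i : J i -> @measurable_fun _ _ (g_sigma_algebraType G) R setT (X i).
  move=> Ji _ B mB; apply: sub_sigma_algebra; exists i => //.
  by exists B.
have mp : @measurable_fun _ _ (g_sigma_algebraType G) S setT
    (fun w => phi (X j w, X k w)).
  apply: (measurableT_comp (f := phi)) => //.
  by apply: measurable_fun_pair; exact: mX.
by have := mp measurableT A mA; rewrite setTI.
Qed.

Lemma independent_families_comp (P : probability T R) (X Y : int -> T -> R)
  (j k : int) d1 (S1 : measurableType d1) d2 (S2 : measurableType d2)
  (phi : R * R -> S1) (chi : R * R -> S2) A B :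
  independent_families P X Y ->
  measurable_fun setT phi -> measurable_fun setT chi ->
  measurable A -> measurable B ->
  P ((fun w => phi (X j w, X k w)) @^-1` A `&` (fun w => chi (Y j w, Y k w)) @^-1` B) =
  (P ((fun w => phi (X j w, X k w)) @^-1` A) *
   P ((fun w => chi (Y j w, Y k w)) @^-1` B))%E.
Proof. by move=> h mphi mchi mA mB; apply: h; exact: sigma_family_comp. Qed.

Lemma mutually_independent2 (P : probability T R) (X : int -> T -> R) (j k : int) A B :
  mutually_independent P X -> j != k -> measurable A -> measurable B ->
  P (X j @^-1` A `&` X k @^-1` B) = (P (X j @^-1` A) * P (X k @^-1` B))%E.
Proof.
move=> h jk mA mB; have kj : k == j = false by rewrite eq_sym; exact/negbTE.
have U : uniq [:: j; k] by rewrite /= inE jk.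
have mAB i : measurable (if i == j then A else B) by case: ifP.
have := h [:: j; k] _ U mAB.
rewrite !big_cons big_nil mule1 eqxx kj => <-; congr (P _).
apply/seteqP; split => w /=.
  by move=> [Aj Bk] i /=; rewrite !inE => /orP[|] /eqP ->; rewrite ?eqxx ?kj.
move=> H; split.
  by have := H j; rewrite /= !inE eqxx; exact.
by have := H k; rewrite /= !inE eqxx orbT kj; exact.
Qed.

End sigma_families.

(** * Signal plus independent noise *)

Section signal_plus_noise.
Context d (T : measurableType d) (R : realType) (P : probability T R).
Variables (X e : nat -> T -> R) (H : R -> R) (M C : R).
Hypotheses (mX : forall k, measurable_fun setT (X k))
  (me : forall k, measurable_fun setT (e k))
  (Xe : forall j k (A B : set (R * R)), measurable A -> measurable B ->
    P ((fun w => (X j w, X k w)) @^-1` A `&` (fun w => (e j w, e k w)) @^-1` B) =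
    (P ((fun w => (X j w, X k w)) @^-1` A) * P ((fun w => (e j w, e k w)) @^-1` B))%E)
  (ee : forall j k (A B : set R), j != k -> measurable A -> measurable B ->
    P (e j @^-1` A `&` e k @^-1` B) = (P (e j @^-1` A) * P (e k @^-1` B))%E)
  (law_e : forall k (A : set R), measurable A -> P (e k @^-1` A) = P (e 0%N @^-1` A))
  (mH : measurable_fun setT H) (HM : forall x, `|H x| <= M)
  (HC : forall x, \int[P]_w (H (x + e 0%N w) ^+ 2) <= C).

(** By independence and equality of the laws of the noises, the conditional mean of H(X_k + e_k)
    given X_k = x, for every k. *)
Definition smoothed (x : R) : R := \int[P]_w H (x + e 0%N w).

Let measurable_shift k x : measurable_fun setT (fun w => H (x + e k w)).
Proof. by apply: (measurableT_comp mH); exact: measurable_funD. Qed.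

Let shift_law k x (f : R -> R) N : measurable_fun setT f -> (forall z, `|f z| <= N) ->
  \int[P]_w f (x + e k w) = \int[P]_w f (x + e 0%N w).
Proof.
move=> mf fN; apply: (@eq_law _ _ _ P _ _ P _ R (e k) (e 0%N) (fun z => f (x + z)) N) => //.
- exact: law_e.
- by apply: (measurableT_comp mf); exact: measurable_funD.
Qed.

Lemma smoothed_le x : `|smoothed x| <= M.
Proof. by apply: norm_Rintegral_bounded => //; exact: measurable_shift. Qed.

Let Xe1 k (A B : set R) : measurable A -> measurable B ->
  P (X k @^-1` A `&` e k @^-1` B) = (P (X k @^-1` A) * P (e k @^-1` B))%E.
Proof.
move=> mA mB; have mf (D : set R) : measurable D -> measurable ([set z | D z.1] : set (R * R)).
  move=> mD; rewrite -[X in measurable X]setTI.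
  by apply: (measurable_fst measurableT).
by have := Xe k k (mf A mA) (mf B mB).
Qed.

Lemma measurable_smoothed : measurable_fun setT smoothed.
Proof.
have mf : measurable_fun setT (fun z : R * R => H (z.1 + z.2)).
  by apply: (measurableT_comp mH); apply: measurable_funD.
exact: (@Fubini_indep _ _ _ P _ R _ R (X 0%N) (e 0%N) (fun u v => H (u + v)) M
  (mX _) (me _) (Xe1 0%N) mf (fun u v => HM _)).2.
Qed.

Definition fluctuation k w : R := H (X k w + e k w) - smoothed (X k w).

Lemma measurable_fluctuation k : measurable_fun setT (fluctuation k).
Proof.
apply: measurable_funB; first by apply: (measurableT_comp mH); exact: measurable_funD.
exact: (measurableT_comp measurable_smoothed).
Qed.

Let M2 x y : `|H x - smoothed y| <= 2 * M.
Proof. by rewrite (le_trans (ler_normB _ _))// mulr_natl mulr2n lerD// smoothed_le. Qed.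

Lemma fluctuation_le k w : `|fluctuation k w| <= 2 * M.
Proof. exact: M2. Qed.

(** Two uses of independence: the noises are separated from the signal, whose values x and y are
    then frozen, and the two noises from each other. The inner factor is centred by the definition
    of [smoothed]. *)
Lemma fluctuation_orthogonal j k : j != k ->
  \int[P]_w (fluctuation j w * fluctuation k w) = 0.
Proof.
move=> jk; have M0 : 0 <= M by exact: le_trans (HM 0).
pose f (u v : R * R) := (H (u.1 + v.1) - smoothed u.1) * (H (u.2 + v.2) - smoothed u.2).
have mpX : measurable_fun setT (fun w => (X j w, X k w)) by exact: measurable_fun_pair.
have mpe : measurable_fun setT (fun w => (e j w, e k w)) by exact: measurable_fun_pair.
have mf : measurable_fun setT (fun z : (R * R) * (R * R) => f z.1 z.2).
  have m11 : measurable_fun setT (fun z : (R * R) * (R * R) => z.1.1) by exact: measurableT_comp.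
  have m12 : measurable_fun setT (fun z : (R * R) * (R * R) => z.1.2) by exact: measurableT_comp.
  have m21 : measurable_fun setT (fun z : (R * R) * (R * R) => z.2.1) by exact: measurableT_comp.
  have m22 : measurable_fun setT (fun z : (R * R) * (R * R) => z.2.2) by exact: measurableT_comp.
  apply: measurable_funM; apply: measurable_funB.
  - by apply: (measurableT_comp mH); exact: measurable_funD.
  - exact: (measurableT_comp measurable_smoothed).
  - by apply: (measurableT_comp mH); exact: measurable_funD.
  - exact: (measurableT_comp measurable_smoothed).
have fM u v : `|f u v| <= 2 * M * (2 * M) by rewrite normrM ler_pM// M2.
rewrite (@Fubini_indep _ _ _ P _ (R * R)%type _ (R * R)%type
  (fun w => (X j w, X k w)) (fun w => (e j w, e k w)) f _ mpX mpe (Xe j k) mf fM).1.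
transitivity (\int[P]_w (0 : R)); last by rewrite Rintegral_cstT.
apply: eq_Rintegral => w _; move: (X j w) (X k w) => x y; rewrite /f /=.
have mg : measurable_fun setT (fun z : R * R => (H (x + z.1) - smoothed x) * (H (y + z.2) - smoothed y)).
  by apply: measurable_funM; apply: measurable_funB => //; apply: (measurableT_comp mH); exact: measurable_funD.
have gM u v : `|(H (x + u) - smoothed x) * (H (y + v) - smoothed y)| <= 2 * M * (2 * M).
  by rewrite normrM ler_pM// M2.
rewrite (@Fubini_indep _ _ _ P _ R _ R (e j) (e k)
  (fun u v => (H (x + u) - smoothed x) * (H (y + v) - smoothed y)) _ (me j) (me k)
  (fun A B => ee jk) mg gM).1.
transitivity (\int[P]_w (0 : R)); last by rewrite Rintegral_cstT.
apply: eq_Rintegral => v _; have hk : P.-rint (fun w => H (y + e k w)).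
  by apply: (rint_bounded P (M := M)).
rewrite RintegralTZ; last by apply: rintB => //; exact: rint_cst.
rewrite RintegralTB//; last exact: rint_cst.
by rewrite Rintegral_cstT (shift_law k y mH HM) subrr mulr0.
Qed.

(** With the signal frozen at x, this is a variance, hence at most the second moment, which is
    bounded uniformly in x. *)
Lemma fluctuation_variance k : \int[P]_w (fluctuation k w * fluctuation k w) <= C.
Proof.
have M0 : 0 <= M by exact: le_trans (HM 0).
pose f u v := (H (u + v) - smoothed u) * (H (u + v) - smoothed u).
have mf : measurable_fun setT (fun z : R * R => f z.1 z.2).
  have m1 : measurable_fun setT (fun z : R * R => H (z.1 + z.2) - smoothed z.1).
    apply: measurable_funB; last exact: (measurableT_comp measurable_smoothed).
    by apply: (measurableT_comp mH); exact: measurable_funD.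
  exact: measurable_funM.
have fM u v : `|f u v| <= 2 * M * (2 * M) by rewrite normrM ler_pM// M2.
have [-> mF] := @Fubini_indep _ _ _ P _ R _ R (X k) (e k) f _ (mX k) (me k) (Xe1 k) mf fM.
have mfu u : measurable_fun setT (f u).
  exact: (measurable_fun_pair2 (f := fun z : R * R => f z.1 z.2)).
rewrite -[leRHS](Rintegral_cstT P); apply: le_RintegralT; last 1 first.
- move=> w; move: (X k w) => x.
  have h1 : P.-rint (fun w => H (x + e k w)) by apply: (rint_bounded P (M := M)).
  have H2M z : `|H z ^+ 2| <= M * M by rewrite expr2 normrM ler_pM.
  have h2 : P.-rint (fun w => H (x + e k w) ^+ 2).
    by apply: (rint_bounded P (M := M * M)) => //; exact: measurable_funX.
  have -> : \int[P]_v f x (e k v) = \int[P]_w (H (x + e k w) ^+ 2) - smoothed x ^+ 2.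
    transitivity (\int[P]_w (H (x + e k w) ^+ 2 - (2 * smoothed x * H (x + e k w) - smoothed x ^+ 2))).
      by apply: eq_Rintegral => v _; rewrite /f; ring.
    have h3 : P.-rint (fun w => 2 * smoothed x * H (x + e k w)) by exact: rintZ.
    have h4 : P.-rint (fun=> smoothed x ^+ 2) by exact: rint_cst.
    rewrite RintegralTB//; last exact: rintB.
    rewrite RintegralTB// RintegralTZ// Rintegral_cstT.
    rewrite (shift_law k x mH HM) -/(smoothed x); ring.
  rewrite (shift_law k x (f := fun z => H z ^+ 2) (N := M * M))//; last exact: measurable_funX.
  by rewrite (le_trans _ (HC x))// lerBlDr lerDl sqr_ge0.
- apply: (rint_bounded P (M := 2 * M * (2 * M))).
    exact: (measurableT_comp mF).
  move=> w; apply: norm_Rintegral_bounded => //.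
  exact: (measurableT_comp (mfu _)).
- exact: rint_cst.
Qed.

Lemma fluctuation_sum (n : nat) : 0 <= C ->
  \int[P]_w ((\sum_(k < n) fluctuation k w) ^+ 2) <= 2 * n%:R * C.
Proof.
move=> C0; apply: (@second_moment_sum _ _ _ _ fluctuation (2 * M) C
    (fun k => if k == 0%N then C else 0)).
- exact: measurable_fluctuation.
- exact: fluctuation_le.
- by move=> k; case: ifP.
- case=> [|N]; first by rewrite big_ord0.
  by rewrite big_ord_recl/= big1 ?addr0.
- move=> k j kj; case: ifPn; rewrite subn_eq0 => jk.
    by have -> : k = j; [apply/eqP; rewrite eqn_leq kj|exact: fluctuation_variance].
  by rewrite fluctuation_orthogonal// neq_ltn ltnNge jk.
Qed.

End signal_plus_noise.

(** * Averages of a function of the mixing signal *)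

Section mixing.
Context d (T : measurableType d) (R : realType) (P : probability T R).

(** Comparison with the trivial event: the coefficient bounds an absolute value. *)
Lemma beta_mixing_coef_ge0 (X : int -> T -> R) k : (0 <= beta_mixing_coef P X k)%E.
Proof.
have sT J : sigma_family X J setT.
  exact: (@measurableT _ (g_sigma_algebraType (\bigcup_(j in J) preimage_set_system setT (X j) measurable))).
have s0 J : sigma_family X J (~` setT).
  rewrite setCT.
  exact: (@measurable0 _ (g_sigma_algebraType (\bigcup_(j in J) preimage_set_system setT (X j) measurable))).
have := @beta_coef_event R _ T P _ _ _ _ (sT [set i | i <= 0]) (s0 [set i | i <= 0])
  (sT [set i | k%:Z <= i]) (s0 [set i | k%:Z <= i]).
by move=> /(le_trans (abse_ge0 _)); rewrite pmule_rge0.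
Qed.

Variables (V : int -> T -> R) (B : R -> R) (M : R).
Hypotheses (mV : forall i, measurable_fun setT (V i)) (sV : stationary P V)
  (mB : measurable_fun setT B) (BM : forall x, `|B x| <= M).

Let mBV i : measurable_fun setT (fun w => B (sv_X V i w)).
Proof. by apply: (measurableT_comp mB); apply: measurableT_comp => //; exact: measurable_ln. Qed.

Let rBV i : P.-rint (fun w => B (sv_X V i w)).
Proof. exact: (rint_bounded P (mBV i)). Qed.

Lemma stationary_mean i : \int[P]_w B (sv_X V i w) = \int[P]_w B (sv_X V 0 w).
Proof.
apply: (@Rintegral_stationary _ _ _ P V (fun x _ => B (ln x)) M mV sV _ (fun x _ => BM _) i 0).
apply: (measurableT_comp (f := fun x => B (ln x))) => //.
by apply: (measurableT_comp mB); exact: measurable_ln.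
Qed.

(** Stationarity moves the pair of times to 0 and j - k, where the two variables are measurable for
    the past and the future that define the coefficient. *)
Lemma stationary_covariance (k j : nat) (b : R) : (k <= j)%N ->
  (beta_mixing_coef P (sv_X V) (j - k) <= b%:E)%E ->
  `|\int[P]_w (B (sv_X V k.+1%:Z w) * B (sv_X V j.+1%:Z w)) -
    (\int[P]_w B (sv_X V 0 w)) ^+ 2| <= 8 * M * M * b.
Proof.
move=> kj Hb; have M0 : 0 <= M by exact: le_trans (BM 0).
have mBln : measurable_fun setT (fun x => B (ln x)).
  by apply: (measurableT_comp mB); exact: measurable_ln.
have -> : \int[P]_w (B (sv_X V k.+1%:Z w) * B (sv_X V j.+1%:Z w)) =
    \int[P]_w (B (sv_X V 0 w) * B (sv_X V (j - k)%N%:Z w)).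
  have -> : (j.+1%:Z = (j - k)%N%:Z + k.+1%:Z)%R by rewrite -PoszD addnS subnK.
  apply: (@Rintegral_stationary _ _ _ P V (fun x y => B (ln x) * B (ln y)) (M * M) mV sV).
    by apply: measurable_funM; exact: (measurableT_comp mBln).
  by move=> x y; rewrite normrM ler_pM.
rewrite expr2 -{2}(stationary_mean (j - k)%N%:Z).
apply: beta_covariance Hb => //.
- move=> s; split.
    apply: (@sigma_family_comp _ _ _ (sv_X V) _ 0 0 _ R (fun z => B z.1) [set y | s <= y]) => //.
      exact: (measurableT_comp mB).
    exact: measurable_ge_set.
  apply: (@sigma_family_comp _ _ _ (sv_X V) _ 0 0 _ R (fun z => B z.1) (~` [set y | s <= y])) => //.
    exact: (measurableT_comp mB).
  by apply: measurableC; exact: measurable_ge_set.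
- move=> s; split.
    apply: (@sigma_family_comp _ _ _ (sv_X V) _ (j - k)%N%:Z (j - k)%N%:Z _ R (fun z => B z.1) [set y | s <= y]) => //=.
      exact: (measurableT_comp mB).
    exact: measurable_ge_set.
  apply: (@sigma_family_comp _ _ _ (sv_X V) _ (j - k)%N%:Z (j - k)%N%:Z _ R (fun z => B z.1) (~` [set y | s <= y])) => //=.
    exact: (measurableT_comp mB).
  by apply: measurableC; exact: measurable_ge_set.
Qed.

Lemma mixing_sum (n : nat) : (\sum_(0 <= k <oo) beta_mixing_coef P (sv_X V) k < +oo)%E ->
  \int[P]_w ((\sum_(k < n) (B (sv_X V k.+1%:Z w) - \int[P]_w B (sv_X V 0 w))) ^+ 2) <=
  2 * n%:R * (8 * M * M * fine (\sum_(0 <= k <oo) beta_mixing_coef P (sv_X V) k)%E).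
Proof.
move=> fin; set b := \int[P]_w B (sv_X V 0 w).
have M0 : 0 <= M by exact: le_trans (BM 0).
have b0 := beta_mixing_coef_ge0 (sv_X V).
have S0 : (0 <= \sum_(0 <= k <oo) beta_mixing_coef P (sv_X V) k)%E by exact: nneseries_ge0.
have part N : (\sum_(0 <= k < N) beta_mixing_coef P (sv_X V) k <=
    \sum_(0 <= k <oo) beta_mixing_coef P (sv_X V) k)%E by exact: nneseries_lim_ge.
(* Each term of a finite sum of nonnegative terms is finite, so [fine] loses nothing. *)
have bfin k : beta_mixing_coef P (sv_X V) k \is a fin_num.
  rewrite ge0_fin_numE//; apply: le_lt_trans fin; apply: le_trans (part k.+1).
  by rewrite big_nat_recr//= leeDr// sume_ge0.
have bM : `|b| <= M by exact: norm_Rintegral_bounded.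
apply: (@second_moment_sum _ _ _ P (fun k w => B (sv_X V k.+1%:Z w) - b) (M + M) _
  (fun k => 8 * M * M * fine (beta_mixing_coef P (sv_X V) k))).
- by move=> k; apply: measurable_funB.
- by move=> k w; rewrite (le_trans (ler_normB _ _))// lerD.
- by move=> k; rewrite mulr_ge0 ?mulr_ge0// fine_ge0.
- move=> N; rewrite -mulr_sumr ler_wpM2l ?mulr_ge0//.
  have := part N; rewrite big_mkord -lee_fin fineK ?ge0_fin_numE//.
  rewrite -sumEFin; under [in X in _ -> X]eq_bigr do rewrite fineK//.
  exact.
- move=> k j kj.
  have rBB : P.-rint (fun w => B (sv_X V k.+1%:Z w) * B (sv_X V j.+1%:Z w)).
    by apply: (rintM (mBV _) (fun w => BM _)).
  have -> : \int[P]_w ((B (sv_X V k.+1%:Z w) - b) * (B (sv_X V j.+1%:Z w) - b)) =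
      \int[P]_w (B (sv_X V k.+1%:Z w) * B (sv_X V j.+1%:Z w)) - b ^+ 2.
    transitivity (\int[P]_w (B (sv_X V k.+1%:Z w) * B (sv_X V j.+1%:Z w) -
        (b * B (sv_X V k.+1%:Z w) + (b * B (sv_X V j.+1%:Z w) - b ^+ 2)))).
      by apply: eq_Rintegral => w _; ring.
    have h1 i : P.-rint (fun w => b * B (sv_X V i w)) by exact: rintZ.
    have h2 : P.-rint (fun=> b ^+ 2) by exact: rint_cst.
    have h3 i : P.-rint (fun w => b * B (sv_X V i w) - b ^+ 2) by exact: rintB.
    rewrite RintegralTB//; last exact: rintD.
    rewrite RintegralTD// RintegralTB// Rintegral_cstT !RintegralTZ// !stationary_mean -/b.
    ring.
  apply: (le_trans (ler_norm _)); apply: stationary_covariance => //.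
  by rewrite fineK.
Qed.

End mixing.

(** * Combination of the error terms *)

Section assembly.
Context (R : realType).
Notation mu := (@lebesgue_measure R).

Lemma variance_rate_ge0 (p : R) (m : nat) : (0 < m)%N -> 0 <= variance_rate p m.
Proof.
by move=> m0; rewrite addr_ge0// mulr_ge0// ?powR_ge0// ln_ge0// ler1n.
Qed.

(** Only p = 3/2 needs an argument. If m >= 2, then 1 <= ln m / ln 2; if m = 1, then e^(pi^2) times
    the bias rate m e^(-pi^2 m) equals 1, which is at least 1/n. *)
Lemma variance_rate_absorb (p : R) (m n : nat) : (0 < m)%N -> (0 < n)%N ->
  (variance_rate p m + (p == 3 / 2)%:R) / n%:R <=
  (1 + (ln 2)^-1) * variance_rate p m / n%:R +
  expR (pi ^+ 2) * (m%:R * expR (- (pi ^+ 2 * m%:R))).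
Proof.
move=> m0 n0; have n0' : (0 : R) < n%:R by rewrite ltr0n.
have V0 := variance_rate_ge0 p m0.
have ln20 : (0 : R) < ln 2 by rewrite ln_gt0// ltr1n.
have E0 : 0 <= expR (pi ^+ 2) * (m%:R * expR (- (pi ^+ 2 * m%:R))) :> R.
  by rewrite !mulr_ge0// ?expR_ge0.
have a1 : 1 <= 1 + (ln 2)^-1 :> R by rewrite lerDl invr_ge0 ltW.
have [p32|p32] := eqVneq p (3 / 2); last first.
  by rewrite addr0 ler_wpDr// ler_wpM2r ?invr_ge0// ?(ltW n0')// ler_peMl.
have [m1|m1] := leqP m 1.
  have -> : m = 1%N by apply/eqP; rewrite eqn_leq m1.
  rewrite mulr1 mul1r -expRD subrr expR0 /variance_rate p32 !eqxx/= ln1.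
  by rewrite !(mulr0, mul0r, add0r, mulr1) ?mul1r invf_le1// ler1n.
rewrite ler_wpDr// ler_wpM2r ?invr_ge0 ?(ltW n0')// mulrDl mul1r lerD2l/=.
rewrite -(ler_pM2l ln20) mulr1 mulrA mulfV ?lt0r_neq0// mul1r.
rewrite /variance_rate p32 !eqxx/= mulr0 add0r mulr1 ler_ln ?posrE ?ler_nat//.
by rewrite ltr0n.
Qed.

Lemma log_volatility (v y : R) : 0 < v -> y != 0 ->
  ln ((Num.sqrt v * y) ^+ 2) = ln v + ln (y ^+ 2).
Proof.
move=> v0 y0; rewrite exprMn sqr_sqrtr ?(ltW v0)// lnM// posrE.
by rewrite lt0r sqrf_eq0 y0 sqr_ge0.
Qed.

Section probability.
Context d (T : measurableType d) (P : probability T R).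

(** The inequality (x + y + z)^2 <= 3 (x^2 + y^2 + z^2) separates fluctuation, mixing and bias
    without any cross term. [M] provides integrability and does not enter the bound. *)
Lemma mse_three_terms (D Y : nat -> T -> R) (M h b c1 c2 k : R) (n : nat) : (0 < n)%N ->
  (forall j, measurable_fun setT (D j)) -> (forall j w, `|D j w| <= M) ->
  (forall j, measurable_fun setT (Y j)) -> (forall j w, `|Y j w| <= M) ->
  \int[P]_w ((\sum_(j < n) D j w) ^+ 2) <= 2 * n%:R * c1 ->
  \int[P]_w ((\sum_(j < n) (Y j w - b)) ^+ 2) <= 2 * n%:R * c2 ->
  (b - h) ^+ 2 <= k ->
  \int[P]_w ((n%:R^-1 * \sum_(j < n) (D j w + Y j w) - h) ^+ 2) <=
  3 * (2 * c1 / n%:R + (2 * c2 / n%:R + k)).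
Proof.
move=> n0 mD DM mY YM HD HY Hk; have n0' : (0 : R) < n%:R by rewrite ltr0n.
have nn0 : n%:R != 0 :> R by rewrite lt0r_neq0.
have bsq (F : nat -> T -> R) N : (forall j, measurable_fun setT (F j)) ->
    (forall j w, `|F j w| <= N) -> forall c, P.-rint (fun w => (c * (\sum_(j < n) F j w)) ^+ 2).
  move=> mF FN c.
  have mS : measurable_fun setT (fun w => c * \sum_(j < n) F j w).
    by apply: measurable_funM => //; apply: measurable_sum.
  have SN w : `|c * \sum_(j < n) F j w| <= `|c| * (n%:R * N).
    rewrite normrM ler_wpM2l// (le_trans (ler_norm_sum _ _ _))//.
    have -> : n%:R * N = \sum_(j < n) N by rewrite sumr_const card_ord mulr_natl.
    exact: ler_sum.
  apply: (rint_bounded P (M := `|c| * (n%:R * N) * (`|c| * (n%:R * N)))).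
    exact: measurable_funX.
  by move=> w; rewrite expr2 normrM ler_pM.
have mYb j : measurable_fun setT (fun w => Y j w - b) by exact: measurable_funB.
have hD := bsq D M mD DM; have hY : forall c, P.-rint (fun w => (c * \sum_(j < n) (Y j w - b)) ^+ 2).
  apply: (bsq (fun j w => Y j w - b) (M + `|b|)) => // j w.
  by rewrite (le_trans (ler_normB _ _))// lerD.
pose u w := n%:R^-1 * \sum_(j < n) D j w.
pose v w := n%:R^-1 * \sum_(j < n) (Y j w - b).
have E w : n%:R^-1 * \sum_(j < n) (D j w + Y j w) - h = u w + (v w + (b - h)).
  rewrite /u /v sumrB big_split/= sumr_const card_ord -[b *+ n]mulr_natl mulrBr mulKf//.
  rewrite mulrDr; ring.
have E3 (x y z : R) : (x + (y + z)) ^+ 2 <= 3 * (x ^+ 2 + (y ^+ 2 + z ^+ 2)).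
  rewrite -subr_ge0; have -> : 3 * (x ^+ 2 + (y ^+ 2 + z ^+ 2)) - (x + (y + z)) ^+ 2 =
    (x - y) ^+ 2 + (x - z) ^+ 2 + (y - z) ^+ 2 by ring.
  by rewrite !addr_ge0// sqr_ge0.
have hu : P.-rint (fun w => u w ^+ 2) by exact: hD.
have hv : P.-rint (fun w => v w ^+ 2) by exact: hY.
have hvk : P.-rint (fun w => v w ^+ 2 + k) by apply: rintD => //; exact: rint_cst.
have hR : P.-rint (fun w => u w ^+ 2 + (v w ^+ 2 + k)) by exact: rintD.
apply: (@le_trans _ _ (\int[P]_w (3 * (u w ^+ 2 + (v w ^+ 2 + k))))).
  apply: le_RintegralT; last 1 first.
  - move=> w; rewrite E (le_trans (E3 _ _ _))// ler_wpM2l// !lerD2l//.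
  - under eq_fun do rewrite E.
    have mu' : measurable_fun setT u.
      by apply: measurable_funM => //; apply: measurable_sum.
    have mv' : measurable_fun setT v.
      by apply: measurable_funM => //; apply: measurable_sum.
    apply: (@rint_dom _ _ _ P _ (fun w => 3 * (u w ^+ 2 + (v w ^+ 2 + k)))); last exact: rintZ.
      by apply: measurable_funX; apply: measurable_funD => //; apply: measurable_funD.
    move=> w; rewrite ger0_norm ?sqr_ge0// (le_trans (E3 _ _ _))// ler_wpM2l// !lerD2l//.
  - exact: rintZ.
rewrite RintegralTZ// ler_wpM2l//.
rewrite RintegralTD// RintegralTD//; last exact: rint_cst.
rewrite Rintegral_cstT.
have sc (F : T -> R) c : P.-rint (fun w => (1 * F w) ^+ 2) -> \int[P]_w (F w ^+ 2) <= 2 * n%:R * c ->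
    \int[P]_w ((n%:R^-1 * F w) ^+ 2) <= 2 * c / n%:R.
  move=> hF HF; under eq_Rintegral do rewrite exprMn.
  rewrite RintegralTZ; last by under eq_fun do rewrite -[F _]mul1r.
  rewrite -(@ler_pM2l _ (n%:R ^+ 2)) ?exprn_gt0// mulrA -exprMn mulfV// expr1n mul1r.
  by rewrite (le_trans HF)// le_eqVlt; apply/orP; left; apply/eqP; field.
apply: lerD; first exact: (sc (fun w => \sum_(j < n) D j w)).
by rewrite lerD2r; exact: (sc (fun w => \sum_(j < n) (Y j w - b))).
Qed.

End probability.
End assembly.

(** Bookkeeping with c = 1 / (2 pi), i = 1/n, q = m, f the exponential and v the variance rate. The
    two summands 1 make the constants positive; the terms they add are nonnegative. *)
Lemma combine_bounds (R : realFieldType) (c C r v L S M K e q f i : R) :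
  0 <= 6 * c ^+ 2 * C -> r * i <= L * v * i + e * (q * f) -> 0 <= v * i -> 0 <= S * i ->
  3 * (2 * (c ^+ 2 * (C * r)) * i + (2 * (8 * M * M * S) * i + K * q * f)) <=
  (3 * K + 6 * c ^+ 2 * C * e) * q * f + (6 * c ^+ 2 * C * L + 1) * v * i +
    (48 * M * M + 1) * S * i.
Proof.
move=> a0 h v0 S0; have := ler_wpM2l a0 h; rewrite -subr_ge0 => h1; rewrite -subr_ge0.
by apply: (le_trans (addr_ge0 h1 (addr_ge0 v0 S0))); rewrite le_eqVlt; apply/orP; left; apply/eqP; ring.
Qed.

Section bias.
Context (R : realType) d (T : measurableType d) (P : probability T R).

Lemma sqr_mean_diff_le (U W : T -> R) (M k : R) :
  measurable_fun setT U -> measurable_fun setT W -> (forall w, `|U w| <= M) ->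
  (forall w, (W w - U w) ^+ 2 <= k) -> (\int[P]_w U w - \int[P]_w W w) ^+ 2 <= k.
Proof.
move=> mU mW UM Hk.
have d1 w : `|W w - U w| <= Num.sqrt k by rewrite -sqrtr_sqr ler_wsqrtr.
(* A probability space has a point, and evaluating the pointwise bound there shows that k is
   nonnegative. *)
have [w0 _] : exists w0 : T, True.
  apply/not_existsP => h; have := probability_setT P.
  have -> : [set: T] = set0 by apply/seteqP; split => // x _; exact: (h x I).
  by rewrite measure0 => /eqP; rewrite eqe eq_sym oner_eq0.
have k0 : 0 <= k by exact: le_trans (sqr_ge0 _) (Hk w0).
have hU := rint_bounded P mU UM.
have hW : P.-rint W.
  apply: (rint_bounded P (M := Num.sqrt k + M)) => // w.
  by rewrite -[W w](subrK (U w)) (le_trans (ler_normD _ _))// lerD.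
rewrite -sqrrN opprB -RintegralTB// -(sqr_sqrtr k0) -sqr_normr ler_sqr ?nnegrE//.
by apply: norm_Rintegral_bounded => //; exact: measurable_funB.
Qed.

(** A law with a density does not charge 0. This excludes the event where [ln] takes its default
    value and the logarithm of the product fails to split. *)
Lemma gamma_square_neq0 (Y : {RV P >-> R}) (p : R) :
  has_density P (fun w => Y w ^+ 2) (gamma_density p) -> P (Y @^-1` [set 0]) = 0%E.
Proof.
move=> [_ _ /(_ [set 0] (measurable_set1 _))].
rewrite (_ : _ @^-1` _ = Y @^-1` [set 0]) => [->|].
  by rewrite integral_set1.
apply/seteqP; split => w /=; last by move=> ->; rewrite expr0n.
by move=> /eqP; rewrite sqrf_eq0 => /eqP.
Qed.

End bias.

(** * The risk bound *)

Theorem proposition4p1 (R : realType) (d : measure_display)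
    (T : measurableType d) (P : probability T R)
    (V eta : int -> {RV P >-> R}) (g f_eps : R -> R) (p : R)
    (V_gt0 : forall i, {ae P, forall w, 0 < V i w})
    (eta_iid : iid P eta)
    (V_stationary : stationary P V)
    (V_eta_indep : independent_families P V eta)
    (X1_density : has_density P (sv_X V 1) g)
    (eps1_density : has_density P (sv_eps eta 1) f_eps)
    (p_gt0 : 0 < p)
    (eta1_gamma : has_density P (fun w => eta 1 w ^+ 2) (gamma_density p))
    (beta_summable :
       (\sum_(0 <= k <oo) beta_mixing_coef P (sv_X V) k < +oo)%E)
    (lambda : R) (lambda_gt0 : 0 < lambda) :
  exists K K' K'' : R, [/\ 0 < K, 0 < K', 0 < K'' &
    forall m n : nat, (0 < m)%N -> (0 < n)%N ->
      ('E_P[fun w => (Normc.normc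
              (h_hat (sv_Z V eta) f_eps m n lambda w
               - (h_target P V lambda)%:C) ^+ 2)%R]
       <= (K * m%:R * expR (- (pi ^+ 2 * m%:R)))%:E
          + (K' * variance_rate p m / n%:R)%:E
          + K''%:E * (\sum_(0 <= k <oo) beta_mixing_coef P (sv_X V) k)
            * (n%:R^-1)%:E)%E].
Proof.
have [eta_indep eta_id] := eta_iid.
(* The sample starts at time 1, so the natural number k stands for time k + 1. *)
pose X (k : nat) := sv_X V k.+1%:Z; pose e (k : nat) := sv_eps eta k.+1%:Z.
have mX i : measurable_fun setT (sv_X V i) by apply: measurableT_comp => //; exact: measurable_ln.
have me i : measurable_fun setT (sv_eps eta i).
  apply: measurableT_comp; first exact: measurable_ln.
  exact: measurable_funX.
have mX' k : measurable_fun setT (X k) by exact: mX.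
have me' k : measurable_fun setT (e k) by exact: me.
have mY : measurable_fun setT (fun w => eta 1 w ^+ 2) by exact: measurable_funX.
have char t := log_gamma_char t p_gt0 mY eta1_gamma.
have hC t : \int[P]_w cos (t * e 0%N w) = epsC p t by exact: (char t).1.
have hS t : \int[P]_w sin (t * e 0%N w) = epsS p t by exact: (char t).2.
have hf t : fourier f_eps t = epsC p t +i* epsS p t.
  by rewrite (fourier_density t (me 1) eps1_density) -(hC t) -(hS t).
have mlnln : measurable_fun setT (fun z : R * R => (ln z.1, ln z.2)).
  apply: measurable_fun_pair; apply: measurableT_comp => //; exact: measurable_ln.
have msq : measurable_fun setT (fun z : R * R => (ln (z.1 ^+ 2), ln (z.2 ^+ 2))).
  apply: measurable_fun_pair; apply: (measurableT_comp (f := @ln R)) => //;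
    try exact: measurable_ln; exact: measurable_funX.
have Xe j k (A B : set (R * R)) : measurable A -> measurable B ->
    P ((fun w => (X j w, X k w)) @^-1` A `&` (fun w => (e j w, e k w)) @^-1` B) =
    (P ((fun w => (X j w, X k w)) @^-1` A) * P ((fun w => (e j w, e k w)) @^-1` B))%E.
  exact: (independent_families_comp j.+1%:Z k.+1%:Z V_eta_indep mlnln msq).
have mlsq : measurable_fun setT (fun y : R => ln (y ^+ 2)).
  apply: (measurableT_comp (f := @ln R)); [exact: measurable_ln|exact: measurable_funX].
have mpre (A : set R) : measurable A -> measurable ((fun y : R => ln (y ^+ 2)) @^-1` A).
  by move=> mA; rewrite -[X in measurable X]setTI; exact: mlsq.
have ee j k (A B : set R) : j != k -> measurable A -> measurable B ->
    P (e j @^-1` A `&` e k @^-1` B) = (P (e j @^-1` A) * P (e k @^-1` B))%E.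
  move=> jk mA mB.
  by apply: (mutually_independent2 (X := eta) eta_indep _ (mpre A mA) (mpre B mB)).
have law_e k (A : set R) : measurable A -> P (e k @^-1` A) = P (e 0%N @^-1` A).
  by move=> mA; exact: (eta_id k.+1%:Z 1 _ (mpre A mA)).
have [C C0 HC2] := kernel_second_moment p_gt0 lambda_gt0 (me 1) hC hS.
have [Kt Kt0 HKt] := lgI_truncation lambda_gt0.
have pi0 := @pi_gt0 R.
pose c0 : R := (2 * pi)^-1; have c00 : 0 <= c0 by rewrite invr_ge0 mulr_ge0 ?(ltW pi0).
have hCS : (@lebesgue_measure R).-rint (fun t => `|lgC 1 lambda t| + `|lgS 1 lambda t|).
  by apply: rintD; apply: rint_abs; [exact: rint_lgC|exact: rint_lgS].
(* The integral of |psi_lambda^*| over the whole line bounds the truncated one for every m, so the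
   constant of the mixing term is free of m. *)
pose MB := c0 * \int[@lebesgue_measure R]_t (`|lgC 1 lambda t| + `|lgS 1 lambda t|).
have MB0 : 0 <= MB by rewrite mulr_ge0// RintegralT_ge0// => t; rewrite addr_ge0.
pose S := fine (\sum_(0 <= k <oo) beta_mixing_coef P (sv_X V) k)%E.
have Sum0 : (0 <= \sum_(0 <= k <oo) beta_mixing_coef P (sv_X V) k)%E.
  by apply: nneseries_ge0 => k _ _; exact: beta_mixing_coef_ge0.
have S0 : 0 <= S by exact: fine_ge0.
pose a := 6 * c0 ^+ 2 * C; have a0 : 0 <= a by rewrite !mulr_ge0// exprn_ge0.
have ln20 : (0 : R) < ln 2 by rewrite ln_gt0// ltr1n.
have L0 : 0 <= 1 + (ln 2)^-1 :> R by rewrite addr_ge0// invr_ge0 ltW.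
exists (3 * Kt + a * expR (pi ^+ 2)), (a * (1 + (ln 2)^-1) + 1), (48 * MB * MB + 1); split.
- by rewrite ltr_wpDr ?mulr_ge0 ?expR_ge0// mulr_gt0.
- by rewrite ltr_wpDl// mulr_ge0.
- by rewrite ltr_wpDl// mulr_ge0// mulr_ge0.
move=> m n m0 n0; pose A := pi * m%:R : R.
have hre := rint_ker_re p_gt0 lambda_gt0 A; have him := rint_ker_im p_gt0 lambda_gt0 A.
pose H z := c0 * trigT (ker_re p lambda A) (ker_im p lambda A) z.
(* This bound depends on m; it is used for integrability only. *)
pose MH := c0 * \int[@lebesgue_measure R]_t rho (ker_re p lambda A) (ker_im p lambda A) t.
have MH0 : 0 <= MH by rewrite mulr_ge0// RintegralT_ge0// => t; exact: rho_ge0.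
have mT := measurable_trigT hre him.
have mH : measurable_fun setT H by exact: measurable_funM.
have HM z : `|H z| <= MH by rewrite normrM ger0_norm// ler_wpM2l// trigT_le.
have mshift x : measurable_fun setT (fun w => trigT (ker_re p lambda A) (ker_im p lambda A) (x + e 0%N w)).
  by apply: (measurableT_comp mT); apply: measurable_funD => //; exact: me'.
have rshift x : P.-rint (fun w => trigT (ker_re p lambda A) (ker_im p lambda A) (x + e 0%N w)).
  by apply: (rint_bounded P (mshift x)) => w; exact: trigT_le.
set r := variance_rate p m + (p == 3 / 2)%:R.
have HC x : \int[P]_w (H (x + e 0%N w) ^+ 2) <= c0 ^+ 2 * (C * r).
  under eq_Rintegral do rewrite exprMn.
  rewrite RintegralTZ; last first.
    by apply: (rintM (mshift x) (fun w => trigT_le hre him _)).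
  by rewrite ler_wpM2l ?exprn_ge0// HC2.
have r0 : 0 <= r by rewrite addr_ge0// variance_rate_ge0.
pose B := smoothed P e H.
have BE x : B x = c0 * \int[@lebesgue_measure R]_t (\1_(wnd A) t * lgI 1 lambda t x).
  rewrite /B /smoothed RintegralTZ//; congr (_ * _).
  by rewrite (kernel_mean p_gt0 lambda_gt0 (me 1) hC hS).
have BM x : `|B x| <= MB.
  rewrite BE normrM ger0_norm// ler_wpM2l//; apply: le_norm_RintegralT => //.
    by apply: rint_indic; [exact: measurable_wnd|exact: rint_lgI].
  move=> t; apply: (le_trans _ (lgI_le 1 lambda t x)); rewrite normrM ler_piMl//.
  by rewrite indicE ger0_norm// lern1 leq_b1.
have mB : measurable_fun setT B by exact: (measurable_smoothed mX' me' Xe mH HM).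
have flu := fluctuation_sum mX' me' Xe ee law_e mH HM HC n (mulr_ge0 (exprn_ge0 2 c00) (mulr_ge0 C0 r0)).
have mix := mixing_sum (fun i => @measurable_funPT _ _ _ _ (V i)) V_stationary mB BM n beta_summable.
have mV i : measurable_fun setT (V i) by [].
have mw : measurable_fun setT (lgw 1 lambda) by exact: measurable_lgw.
have hE : h_target P V lambda = \int[P]_w lgw 1 lambda (sv_X V 1 w).
  transitivity (\int[P]_w (V 1 w * expR (- (lambda * V 1 w)))); first by rewrite /h_target unlock.
  (* The weight at ln v equals v e^(-lambda v) only for v > 0, which holds almost surely. *)
  apply: ae_eq_RintegralT.
  - apply: measurable_funM => //; apply: measurableT_comp => //; apply: measurableT_comp => //.
    exact: measurable_funM.
  - exact: (measurableT_comp mw).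
  - apply: filterS (V_gt0 1) => w w0.
    by rewrite /lgw /sv_X lnK ?posrE// mul1r expRD lnK ?posrE.
set b := \int[P]_w B (sv_X V 0 w) in mix.
have bias : (b - h_target P V lambda) ^+ 2 <= Kt * m%:R * expR (- (pi ^+ 2 * m%:R)).
  rewrite hE /b -(stationary_mean mV V_stationary mB BM 1).
  apply: sqr_mean_diff_le.
  - exact: (measurableT_comp mB).
  - exact: (measurableT_comp mw).
  - by move=> w; exact: BM.
  - by move=> w; rewrite BE; exact: HKt.
pose M := 2 * MH + MB.
have Dle k w : `|fluctuation P X e H k w| <= M.
  by apply: (le_trans (fluctuation_le P X me' mH HM k w)); rewrite lerDl.
have Yle (k : nat) w : `|B (X k w)| <= M by apply: (le_trans (BM _)); rewrite lerDr mulr_ge0.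
have mD := measurable_fluctuation mX' me' Xe mH HM.
have mY' (k : nat) : measurable_fun setT (fun w => B (X k w)) by exact: (measurableT_comp mB).
have := mse_three_terms n0 mD Dle mY' Yle flu mix bias.
(* A fluctuation plus its conditional mean is H(X_k + e_k) again. *)
under eq_Rintegral do under eq_bigr do rewrite subrK.
rewrite -/S => mse.
have mHsum (U : nat -> T -> R) : (forall k, measurable_fun setT (U k)) ->
    measurable_fun setT (fun w => n%:R^-1 * \sum_(k < n) H (U k w) - h_target P V lambda).
  move=> mU; apply: measurable_funB => //; apply: measurable_funM => //.
  by apply: measurable_sum => k; exact: (measurableT_comp mH).
pose Zh w := n%:R^-1 * \sum_(k < n) H (sv_Z V eta k.+1%:Z w) - h_target P V lambda.
have mZh : measurable_fun setT Zh.
  apply: (mHsum (fun k => sv_Z V eta k.+1%:Z)) => k.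
  apply: measurableT_comp; first exact: measurable_ln.
  apply: measurable_funX; apply: measurable_funM => //.
  apply: measurableT_comp => //; apply: continuous_measurable_fun; exact: sqrt_continuous.
have ZhM w : `|Zh w| <= MH + `|h_target P V lambda|.
  rewrite (le_trans (ler_normB _ _))// lerD2r normrM ger0_norm ?invr_ge0// ler_pdivrMl ?ltr0n//.
  rewrite (le_trans (ler_norm_sum _ _ _))//.
  have -> : n%:R * MH = \sum_(k < n) MH by rewrite sumr_const card_ord mulr_natl.
  by apply: ler_sum => i _; exact: HM.
rewrite (_ : 'E_P[_] = (\int[P]_w (Zh w ^+ 2))%:E)%E; last first.
  rewrite unlock EFin_RintegralT; last first.
    by apply: (rintM mZh ZhM); exact: (rint_bounded P mZh ZhM).
  apply: eq_integral => w _.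
  by rewrite (@h_hat_real R T (sv_Z V eta) f_eps p lambda m n w p_gt0 lambda_gt0 hf) sqr_normc_real.
(* The observations equal signal plus noise only where V is positive and eta is nonzero; the
   exceptional sets are null and countably many. *)
have -> : \int[P]_w (Zh w ^+ 2) =
    \int[P]_w ((n%:R^-1 * \sum_(k < n) H (X k w + e k w) - h_target P V lambda) ^+ 2).
  apply: ae_eq_RintegralT.
  - exact: measurable_funX.
  - apply: measurable_funX; apply: (mHsum (fun k w => X k w + e k w)) => k.
    exact: measurable_funD.
  have aeZ (k : nat) : {ae P, forall w, sv_Z V eta k.+1%:Z w = X k w + e k w}.
    have eta0 : {ae P, forall w, eta k.+1%:Z w != 0}.
      exists (eta k.+1%:Z @^-1` [set 0]); split.
      - by rewrite -[X in measurable X]setTI; exact: measurable_funPT.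
      - by rewrite (eta_id k.+1%:Z 1)// (gamma_square_neq0 eta1_gamma).
      - by move=> w /= /negP; rewrite negbK => /eqP.
    apply: filterS2 (V_gt0 k.+1%:Z) eta0 => w w0 y0.
    exact: log_volatility.
  apply: filterS (ae_foralln aeZ) => w HZ; rewrite /Zh.
  by under eq_bigr do rewrite HZ.
have SE : (\sum_(0 <= k <oo) beta_mixing_coef P (sv_X V) k)%E = S%:E.
  by rewrite fineK// ge0_fin_numE.
rewrite SE -!EFinM -!EFinD lee_fin; apply: (le_trans mse).
have V0 := variance_rate_ge0 p m0.
have n0' : 0 <= n%:R^-1 :> R by rewrite invr_ge0.
apply: combine_bounds => //.
- exact: variance_rate_absorb.
- exact: mulr_ge0.
- exact: mulr_ge0.
Qed.
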